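(* Let $0\le\alpha<1$ and let $T,S\in B(X)$ be commuting operators with $\|e^{itT}\|\le C_T(1+|t|^\alpha)$ and $\|e^{itS}\|\le C_S(1+|t|^\alpha)$ for all $t\in\mathbb{R}$, for some constants $C_T,C_S>0$. Then for every $x\in X$, $$\max\{\|Tx\|,\|Sx\|\}\le\max\{C_T,C_S\}\left[r_{T+iS}(x)+C(\alpha)\,r_{T+iS}(x)^{1-\alpha}\right]\|x\|,$$ where $C(\alpha)=\left(\frac{2}{\pi}\right)^{2-\alpha}\sum_{k\in\mathbb{Z}}|2k+1|^{-(2-\alpha)}$.
   Context: $X$ is a complex Banach space, $B(X)$ the bounded linear operators on $X$. Local spectrum $\sigma_A(x)=\mathbb{C}\setminus\rho_A(x)$, where $\rho_A(x)$ is the set of $\lambda\in\mathbb{C}$ having a neighbourhood $U$ and analytic $u:U\to X$ with $(zI-A)u(z)=x$ on $U$; local spectral radius $r_A(x)=\sup\{|\lambda|:\lambda\in\sigma_A(x)\}$ (with $\sup\emptyset=0$). *)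

(* Defs.v *)
From Stdlib Require Import Reals Lra ZArith.
Open Scope R_scope.

Record Cplx := mkC { Cre : R ; Cim : R }.
Definition Cadd (a b : Cplx) : Cplx := mkC (Cre a + Cre b) (Cim a + Cim b).
Definition Copp (a : Cplx) : Cplx := mkC (- Cre a) (- Cim a).
Definition Csub (a b : Cplx) : Cplx := Cadd a (Copp b).
Definition Cmul (a b : Cplx) : Cplx :=
  mkC (Cre a * Cre b - Cim a * Cim b) (Cre a * Cim b + Cim a * Cre b).
Definition Cnorm (a : Cplx) : R := sqrt (Cre a * Cre a + Cim a * Cim a).
Definition Cof (r : R) : Cplx := mkC r 0.
Definition C0 : Cplx := Cof 0.
Definition C1 : Cplx := Cof 1.
Definition Ci : Cplx := mkC 0 1.
Fixpoint Cpow (a : Cplx) (n : nat) : Cplx :=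
  match n with O => C1 | S m => Cmul a (Cpow a m) end.

Record CBanach := {
  carrier :> Type;
  vzero : carrier;
  vadd : carrier -> carrier -> carrier;
  vopp : carrier -> carrier;
  vscal : Cplx -> carrier -> carrier;
  vnorm : carrier -> R;
  vadd_assoc : forall x y z, vadd x (vadd y z) = vadd (vadd x y) z;
  vadd_comm : forall x y, vadd x y = vadd y x;
  vadd_zero : forall x, vadd x vzero = x;
  vadd_opp : forall x, vadd x (vopp x) = vzero;
  vscal_one : forall x, vscal C1 x = x;
  vscal_assoc : forall a b x, vscal a (vscal b x) = vscal (Cmul a b) x;
  vscal_distr_v : forall a x y, vscal a (vadd x y) = vadd (vscal a x) (vscal a y);
  vscal_distr_c : forall a b x, vscal (Cadd a b) x = vadd (vscal a x) (vscal b x);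
  vnorm_eq0 : forall x, vnorm x = 0 -> x = vzero;
  vnorm_triangle : forall x y, vnorm (vadd x y) <= vnorm x + vnorm y;
  vnorm_scal : forall a x, vnorm (vscal a x) = Cnorm a * vnorm x;
  vcomplete : forall u : nat -> carrier,
    (forall eps, 0 < eps -> exists N, forall m n, (N <= m)%nat -> (N <= n)%nat ->
        vnorm (vadd (u m) (vopp (u n))) < eps) ->
    exists l, forall eps, 0 < eps -> exists N, forall n, (N <= n)%nat ->
        vnorm (vadd (u n) (vopp l)) < eps
}.

Arguments vzero {c}. Arguments vadd {c}. Arguments vopp {c}.
Arguments vscal {c}. Arguments vnorm {c}.

Section Ops.
Variable X : CBanach.

Definition vsub (x y : X) : X := vadd x (vopp y).

Definition vlim (u : nat -> X) (l : X) : Prop :=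
  forall eps, 0 < eps -> exists N, forall n, (N <= n)%nat -> vnorm (vsub (u n) l) < eps.

Definition is_bounded_op (A : X -> X) : Prop :=
  (forall x y, A (vadd x y) = vadd (A x) (A y)) /\
  (forall a x, A (vscal a x) = vscal a (A x)) /\
  (exists M, forall x, vnorm (A x) <= M * vnorm x).

Fixpoint exp_partial (A : X -> X) (t : R) (x : X) (N : nat) : X :=
  match N with
  | O => x
  | S M => vadd (exp_partial A t x M)
                (vscal (Cmul (Cpow (Cmul Ci (Cof t)) (S M)) (Cof (/ INR (fact (S M)))))
                       (Nat.iter (S M) A x))
  end.

Definition exp_it_bound (A : X -> X) (t K : R) : Prop :=
  forall x y, vlim (exp_partial A t x) y -> vnorm y <= K * vnorm x.

Definition Copen (U : Cplx -> Prop) : Prop :=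
  forall z, U z -> exists r, 0 < r /\ forall w, Cnorm (Csub w z) < r -> U w.

Fixpoint pser_partial (a : nat -> X) (z0 z : Cplx) (N : nat) : X :=
  match N with
  | O => vscal (Cpow (Csub z z0) 0) (a O)
  | S M => vadd (pser_partial a z0 z M) (vscal (Cpow (Csub z z0) (S M)) (a (S M)))
  end.

Definition analytic_on (U : Cplx -> Prop) (u : Cplx -> X) : Prop :=
  forall z0, U z0 -> exists r, 0 < r /\ exists a : nat -> X,
    forall z, U z -> Cnorm (Csub z z0) < r -> vlim (pser_partial a z0 z) (u z).

Definition local_resolvent (A : X -> X) (x : X) (lam : Cplx) : Prop :=
  exists U : Cplx -> Prop, Copen U /\ U lam /\
    exists u : Cplx -> X, analytic_on U u /\
      forall z, U z -> vsub (vscal z (u z)) (A (u z)) = x.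

Definition local_spectrum (A : X -> X) (x : X) (lam : Cplx) : Prop :=
  ~ local_resolvent A x lam.

(* r is the local spectral radius r_A(x) = sup {|lam| : lam in sigma_A(x)},
   with sup of the empty set = 0 (adding 0 to the set implements this since
   all |lam| >= 0). *)
Definition is_local_spectral_radius (A : X -> X) (x : X) (r : R) : Prop :=
  is_lub (fun y => y = 0 \/ exists lam, local_spectrum A x lam /\ y = Cnorm lam) r.

End Ops.

Arguments vsub {X}. Arguments vlim {X}. Arguments is_bounded_op {X}.
Arguments exp_partial {X}. Arguments exp_it_bound {X}.
Arguments analytic_on {X}. Arguments local_resolvent {X}.
Arguments local_spectrum {X}. Arguments is_local_spectral_radius {X}.

(* real power s^p for s >= 0, with 0^p = 0 for p > 0 and 0^0 = 1 *)
Definition powR (s p : R) : R :=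
  if Rle_dec s 0 then (if Req_EM_T p 0 then 1 else 0) else Rpower s p.

Definition calpha_term (alpha : R) (k : Z) : R :=
  Rpower (Rabs (2 * IZR k + 1)) (- (2 - alpha)).

(* Main.v *)
(* Write A = T + iS and let r be the local spectral radius of A at x.

   Growth of A^n x. Since T and S have exponentials of growth o(t), (A - l)^2 c = 0 forces
   (A - l) c = 0; hence the Taylor coefficients of a local solution of (z - A) u(z) = x are
   determined by the equation alone, local solutions on |z| > r fit together, and a Cauchy
   estimate gives A^n x = O(s^n) for every s > r.

   Exponential type. For real b, exp(bT) x = exp(-ibS) exp(bA) x, so exp(zT) x has exponential
   type at most s, and T^n x = O(s^n) as well.

   Bernstein inequality. Put t = PI / (2s). Let f be the position after an odd number d of
   steps of the simple random walk on Z from 0, let c be the inverse of the integral of cos^d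
   over [0, PI/2] and P_d(xi) = c E[exp(i f (PI/2 - xi)) / f^2]. Then P_d(0) = 0, P_d'(0) = 1
   and P_d'' = - c sin^d. On x the operator cos(utT), 0 <= u <= 1, is invertible: its inverse
   square is given by the power series of sec^2, which converges on [0, PI/2). As the Fourier
   coefficients of sin^n cos have l^1-norm O(1 / sqrt n), this makes sin^d(utT) x tend to 0
   fast enough, uniformly in u, to give tTx = lim P_d(tT) x. The coefficients of P_d add up to
   at most PI/2 in absolute value and the one at frequency f is at most (2/PI) / f^2; inserting
   the growth of exp(iftT) yields the bound for T, and S is treated through S - iT = -iA. *)

(* As d grows, P_d tends to the triangle wave that equals xi on [-PI/2, PI/2]. The coefficient of
   the wave at an odd frequency f has modulus (2/PI) / f^2, and these add up to PI/2. After division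
   by t = PI / (2s) their sum gives the term s, and the sum weighted by (t |f|)^alpha, finite
   because alpha < 1, gives C(alpha) s^(1 - alpha). The infinite series of the wave is avoided: P_d
   is a trigonometric polynomial that differs from xi by a double integral of c sin^d, so only the
   decay of sin^d has to be proved. The choice d = 4n + 1 comes from a count of powers of n. The
   factor c is bounded by a multiple of n and the growth of the exponentials costs n^alpha, so four
   gains of n^(-1/2) leave n^(-(1 - alpha)). This takes four cosines, hence sec^2 is applied twice.
   Neither contour integrals nor analytic continuation occur: analytic functions are replaced by
   coefficient sequences, and Cauchy estimates are averages over roots of unity. *)
From Coquelicot Require Import Coquelicot.
From Stdlib Require Import Reals ZArith Lra Lia Psatz ssreflect.
From Stdlib Require Import FunctionalExtensionality ClassicalEpsilon Classical.
Require Import Defs.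
Open Scope R_scope.

(** * Complex numbers *)

Lemma Cext (a b : Cplx) : Cre a = Cre b -> Cim a = Cim b -> a = b.
Proof. by case: a b => [a1 a2] [b1 b2] /= -> ->. Qed.

Ltac ceq := apply: Cext; rewrite /C0 /C1 /Csub /Cof /=.

Lemma Cplx_ring_theory : ring_theory C0 C1 Cadd Cmul Csub Copp eq.
Proof. by split; intros; ceq; ring. Qed.
Add Ring Cplx_ring : Cplx_ring_theory.

Lemma CnormE a : Cnorm a = Cmod (Cre a, Cim a).
Proof. by rewrite /Cnorm /Cmod /= !Rmult_1_r. Qed.
Lemma Cnorm_ge0 a : 0 <= Cnorm a.
Proof. exact: sqrt_pos. Qed.
Lemma CnormM a b : Cnorm (Cmul a b) = Cnorm a * Cnorm b.
Proof. by rewrite !CnormE -Cmod_mult. Qed.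
Lemma Cnorm_triangle a b : Cnorm (Cadd a b) <= Cnorm a + Cnorm b.
Proof. by rewrite !CnormE; exact: (Cmod_triangle (Cre a, Cim a) (Cre b, Cim b)). Qed.
Lemma CnormN a : Cnorm (Copp a) = Cnorm a.
Proof. by rewrite /Cnorm /=; f_equal; ring. Qed.
Lemma Cnorm_Cof r : Cnorm (Cof r) = Rabs r.
Proof. by rewrite /Cnorm /= Rmult_0_l Rplus_0_r sqrt_Rsqr_abs. Qed.
Lemma Cnorm1 : Cnorm C1 = 1.
Proof. by rewrite /C1 Cnorm_Cof Rabs_R1. Qed.
Lemma Cnorm0 : Cnorm C0 = 0.
Proof. by rewrite /C0 Cnorm_Cof Rabs_R0. Qed.
Lemma CnormX a n : Cnorm (Cpow a n) = Cnorm a ^ n.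
Proof. elim: n => [|n IH] /=; [exact: Cnorm1 | by rewrite CnormM IH]. Qed.
Lemma CofM a b : Cof (a * b) = Cmul (Cof a) (Cof b).
Proof. by ceq; ring. Qed.
Lemma CofD a b : Cof (a + b) = Cadd (Cof a) (Cof b).
Proof. by ceq; ring. Qed.
Lemma Cof_pow a n : Cof (a ^ n) = Cpow (Cof a) n.
Proof. elim: n => [|n IH] //=. by rewrite CofM IH. Qed.
Lemma Cpow_mul a b n : Cpow (Cmul a b) n = Cmul (Cpow a n) (Cpow b n).
Proof. elim: n => [|n IH] /=; [by ceq; ring | rewrite IH; ring]. Qed.
Lemma Cre_le a : Rabs (Cre a) <= Cnorm a.
Proof.
rewrite /Cnorm -(sqrt_Rsqr_abs (Cre a)); apply: sqrt_le_1_alt.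
by rewrite /Rsqr; nra.
Qed.
Lemma Cim_le a : Rabs (Cim a) <= Cnorm a.
Proof.
rewrite /Cnorm -(sqrt_Rsqr_abs (Cim a)); apply: sqrt_le_1_alt.
by rewrite /Rsqr; nra.
Qed.

Definition Cis (t : R) : Cplx := mkC (cos t) (sin t).
Lemma CisD a b : Cis (a + b) = Cmul (Cis a) (Cis b).
Proof. by ceq; rewrite ?cos_plus ?sin_plus; ring. Qed.
Lemma Cis0 : Cis 0 = C1.
Proof. by rewrite /Cis cos_0 sin_0. Qed.
Lemma Cis_pow t n : Cpow (Cis t) n = Cis (INR n * t).
Proof.
elim: n => [|n IH]; first by rewrite /= Rmult_0_l Cis0.
by rewrite S_INR /= IH -CisD; f_equal; ring.
Qed.
Lemma Cnorm_Cis t : Cnorm (Cis t) = 1.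
Proof.
rewrite /Cnorm /= -[RHS]sqrt_1; f_equal.
by have := sin2_cos2 t; rewrite /Rsqr; lra.
Qed.
Lemma CisK t : Cmul (Cis t) (Cis (- t)) = C1.
Proof. by rewrite -CisD Rplus_opp_r Cis0. Qed.
(** The chord between two points of the unit circle has length [2 |sin ((a - b) / 2)|], and
    [|sin y| <= |y|] by the mean value theorem. *)
Lemma Cis_lipschitz a b : Cnorm (Csub (Cis a) (Cis b)) <= Rabs (a - b).
Proof.
have E : Csub (Cis a) (Cis b) =
  Cmul (Cof (2 * sin ((a - b) / 2))) (Cis ((a + b) / 2 + PI / 2)).
{ ceq; rewrite cos_plus sin_plus cos_PI2 sin_PI2.
  - rewrite -/(Rminus (cos a) (cos b)) form2; lra.
  - rewrite -/(Rminus (sin a) (sin b)) form4; lra. }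
rewrite E CnormM Cnorm_Cis Cnorm_Cof Rmult_1_r Rabs_mult (Rabs_right 2); last lra.
have H x : Rabs (sin x) <= Rabs x.
{ have P y : 0 <= y -> Rabs (sin y) <= y.
  { move=> hy; case: (Req_dec y 0) => [->|hy0]; first by rewrite sin_0 Rabs_R0; lra.
    have [c [E1 _]] := MVT_cor2 sin cos 0 y ltac:(lra)
      (fun c _ => derivable_pt_lim_sin c).
    have -> : sin y = cos c * y by rewrite sin_0 in E1; lra.
    rewrite Rabs_mult (Rabs_right y); last lra.
    have : Rabs (cos c) <= 1 by apply: Rabs_le; apply: COS_bound.
    nra. }
  case: (Rle_dec 0 x) => hx; first by rewrite (Rabs_right x); [exact: P | lra].
  rewrite (Rabs_left x); last lra.
  by rewrite -(Ropp_involutive x) sin_neg Rabs_Ropp Ropp_involutive; apply: P; lra. }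
have := H ((a - b) / 2); rewrite /Rdiv Rabs_mult (Rabs_right (/ 2)); lra.
Qed.

(** * Finite real sums *)

Fixpoint rsum (f : nat -> R) (n : nat) : R :=
  match n with O => 0 | S m => rsum f m + f m end.

Lemma rsumS f n : rsum f (S n) = rsum f n + f n.
Proof. by []. Qed.
Lemma rsum_ext f g n : (forall i, (i < n)%nat -> f i = g i) -> rsum f n = rsum g n.
Proof.
elim: n => [|n IH] H //=; rewrite IH; first by rewrite H; [|lia].
by move=> i hi; apply: H; lia.
Qed.
Lemma rsum_le f g n : (forall i, (i < n)%nat -> f i <= g i) -> rsum f n <= rsum g n.
Proof.
elim: n => [|n IH] H /=; first lra.
have h1 := H n ltac:(lia); have h2 : rsum f n <= rsum g n by apply: IH => i hi; apply: H; lia.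
lra.
Qed.
Lemma rsum0 n : rsum (fun _ => 0) n = 0.
Proof. elim: n => [|n IH] //=; lra. Qed.
Lemma rsum_ge0 f n : (forall i, (i < n)%nat -> 0 <= f i) -> 0 <= rsum f n.
Proof. by move=> H; rewrite -(rsum0 n); apply: rsum_le. Qed.
Lemma rsum_add f g n : rsum (fun i => f i + g i) n = rsum f n + rsum g n.
Proof. elim: n => [|n IH] /=; lra. Qed.
Lemma rsum_scal c f n : rsum (fun i => c * f i) n = c * rsum f n.
Proof. elim: n => [|n IH] /=; [ring | rewrite IH; ring]. Qed.
Lemma rsum_split f n m : rsum f (n + m) = rsum f n + rsum (fun i => f (n + i)%nat) m.
Proof. elim: m => [|m IH]; rewrite ?Nat.add_0_r ?Nat.add_succ_r /=; [ring | rewrite IH; ring]. Qed.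
Lemma rsum_recl f n : rsum f (S n) = f O + rsum (fun i => f (S i)) n.
Proof. elim: n => [|n IH]; [rewrite /=; ring | rewrite [rsum f (S (S n))]/= -/(rsum f (S n)) IH /=; ring]. Qed.
Lemma rsum_mono f n m : (forall i, 0 <= f i) -> (n <= m)%nat -> rsum f n <= rsum f m.
Proof.
move=> H hnm; have -> : m = (n + (m - n))%nat by lia.
rewrite rsum_split; have := rsum_ge0 (fun i => f (n + i)%nat) (m - n) (fun i _ => H _); lra.
Qed.
Lemma rsum_rev f n : rsum (fun i => f (n - 1 - i)%nat) n = rsum f n.
Proof.
elim: n f => [|n IH] f //; rewrite rsum_recl /= Rplus_comm; congr (_ + _).
  by rewrite -IH; apply: rsum_ext => i hi; f_equal; lia.
by f_equal; lia.
Qed.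
(** Both sides run over the pairs of indices with sum below [N], by antidiagonals and by rows. This
    is the reindexing behind every Cauchy product. *)
Lemma rsum_triangle (F : nat -> nat -> R) N :
  rsum (fun k => rsum (fun i => F i (k - i)%nat) (S k)) N =
  rsum (fun i => rsum (F i) (N - i)) N.
Proof.
elim: N => [|N IH] //; rewrite rsumS IH [in RHS]rsumS.
have -> : rsum (fun i => rsum (F i) (S N - i)) N =
  rsum (fun i => rsum (F i) (N - i)) N + rsum (fun i => F i (N - i)%nat) N.
{ rewrite -rsum_add; apply: rsum_ext => i hi.
  by have -> : (S N - i = S (N - i))%nat by lia. }
have -> : (S N - N = 1)%nat by lia.
by rewrite /= Nat.sub_diag; ring.
Qed.

(** For nonnegative terms this is convergence with sum at most [B]; comparing series becomes
    comparing partial sums. *)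
Definition bsum (f : nat -> R) (B : R) := forall n, rsum f n <= B.

Lemma bsum_ge0 f B : bsum f B -> 0 <= B.
Proof. by move=> /(_ O). Qed.
Lemma bsum_scal c f B : 0 <= c -> bsum f B -> bsum (fun n => c * f n) (c * B).
Proof. by move=> hc H n; rewrite rsum_scal; apply: Rmult_le_compat_l. Qed.
Lemma bsum_le f g B : (forall n, f n <= g n) -> bsum g B -> bsum f B.
Proof. by move=> H Hg n; apply: Rle_trans (Hg n); apply: rsum_le. Qed.
Lemma bsum_shift f B N : (forall n, 0 <= f n) -> bsum f B -> bsum (fun n => f (N + n)%nat) B.
Proof.
move=> H0 H n; apply: Rle_trans (H (N + n)%nat).
by rewrite rsum_split; have := rsum_ge0 f N (fun i _ => H0 i); lra.
Qed.
(** The partial sums come within [eps] of their supremum, and no later block can exceed the gap. *)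
Lemma bsum_tail f B eps : (forall n, 0 <= f n) -> bsum f B -> 0 < eps ->
  exists N, forall M, (N <= M)%nat -> bsum (fun n => f (M + n)%nat) eps.
Proof.
move=> H0 H he.
have [l Hl] : {l | is_lub (fun y => exists n, y = rsum f n) l}.
{ apply: completeness; first by exists B => _ [n ->]; exact: H.
  by exists 0; exists O. }
have [N HN] : exists N, l - eps < rsum f N.
{ apply: NNPP => hn; have : l <= l - eps; last lra.
  apply: (proj2 Hl) => _ [n ->]; apply: Rnot_lt_le => hl; apply: hn; by exists n. }
exists N => M hM n.
have h1 : rsum f (M + n) <= l by apply: (proj1 Hl); exists (M + n)%nat.
have h2 := rsum_mono f N M H0 hM.
by rewrite rsum_split in h1; lra.
Qed.
Lemma bsum_geom q : 0 <= q < 1 -> bsum (fun n => q ^ n) (/ (1 - q)).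
Proof.
move=> hq n.
have E : rsum (fun n => q ^ n) n * (1 - q) = 1 - q ^ n by elim: n => [|n IH] /=; [ring | nra].
have h : 0 <= q ^ n by apply: pow_le; lra.
apply: (Rmult_le_reg_r (1 - q)); first lra.
rewrite E Rinv_l; lra.
Qed.

Lemma le_eps_all a b : (forall eps, 0 < eps -> a <= b + eps) -> a <= b.
Proof. move=> H; apply: Rnot_lt_le => h; have := H ((a - b) / 2); lra. Qed.

Fixpoint csum (c : nat -> Cplx) (n : nat) : Cplx :=
  match n with O => C0 | S m => Cadd (csum c m) (c m) end.

Lemma csum_geom z n : Cmul (Csub z C1) (csum (Cpow z) n) = Csub (Cpow z n) C1.
Proof.
elim: n => [|n IH]; first by rewrite /=; ring.
have -> : csum (Cpow z) (S n) = Cadd (csum (Cpow z) n) (Cpow z n) by [].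
have -> : Cmul (Csub z C1) (Cadd (csum (Cpow z) n) (Cpow z n)) =
  Cadd (Cmul (Csub z C1) (csum (Cpow z) n)) (Cmul (Csub z C1) (Cpow z n)) by ring.
by rewrite IH -[Cpow z (S n)]/(Cmul z (Cpow z n)); ring.
Qed.
Lemma Cnorm_eq0 z : Cnorm z = 0 -> z = C0.
Proof.
move=> h; have := Cre_le z; have := Cim_le z; rewrite h => h1 h2.
by ceq; apply: Rabs_eq_0; apply: Rle_antisym; try apply: Rabs_pos.
Qed.
Lemma Cmul_eq0 a b : Cmul a b = C0 -> a <> C0 -> b = C0.
Proof.
move=> h ha; apply: Cnorm_eq0; have := CnormM a b; rewrite h Cnorm0 => E.
have : Cnorm a <> 0 by move=> /Cnorm_eq0.
by move: (Rmult_integral _ _ (eq_sym E)) => [] //.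
Qed.
Lemma Cis_2PI_INR k : Cis (2 * INR k * PI) = C1.
Proof.
rewrite /Cis; have := cos_period 0 k; have := sin_period 0 k.
by rewrite !Rplus_0_l cos_0 sin_0 => -> ->.
Qed.
Lemma Cis_neq1 t : 0 < Rabs t < 2 * PI -> Cis t <> C1.
Proof.
move=> ht [E _].
have E2 : cos t = 1 - 2 * sin (t / 2) * sin (t / 2) by rewrite -cos_2a_sin; congr cos; field.
have E3 : sin (t / 2) = 0 by nra.
have h : 0 < sin (Rabs t / 2) by apply: sin_gt_0; lra.
move: h; rewrite /Rabs; case: Rcase_abs => _; last by lra.
by rewrite (_ : - t / 2 = - (t / 2)); [rewrite sin_neg; lra | field].
Qed.
(** A geometric sum whose ratio is an [N]-th root of unity; [0 < |n - m| < N] keeps the ratio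
    different from 1. *)
Lemma roots_of_unity_sum N n m : (n < N)%nat -> (m < N)%nat -> n <> m ->
  csum (Cpow (Cis (2 * PI * (INR n - INR m) / INR N))) N = C0.
Proof.
move=> hn hm hnm; have hN : 0 < INR N by apply: lt_0_INR; lia.
set t := 2 * PI * (INR n - INR m) / INR N.
have PI0 := PI_RGT_0.
apply: (Cmul_eq0 (Csub (Cis t) C1)).
  rewrite csum_geom Cis_pow.
  have -> : INR N * t = 2 * INR n * PI + - (2 * INR m * PI) by rewrite /t; field; lra.
  rewrite CisD Cis_2PI_INR.
  have := CisK (2 * INR m * PI); rewrite Cis_2PI_INR => E.
  have -> : Cis (- (2 * INR m * PI)) = Cmul C1 (Cis (- (2 * INR m * PI))) by ring.
  by rewrite E; ring.
move=> E; have : Cis t <> C1; last first.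
  apply; have -> : Cis t = Cadd (Csub (Cis t) C1) C1 by ring.
  by rewrite E; ring.
apply: Cis_neq1.
have Et : Rabs t = 2 * PI * Rabs (INR n - INR m) / INR N.
{ have hi := Rinv_0_lt_compat _ hN.
  have -> : t = (2 * PI * / INR N) * (INR n - INR m) by rewrite /t; field; lra.
  rewrite Rabs_mult (Rabs_right (2 * PI * / INR N)); first by field; lra.
  by apply: Rle_ge; apply: Rmult_le_pos; lra. }
have h1 : 0 < Rabs (INR n - INR m).
{ by apply: Rabs_pos_lt => h; apply: hnm; apply: INR_eq; lra. }
have h2 : Rabs (INR n - INR m) < INR N.
{ have := pos_INR n; have := pos_INR m; have := lt_INR _ _ hn; have := lt_INR _ _ hm => *.
  by apply: Rabs_def1; lra. }
rewrite Et; split; first by apply: Rdiv_lt_0_compat => //; nra.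
apply: (Rmult_lt_reg_r (INR N)) => //; rewrite /Rdiv Rmult_assoc Rinv_l; [nra | lra].
Qed.

Lemma exp_le x y : x <= y -> exp x <= exp y.
Proof. by move=> [h|->]; [apply: Rlt_le; apply: exp_increasing | lra]. Qed.

(** * Identities, norms and limits in a complex Banach space *)

Section Vectors.
Context {X : CBanach}.
Implicit Types (x y z : X) (a b : Cplx).

Lemma vadd_zero_l x : vadd vzero x = x.
Proof. by rewrite vadd_comm vadd_zero. Qed.
Lemma vadd_cancel x y z : vadd x y = vadd x z -> y = z.
Proof.
move=> H; rewrite -(vadd_zero_l y) -(vadd_zero_l z) -(vadd_opp X x) (vadd_comm X x).
by rewrite -!vadd_assoc H.
Qed.
Lemma vscal0 x : vscal C0 x = vzero.
Proof.
apply: (vadd_cancel (vscal C0 x)); rewrite vadd_zero -vscal_distr_c.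
by congr vscal; ring.
Qed.
Lemma vscalz a : vscal a (vzero : X) = vzero.
Proof. by apply: (vadd_cancel (vscal a vzero)); rewrite vadd_zero -vscal_distr_v vadd_zero. Qed.
Lemma voppE x : vopp x = vscal (Copp C1) x.
Proof.
apply: (vadd_cancel x); rewrite vadd_opp -{1}(vscal_one X x) -vscal_distr_c.
by rewrite -(vscal0 x); congr vscal; ring.
Qed.

(* The square-zero extension of the scalars by X is a commutative ring containing X, so
   module identities in X become ring identities there. *)
Definition szext := (Cplx * X)%type.
Definition sz_add (u v : szext) : szext := (Cadd (fst u) (fst v), vadd (snd u) (snd v)).
Definition sz_mul (u v : szext) : szext :=
  (Cmul (fst u) (fst v), vadd (vscal (fst u) (snd v)) (vscal (fst v) (snd u))).
Definition sz_opp (u : szext) : szext := (Copp (fst u), vopp (snd u)).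
Definition sz_sub (u v : szext) : szext := sz_add u (sz_opp v).
Definition sz_sca (c : Cplx) : szext := (c, vzero).
Definition sz_vec (x : X) : szext := (C0, x).

Lemma sz_ring_theory :
  ring_theory (sz_sca C0) (sz_sca C1) sz_add sz_mul sz_sub sz_opp eq.
Proof.
split.
- by move=> [c x]; rewrite /sz_add /= vadd_zero_l; congr pair; ring.
- by move=> [c x] [d y]; rewrite /sz_add /= vadd_comm; congr pair; ring.
- by move=> [c x] [d y] [e z]; rewrite /sz_add /= vadd_assoc; congr pair; ring.
- by move=> [c x]; rewrite /sz_mul /= vscal_one vscalz vadd_zero; congr pair; ring.
- by move=> [c x] [d y]; rewrite /sz_mul /= vadd_comm; congr pair; ring.
- move=> [c x] [d y] [e z]; rewrite /sz_mul /=; congr pair; first ring.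
  rewrite !vscal_distr_v !vscal_assoc -!vadd_assoc; congr vadd; congr vadd.
  + by congr vscal; ring.
  + by congr vscal; ring.
- move=> [c x] [d y] [e z]; rewrite /sz_mul /sz_add /=; congr pair; first ring.
  rewrite !vscal_distr_v vscal_distr_c -!vadd_assoc; congr vadd.
  by rewrite !vadd_assoc; congr vadd; rewrite vadd_comm.
- by [].
- by move=> [c x]; rewrite /sz_add /= vadd_opp; congr pair; ring.
Qed.
Add Ring sz_ring : sz_ring_theory.

Lemma sz_vec_inj x y : sz_vec x = sz_vec y -> x = y.
Proof. by case. Qed.
Lemma sz_vec_add x y : sz_vec (vadd x y) = sz_add (sz_vec x) (sz_vec y).
Proof. by rewrite /sz_vec /sz_add /=; congr pair; ring. Qed.
Lemma sz_vec_opp x : sz_vec (vopp x) = sz_opp (sz_vec x).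
Proof. by rewrite /sz_vec /sz_opp /=; congr pair; ring. Qed.
Lemma sz_vec_sub x y : sz_vec (vsub x y) = sz_sub (sz_vec x) (sz_vec y).
Proof. by rewrite /vsub sz_vec_add sz_vec_opp. Qed.
Lemma sz_vec_zero : sz_vec vzero = sz_sca C0.
Proof. by []. Qed.
Lemma sz_vec_scal a x : sz_vec (vscal a x) = sz_mul (sz_sca a) (sz_vec x).
Proof. by rewrite /sz_vec /sz_mul /sz_sca /= vscal0 vadd_zero; congr pair; ring. Qed.
Lemma sz_sca_add a b : sz_sca (Cadd a b) = sz_add (sz_sca a) (sz_sca b).
Proof. by rewrite /sz_sca /sz_add /= vadd_zero. Qed.
Lemma sz_sca_opp a : sz_sca (Copp a) = sz_opp (sz_sca a).
Proof. by rewrite /sz_sca /sz_opp /= voppE vscalz. Qed.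
Lemma sz_sca_sub a b : sz_sca (Csub a b) = sz_sub (sz_sca a) (sz_sca b).
Proof. by rewrite /Csub sz_sca_add sz_sca_opp. Qed.
Lemma sz_sca_mul a b : sz_sca (Cmul a b) = sz_mul (sz_sca a) (sz_sca b).
Proof. by rewrite /sz_sca /sz_mul /= !vscalz vadd_zero. Qed.

Definition szE := (sz_vec_add, sz_vec_opp, sz_vec_sub, sz_vec_zero, sz_vec_scal,
  sz_sca_add, sz_sca_opp, sz_sca_sub, sz_sca_mul).
Ltac vring := apply: sz_vec_inj; rewrite ?szE; ring.

Lemma vnorm_zero : vnorm (vzero : X) = 0.
Proof. by rewrite -(vscal0 vzero) vnorm_scal Cnorm0; ring. Qed.
Lemma vnorm_opp x : vnorm (vopp x) = vnorm x.
Proof. by rewrite voppE vnorm_scal CnormN Cnorm1; ring. Qed.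
Lemma vnorm_ge0 x : 0 <= vnorm x.
Proof. by have := vnorm_triangle X x (vopp x); rewrite vadd_opp vnorm_zero vnorm_opp; lra. Qed.
Lemma vnorm_sub x y : vnorm (vsub x y) <= vnorm x + vnorm y.
Proof. by rewrite -(vnorm_opp y); apply: vnorm_triangle. Qed.
Lemma vnorm_subC x y : vnorm (vsub x y) = vnorm (vsub y x).
Proof. by rewrite -vnorm_opp; congr vnorm; vring. Qed.
Lemma vnorm_split x y : vnorm x <= vnorm y + vnorm (vsub x y).
Proof. have E : x = vadd y (vsub x y) by vring. rewrite {1}E; apply: vnorm_triangle. Qed.
Lemma vnorm_dist x y z : vnorm (vsub x z) <= vnorm (vsub x y) + vnorm (vsub y z).
Proof. by have -> : vsub x z = vadd (vsub x y) (vsub y z) by [vring]; apply: vnorm_triangle. Qed.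
Lemma vsub_addl x y : vsub (vadd x y) x = y.
Proof. vring. Qed.
Lemma vsub_eq0 x y : vsub x y = vzero -> x = y.
Proof. by move=> H; have -> : x = vadd (vsub x y) y by [vring]; rewrite H vadd_zero_l. Qed.
Lemma vnorm_small0 x : (forall eps, 0 < eps -> vnorm x <= eps) -> x = vzero.
Proof.
move=> H; apply: vnorm_eq0; apply: Rle_antisym (vnorm_ge0 x).
by apply: le_eps_all => eps he; have := H eps he; lra.
Qed.

Implicit Types (u v : nat -> X).

Lemma vlim_unique u (l m : X) : vlim u l -> vlim u m -> l = m.
Proof.
move=> H1 H2; apply: vsub_eq0; apply: vnorm_small0 => eps he.
have [N1 h1] := H1 (eps / 2) ltac:(lra); have [N2 h2] := H2 (eps / 2) ltac:(lra).
have := h1 (N1 + N2)%nat ltac:(lia); have := h2 (N1 + N2)%nat ltac:(lia).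
have := vnorm_dist l (u (N1 + N2)%nat) m; rewrite (vnorm_subC l (u _)); lra.
Qed.
Lemma vlim_norm_le u (l : X) B N : vlim u l -> (forall n, (N <= n)%nat -> vnorm (u n) <= B) -> vnorm l <= B.
Proof.
move=> H h; apply: le_eps_all => eps he; have [M hM] := H eps he.
have := hM (M + N)%nat ltac:(lia); have := h (M + N)%nat ltac:(lia).
have := vnorm_split l (u (M + N)%nat); rewrite (vnorm_subC l (u _)); lra.
Qed.
Lemma vlim_sub_const u (l c : X) : vlim u l -> vlim (fun n => vsub (u n) c) (vsub l c).
Proof.
move=> H eps he; have [N hN] := H eps he; exists N => n hn.
by have -> : vsub (vsub (u n) c) (vsub l c) = vsub (u n) l by [vring]; apply: hN.
Qed.
Lemma vlim_add u v (l m : X) : vlim u l -> vlim v m -> vlim (fun n => vadd (u n) (v n)) (vadd l m).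
Proof.
move=> H1 H2 eps he.
have [N1 h1] := H1 (eps / 2) ltac:(lra); have [N2 h2] := H2 (eps / 2) ltac:(lra).
exists (N1 + N2)%nat => n hn; have := h1 n ltac:(lia); have := h2 n ltac:(lia).
have -> : vsub (vadd (u n) (v n)) (vadd l m) = vadd (vsub (u n) l) (vsub (v n) m) by [vring].
by have := vnorm_triangle X (vsub (u n) l) (vsub (v n) m); lra.
Qed.
Lemma vlim_shift u (l : X) : vlim u l -> vlim (fun n => u (S n)) l.
Proof. by move=> H eps he; have [N hN] := H eps he; exists N => n hn; apply: hN; lia. Qed.
Lemma vlim_unshift u (l : X) : vlim (fun n => u (S n)) l -> vlim u l.
Proof.
move=> H eps he; have [N hN] := H eps he; exists (S N); case=> [|n] hn; first lia.
by apply: hN; lia.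
Qed.
Lemma vlim_small u v (l : X) : vlim u l ->
  (forall eps, 0 < eps -> exists N, forall n, (N <= n)%nat -> vnorm (vsub (v n) (u n)) <= eps) ->
  vlim v l.
Proof.
move=> H1 H2 eps he.
have [N1 h1] := H1 (eps / 2) ltac:(lra); have [N2 h2] := H2 (eps / 3) ltac:(lra).
exists (N1 + N2)%nat => n hn; have := h1 n ltac:(lia); have := h2 n ltac:(lia).
by have := vnorm_dist (v n) (u n) l; lra.
Qed.

(** * Bounded operators *)

Implicit Types (A : X -> X).
Definition opbound (A : X -> X) M := 0 <= M /\ forall x, vnorm (A x) <= M * vnorm x.

Lemma bop_bound A : is_bounded_op A -> exists M, opbound A M.
Proof.
case=> _ [_ [M hM]]; exists (Rabs M); split; first exact: Rabs_pos.
move=> x; apply: Rle_trans (hM x) _; apply: Rmult_le_compat_r; [exact: vnorm_ge0 | exact: Rle_abs].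
Qed.
Lemma bop_add A : is_bounded_op A -> forall x y, A (vadd x y) = vadd (A x) (A y).
Proof. by case. Qed.
Lemma bop_scal A : is_bounded_op A -> forall a x, A (vscal a x) = vscal a (A x).
Proof. by case=> _ []. Qed.
Lemma bop_zero A : is_bounded_op A -> A vzero = vzero.
Proof. move=> hA; rewrite -(vscal0 vzero) (bop_scal _ hA) !vscal0. done. Qed.
Lemma bop_opp A : is_bounded_op A -> forall x, A (vopp x) = vopp (A x).
Proof. by move=> hA x; rewrite !voppE (bop_scal _ hA). Qed.
Lemma bop_sub A : is_bounded_op A -> forall x y, A (vsub x y) = vsub (A x) (A y).
Proof. by move=> hA x y; rewrite /vsub (bop_add _ hA) (bop_opp _ hA). Qed.

Definition opD (A B : X -> X) : X -> X := fun x => vadd (A x) (B x).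
Definition opZ a (A : X -> X) : X -> X := fun x => vscal a (A x).
Definition opI : X -> X := fun x => x.

Lemma bop_opD (A B : X -> X) : is_bounded_op A -> is_bounded_op B -> is_bounded_op (opD A B).
Proof.
move=> hA hB; split; last split.
- by move=> x y; rewrite /opD (bop_add _ hA) (bop_add _ hB); vring.
- by move=> a x; rewrite /opD (bop_scal _ hA) (bop_scal _ hB); vring.
have [M [_ hM]] := bop_bound A hA; have [N [_ hN]] := bop_bound B hB; exists (M + N) => x.
by have := vnorm_triangle X (A x) (B x); have := hM x; have := hN x; rewrite /opD; lra.
Qed.
Lemma opbound_opZ a A M : opbound A M -> opbound (opZ a A) (Cnorm a * M).
Proof.
move=> [h0 h]; split; first by have := Cnorm_ge0 a; nra.
move=> x; rewrite /opZ vnorm_scal Rmult_assoc.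
by apply: Rmult_le_compat_l (Cnorm_ge0 a) (h x).
Qed.
Lemma bop_opZ a A : is_bounded_op A -> is_bounded_op (opZ a A).
Proof.
move=> hA; split; last split.
- by move=> x y; rewrite /opZ (bop_add _ hA); vring.
- by move=> b x; rewrite /opZ (bop_scal _ hA); vring.
have [M hM] := bop_bound A hA; exists (Cnorm a * M); exact: (proj2 (opbound_opZ a A M hM)).
Qed.
Lemma bop_opI : is_bounded_op opI.
Proof. by do 2 (split; first by []); exists 1 => x; rewrite /opI; lra. Qed.
Lemma bop_iter A n : is_bounded_op A -> is_bounded_op (Nat.iter n A).
Proof.
move=> hA; elim: n => [|n IH] /=; first exact: bop_opI.
split; last split.
- by move=> x y; rewrite /= (bop_add _ IH) (bop_add _ hA).
- by move=> b x; rewrite /= (bop_scal _ IH) (bop_scal _ hA).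
have [M [h0 hM]] := bop_bound A hA; have [N [_ hN]] := bop_bound _ IH; exists (M * N) => x /=.
by have := hM (Nat.iter n A x); have := hN x; nra.
Qed.
Lemma opbound_iter A M n x : opbound A M -> vnorm (Nat.iter n A x) <= M ^ n * vnorm x.
Proof.
move=> [h0 h]; elim: n => [|n IH] /=; first lra.
by apply: Rle_trans (h _) _; rewrite Rmult_assoc; apply: Rmult_le_compat_l.
Qed.
Definition opcomm (A B : X -> X) := forall x, A (B x) = B (A x).
Lemma opcomm_iter (A B : X -> X) n : opcomm A B -> opcomm A (Nat.iter n B).
Proof. move=> h x; elim: n => [|n IH] //=. by rewrite h IH. Qed.
Lemma iter_comm A n x : Nat.iter n A (A x) = A (Nat.iter n A x).
Proof. by elim: n => [|n IH] //=; rewrite IH. Qed.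
Lemma iter_opZ a A n x : is_bounded_op A -> Nat.iter n (opZ a A) x = vscal (Cpow a n) (Nat.iter n A x).
Proof.
move=> hA; elim: n => [|n IH] /=; first by rewrite vscal_one.
by rewrite IH /opZ (bop_scal _ hA); vring.
Qed.
Lemma vlim_bop A u (l : X) : is_bounded_op A -> vlim u l -> vlim (fun n => A (u n)) (A l).
Proof.
move=> hA H eps he; have [M [h0 hM]] := bop_bound A hA.
have he' : 0 < eps / (M + 1) by apply: Rdiv_lt_0_compat; lra.
have [N hN] := H _ he'; exists N => n hn; rewrite -(bop_sub _ hA).
apply: Rle_lt_trans (hM _) _; have h1 := hN n hn; have h2 := vnorm_ge0 (vsub (u n) l).
have E : (M + 1) * (eps / (M + 1)) = eps by field; lra.
nra.
Qed.

(** * Absolutely convergent series *)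

Fixpoint vsum u (n : nat) : X := match n with O => vzero | S m => vadd (vsum u m) (u m) end.

Lemma vsumS u n : vsum u (S n) = vadd (vsum u n) (u n).
Proof. by []. Qed.
Lemma vsum_ext u v n : (forall i, (i < n)%nat -> u i = v i) -> vsum u n = vsum v n.
Proof.
elim: n => [|n IH] H //=; rewrite IH; first by rewrite H; [|lia].
by move=> i hi; apply: H; lia.
Qed.
Lemma vsum_norm u n : vnorm (vsum u n) <= rsum (fun i => vnorm (u i)) n.
Proof.
elim: n => [|n IH] /=; first by rewrite vnorm_zero; lra.
by have := vnorm_triangle X (vsum u n) (u n); lra.
Qed.
Lemma vsum_add u v n : vsum (fun i => vadd (u i) (v i)) n = vadd (vsum u n) (vsum v n).
Proof. by elim: n => [|n IH] /=; [vring | rewrite IH; vring]. Qed.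
Lemma vsum_bop A u n : is_bounded_op A -> A (vsum u n) = vsum (fun i => A (u i)) n.
Proof. by move=> hA; elim: n => [|n IH] /=; [exact: bop_zero | rewrite (bop_add _ hA) IH]. Qed.
Lemma vsum_scal a u n : vscal a (vsum u n) = vsum (fun i => vscal a (u i)) n.
Proof. by elim: n => [|n IH] /=; [vring | rewrite -IH; vring]. Qed.
Lemma vsum_sub u v n : vsum (fun i => vsub (u i) (v i)) n = vsub (vsum u n) (vsum v n).
Proof. by elim: n => [|n IH] /=; [vring | rewrite IH; vring]. Qed.
Lemma vsum_split u n m : vsum u (n + m) = vadd (vsum u n) (vsum (fun i => u (n + i)%nat) m).
Proof. elim: m => [|m IH]; rewrite ?Nat.add_0_r ?Nat.add_succ_r /=; [vring | rewrite IH; vring]. Qed.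
Lemma vsum_recl u n : vsum u (S n) = vadd (u O) (vsum (fun i => u (S i)) n).
Proof. elim: n => [|n IH]; [rewrite /=; vring | rewrite [vsum u (S (S n))]vsumS IH vsumS; vring]. Qed.
Lemma vsum_scalr (c : nat -> Cplx) x n : vsum (fun i => vscal (c i) x) n = vscal (csum c n) x.
Proof. by elim: n => [|n IH] /=; [vring | rewrite IH; vring]. Qed.
Lemma vsum_single u n N : (n < N)%nat -> (forall i, (i < N)%nat -> i <> n -> u i = vzero) -> vsum u N = u n.
Proof.
elim: N => [|N IH] hn H; first lia.
rewrite vsumS; case: (Nat.eq_dec n N) => [E|hne].
  rewrite E; have -> : vsum u N = vsum (fun _ => vzero) N.
  { by apply: vsum_ext => i hi; apply: H; lia. }
  have -> : vsum (fun _ => vzero) N = vzero by elim: (N) => [|k IHk] //=; rewrite IHk; vring.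
  vring.
by rewrite IH; [rewrite (H N); [vring | lia | lia] | lia | move=> i hi; apply: H; lia].
Qed.
Lemma vsum_exchange (F : nat -> nat -> X) n m :
  vsum (fun i => vsum (F i) m) n = vsum (fun j => vsum (fun i => F i j) n) m.
Proof.
elim: n => [|n IH] /=; first by elim: m => [|m IHm] //=; rewrite -IHm; vring.
by rewrite IH -vsum_add.
Qed.
Lemma vsum_triangle (F : nat -> nat -> X) N :
  vsum (fun k => vsum (fun i => F i (k - i)%nat) (S k)) N =
  vsum (fun i => vsum (F i) (N - i)) N.
Proof.
elim: N => [|N IH] //; rewrite vsumS IH [in RHS]vsumS.
have -> : vsum (fun i => vsum (F i) (S N - i)) N =
  vadd (vsum (fun i => vsum (F i) (N - i)) N) (vsum (fun i => F i (N - i)%nat) N).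
{ rewrite -vsum_add; apply: vsum_ext => i hi.
  by have -> : (S N - i = S (N - i))%nat by lia. }
have -> : (S N - N = 1)%nat by lia.
by rewrite /= Nat.sub_diag; vring.
Qed.

Definition absum u := exists B, bsum (fun n => vnorm (u n)) B.
(** A total choice of the limit, so that sums can be written before convergence is known; the value
    is meaningful when the partial sums converge. *)
Definition vtot u : X := epsilon (inhabits vzero) (fun l => vlim (vsum u) l).

Lemma absum_lim u : absum u -> vlim (vsum u) (vtot u).
Proof.
move=> [B hB]; apply: (epsilon_spec (inhabits vzero) (fun l => vlim (vsum u) l)).
apply: vcomplete => eps he.
have [N hN] := bsum_tail _ _ (eps / 2) (fun n => vnorm_ge0 (u n)) hB ltac:(lra).
have H : forall m n, (N <= m)%nat -> (m <= n)%nat -> vnorm (vsub (vsum u n) (vsum u m)) < eps.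
{ move=> m n hm hn; have -> : (n = m + (n - m))%nat by lia.
  rewrite vsum_split.
  rewrite vsub_addl.
  have := vsum_norm (fun i => u (m + i)%nat) (n - m); have := hN m hm (n - m)%nat; lra. }
exists N => m n hm hn; case: (Nat.le_ge_cases m n) => h.
  by rewrite -/(vsub _ _) vnorm_subC; apply: H.
exact: H.
Qed.
Lemma vtot_unique u (l : X) : vlim (vsum u) l -> vtot u = l.
Proof.
move=> H; apply: (vlim_unique (vsum u)); last exact: H.
by apply: (epsilon_spec (inhabits vzero) (fun l => vlim (vsum u) l)); exists l.
Qed.
Lemma absum_le u f B : (forall n, vnorm (u n) <= f n) -> bsum f B -> absum u.
Proof. by move=> h1 h2; exists B; apply: bsum_le h2. Qed.
Lemma vtot_norm u B : bsum (fun n => vnorm (u n)) B -> vnorm (vtot u) <= B.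
Proof.
move=> h; apply: (vlim_norm_le (vsum u) _ _ 0); first by apply: absum_lim; exists B.
by move=> n _; apply: Rle_trans (vsum_norm _ _) (h n).
Qed.
Lemma vtot_tail u B N : absum u -> bsum (fun n => vnorm (u (N + n)%nat)) B ->
  vnorm (vsub (vtot u) (vsum u N)) <= B.
Proof.
move=> h1 h2; have := vlim_sub_const _ _ (vsum u N) (absum_lim u h1).
move/vlim_norm_le => /(_ B N); apply=> n hn; have -> : (n = N + (n - N))%nat by lia.
rewrite vsum_split; rewrite vsub_addl.
by apply: Rle_trans (vsum_norm _ _) (h2 _).
Qed.
Lemma absum_add u v : absum u -> absum v -> absum (fun n => vadd (u n) (v n)).
Proof.
move=> [B hB] [D hD]; exists (B + D) => n; apply: Rle_trans (Rplus_le_compat _ _ _ _ (hB n) (hD n)).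
by rewrite -rsum_add; apply: rsum_le => i _; apply: vnorm_triangle.
Qed.
Lemma absum_bop A u : is_bounded_op A -> absum u -> absum (fun n => A (u n)).
Proof.
move=> hA [B hB]; have [M [h0 hM]] := bop_bound A hA.
by exists (M * B); apply: bsum_le (bsum_scal M _ _ h0 hB) => n /=.
Qed.
Lemma absum_scal a u : absum u -> absum (fun n => vscal a (u n)).
Proof. exact: (absum_bop (opZ a opI)) (bop_opZ a _ bop_opI). Qed.
Lemma absum_shift u : absum u -> absum (fun n => u (S n)).
Proof. by move=> [B hB]; exists B; apply: (bsum_shift _ _ 1%nat) hB => n; apply: vnorm_ge0. Qed.
Lemma absum_unshift u : absum (fun n => u (S n)) -> absum u.
Proof.
move=> [B hB]; exists (vnorm (u O) + B); case=> [|n].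
  by have := hB O; have := vnorm_ge0 (u O) => /=; lra.
by rewrite rsum_recl; have := hB n; lra.
Qed.
Lemma vtot_add u v : absum u -> absum v -> vtot (fun n => vadd (u n) (v n)) = vadd (vtot u) (vtot v).
Proof.
move=> hu hv; apply: vtot_unique; have := vlim_add _ _ _ _ (absum_lim u hu) (absum_lim v hv).
by congr vlim; apply: functional_extensionality => n; rewrite vsum_add.
Qed.
Lemma vtot_bop A u : is_bounded_op A -> absum u -> vtot (fun n => A (u n)) = A (vtot u).
Proof.
move=> hA hu; apply: vtot_unique; have := vlim_bop _ _ _ hA (absum_lim u hu).
by congr vlim; apply: functional_extensionality => n; rewrite vsum_bop.
Qed.
Lemma vtot_scal a u : absum u -> vtot (fun n => vscal a (u n)) = vscal a (vtot u).
Proof. exact: (vtot_bop (opZ a opI)) (bop_opZ a _ bop_opI). Qed.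
Lemma vtot_recl u : absum u -> vtot u = vadd (u O) (vtot (fun n => u (S n))).
Proof.
move=> hu; apply: vtot_unique; apply: vlim_unshift.
have := vlim_sub_const _ _ (vopp (u O)) (absum_lim _ (absum_shift _ hu)).
rewrite (_ : vsub (vtot _) _ = vadd (u O) (vtot (fun n => u (S n)))); last by vring.
congr vlim; apply: functional_extensionality => n; rewrite vsum_recl; vring.
Qed.
Lemma vtot_finite u N : (forall n, (N <= n)%nat -> u n = vzero) -> vtot u = vsum u N.
Proof.
move=> H; apply: vtot_unique => eps he; exists N => n hn.
have -> : (n = N + (n - N))%nat by lia.
rewrite vsum_split.
have -> : vsum (fun i => u (N + i)%nat) (n - N) = vzero.
{ elim: (n - N)%nat => [|k IH] //=; rewrite IH H; [vring | lia]. }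
rewrite vsub_addl.
by rewrite vnorm_zero.
Qed.

(** Up to [M], the antidiagonal sums are sums of truncated rows. The product majorant makes the
    truncation error of the early rows small through [g], and the contribution of the late rows
    small through [f]. *)
Lemma vtot_fubini (F : nat -> nat -> X) (f g : nat -> R) Bf Bg :
  (forall n, 0 <= f n) -> (forall n, 0 <= g n) -> bsum f Bf -> bsum g Bg ->
  (forall i j, vnorm (F i j) <= f i * g j) ->
  vlim (vsum (fun k => vsum (fun i => F i (k - i)%nat) (S k))) (vtot (fun i => vtot (F i))).
Proof.
move=> f0 g0 hf hg hF; have Bf0 := bsum_ge0 _ _ hf; have Bg0 := bsum_ge0 _ _ hg.
have hFi i : bsum (fun j => vnorm (F i j)) (f i * Bg).
{ by apply: bsum_le (bsum_scal (f i) _ _ (f0 i) hg). }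
have hFa i : absum (F i) by exists (f i * Bg).
have hrow : absum (fun i => vtot (F i)).
{ apply: (absum_le _ (fun i => Bg * f i) (Bg * Bf)); last exact: bsum_scal.
  by move=> n; rewrite Rmult_comm; apply: vtot_norm. }
apply: vlim_small (absum_lim _ hrow) _ => eps he.
(* The two errors below are at most [e * Bf] and [Bg * e]. *)
have he1 : 0 < eps / (Bf + Bg + 1) by apply: Rdiv_lt_0_compat; lra.
set e := eps / (Bf + Bg + 1) in he1.
have Ee : e * (Bf + Bg + 1) = eps by rewrite /e; field; lra.
have [N1 h1] := bsum_tail g _ _ g0 hg he1; have [N2 h2] := bsum_tail f _ _ f0 hf he1.
set N := (N1 + N2)%nat.
have hgt : forall M, (N <= M)%nat -> bsum (fun n => g (M + n)%nat) e by move=> M hM; apply: h1; lia.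
have hft : bsum (fun n => f (N + n)%nat) e by apply: h2; lia.
(* With [M >= 2 N], each of the first [N] rows keeps at least [N] terms. *)
exists (N + N)%nat => M hM.
rewrite vsum_triangle -vsum_sub.
apply: Rle_trans (vsum_norm _ _) _.
have rowtail i m : vnorm (vsub (vsum (F i) m) (vtot (F i))) <= f i * Bg.
{ rewrite vnorm_subC; apply: vtot_tail (hFa i) _.
  by apply: bsum_shift (hFi i) => n; apply: vnorm_ge0. }
have rowsmall i m : (N <= m)%nat -> vnorm (vsub (vsum (F i) m) (vtot (F i))) <= f i * e.
{ move=> hm; rewrite vnorm_subC; apply: vtot_tail (hFa i) _.
  by apply: bsum_le (bsum_scal (f i) _ _ (f0 i) (hgt m hm)) => n /=. }
have -> : (M = N + (M - N))%nat by lia.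
rewrite rsum_split.
have b1 : rsum (fun i => vnorm (vsub (vsum (F i) (N + (M - N) - i)) (vtot (F i)))) N <= e * Bf.
{ apply: Rle_trans (bsum_scal e _ _ (Rlt_le _ _ he1) hf N).
  by apply: rsum_le => i hi; rewrite Rmult_comm; apply: rowsmall; lia. }
have b2 : rsum (fun i => vnorm (vsub (vsum (F (N + i)%nat) (N + (M - N) - (N + i))) (vtot (F (N + i)%nat)))) (M - N) <= Bg * e.
{ apply: Rle_trans (bsum_scal Bg _ _ Bg0 hft (M - N)%nat).
  by apply: rsum_le => i hi; rewrite Rmult_comm; apply: rowtail. }
nra.
Qed.

End Vectors.

(** * Exponentials *)

Section Exponential.
Context {X : CBanach}.
Implicit Types (x y z : X) (a b : Cplx) (A B : X -> X) (u v : nat -> X).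
Add Ring sz_ring : (@sz_ring_theory X).
Ltac vring := apply: sz_vec_inj; rewrite ?szE; ring.

(** Here [q] is the derivative of [p] in a one-sided, quantitative sense. Over [N + 1] equal steps
    the quadratic errors add up to [|L| a^2 / (N + 1)], which is made arbitrarily small. *)
Lemma mean_value (p q : R -> X) (a L K : R) : 0 <= a ->
  (forall s h, 0 <= s -> 0 <= h -> s + h <= a ->
     vnorm (vsub (vsub (p (s + h)) (p s)) (vscal (Cof h) (q s))) <= L * h ^ 2) ->
  (forall s, 0 <= s <= a -> vnorm (q s) <= K) ->
  vnorm (vsub (p a) (p 0)) <= K * a.
Proof.
move=> ha Hp Hq; apply: le_eps_all => eps he.
have HL : 0 <= Rabs L by apply: Rabs_pos.
have [N HN] := INR_archimed 1 (Rabs L * a ^ 2 / eps) ltac:(lra).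
rewrite Rmult_1_r in HN.
have hN0 : 0 < INR (S N) by apply: lt_0_INR; lia.
set h := a / INR (S N).
have hh : 0 <= h by apply: Rdiv_le_0_compat.
have Eh : h * INR (S N) = a by rewrite /h; field; lra.
have step k : (k <= S N)%nat -> vnorm (vsub (p (INR k * h)) (p 0)) <= INR k * (h * K + Rabs L * h ^ 2).
{ elim: k => [|k IH] hk.
    by rewrite !Rmult_0_l (_ : vsub (p 0) (p 0) = vzero); [rewrite vnorm_zero; lra | vring].
  have hk' : INR k * h + h <= a.
  { have := le_INR _ _ hk; rewrite S_INR => hk1; rewrite -Eh; nra. }
  have hk0 : 0 <= INR k by apply: pos_INR.
  have h1 := Hp (INR k * h) h ltac:(nra) hh hk'; have h2 := Hq (INR k * h) ltac:(nra).
  have h3 := IH ltac:(lia).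
  rewrite S_INR (_ : (INR k + 1) * h = INR k * h + h); last by ring.
  have -> : vsub (p (INR k * h + h)) (p 0) = vadd (vsub (p (INR k * h)) (p 0))
    (vadd (vscal (Cof h) (q (INR k * h)))
      (vsub (vsub (p (INR k * h + h)) (p (INR k * h))) (vscal (Cof h) (q (INR k * h))))) by vring.
  apply: Rle_trans (vnorm_triangle _ _ _) _.
  have := vnorm_triangle X (vscal (Cof h) (q (INR k * h)))
      (vsub (vsub (p (INR k * h + h)) (p (INR k * h))) (vscal (Cof h) (q (INR k * h)))).
  rewrite vnorm_scal Cnorm_Cof Rabs_right; last lra.
  have : h * vnorm (q (INR k * h)) <= h * K by apply: Rmult_le_compat_l.
  have : L * h ^ 2 <= Rabs L * h ^ 2 by apply: Rmult_le_compat_r; [nra | apply: Rle_abs].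
  lra. }
have := step (S N) ltac:(lia).
have -> : INR (S N) * h = a by rewrite -Eh; ring.
move=> H; apply: Rle_trans H _.
have -> : INR (S N) * (h * K + Rabs L * h ^ 2) = K * a + Rabs L * a ^ 2 / INR (S N).
{ rewrite /h; field; lra. }
apply: Rplus_le_compat_l; apply: (Rmult_le_reg_r (INR (S N))) => //.
rewrite /Rdiv Rmult_assoc Rinv_l ?Rmult_1_r; last lra.
have := Rmult_lt_compat_r eps _ _ he HN; rewrite /Rdiv Rmult_assoc Rinv_l ?Rmult_1_r; last lra.
rewrite S_INR; nra.
Qed.

Definition expt B x (n : nat) : X := vscal (Cof (/ INR (fact n))) (Nat.iter n B x).
Definition Exp B x : X := vtot (expt B x).

Lemma fact_pos n : 0 < INR (fact n).
Proof. exact: INR_fact_lt_0. Qed.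

Lemma bsum_exp m : 0 <= m -> bsum (fun n => m ^ n / INR (fact n)) (exp m).
Proof.
move=> hm n.
have H0 k : 0 <= m ^ k / INR (fact k) by apply: Rdiv_le_0_compat; [apply: pow_le | apply: fact_pos].
apply: Rle_trans (rsum_mono _ n (S n) H0 _) _; first lia.
have E k : rsum (fun n => m ^ n / INR (fact n)) (S k) = sum_f_R0 (fun i => / INR (fact i) * m ^ i) k.
{ elim: k => [|k IH]; first by rewrite /=; field.
  by rewrite rsumS IH [RHS]/=; congr (_ + _); rewrite /Rdiv /= Rmult_comm. }
rewrite E; apply: sum_incr.
- have := proj2_sig (exist_exp m); rewrite -/(exp m) /exp_in /infinite_sum => H eps he.
  by have [N hN] := H eps he; exists N.
- by move=> k; rewrite Rmult_comm; apply: H0.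
Qed.

(** Only the orbit of [x] is bounded, so [m] may be a growth rate local to [x], smaller than the
    norm of [B]. *)
Lemma expt_norm B x m c : (forall n, vnorm (Nat.iter n B x) <= m ^ n * c) ->
  forall n, vnorm (expt B x n) <= c * (m ^ n / INR (fact n)).
Proof.
move=> H n; rewrite /expt vnorm_scal Cnorm_Cof Rabs_right.
  have := H n; have := Rinv_0_lt_compat _ (fact_pos n); rewrite /Rdiv; nra.
by apply: Rle_ge; apply: Rlt_le; apply: Rinv_0_lt_compat; apply: fact_pos.
Qed.
Lemma iter_bound_ge0 B x m c : (forall n, vnorm (Nat.iter n B x) <= m ^ n * c) -> 0 <= c.
Proof. by move=> /(_ O) /=; have := vnorm_ge0 x; lra. Qed.
Lemma Exp_absum_gen B x m c : 0 <= m -> (forall n, vnorm (Nat.iter n B x) <= m ^ n * c) ->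
  absum (expt B x).
Proof.
move=> hm H; apply: absum_le (expt_norm B x m c H) (bsum_scal c _ _ (iter_bound_ge0 _ _ _ _ H) (bsum_exp m hm)).
Qed.
Lemma Exp_norm_gen B x m c : 0 <= m -> (forall n, vnorm (Nat.iter n B x) <= m ^ n * c) ->
  vnorm (Exp B x) <= c * exp m.
Proof.
move=> hm H; apply: vtot_norm; apply: bsum_le (expt_norm B x m c H) _.
exact: bsum_scal (iter_bound_ge0 _ _ _ _ H) (bsum_exp m hm).
Qed.
Lemma bop_iter_bound B x : is_bounded_op B -> exists m, 0 <= m /\ forall n, vnorm (Nat.iter n B x) <= m ^ n * vnorm x.
Proof.
move=> hB; have [m hm] := bop_bound B hB; exists m; split; first exact: (proj1 hm).
by move=> n; apply: opbound_iter.
Qed.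
Lemma Exp_absum B x : is_bounded_op B -> absum (expt B x).
Proof. by move=> hB; have [m [h0 hm]] := bop_iter_bound B x hB; apply: Exp_absum_gen h0 hm. Qed.
Lemma Exp_lim B x : is_bounded_op B -> vlim (vsum (expt B x)) (Exp B x).
Proof. by move=> hB; apply: absum_lim; apply: Exp_absum. Qed.

(** The remainder is the tail of the series from index 2; [(n + 2)! >= n!] compares it with [m^2]
    times the exponential series. *)
Lemma Exp_remainder B x m : opbound B m -> is_bounded_op B ->
  vnorm (vsub (vsub (Exp B x) x) (B x)) <= m ^ 2 * exp m * vnorm x.
Proof.
move=> hm hB; have [h0 _] := hm.
have E : vsum (expt B x) 2 = vadd x (B x).
{ rewrite /= /expt /= Rinv_1 vscal_one -/C1; vring. }
have -> : vsub (vsub (Exp B x) x) (B x) = vsub (Exp B x) (vsum (expt B x) 2) by rewrite E; vring.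
apply: vtot_tail (Exp_absum _ _ hB) _.
have -> : m ^ 2 * exp m * vnorm x = (m ^ 2 * vnorm x) * exp m by ring.
apply: bsum_le (bsum_scal (m ^ 2 * vnorm x) _ _ _ (bsum_exp m h0)); last first.
  by have := vnorm_ge0 x; nra.
move=> n; apply: Rle_trans (expt_norm B x m (vnorm x) (fun k => opbound_iter B m k x hm) _) _.
have h1 : / INR (fact (2 + n)) <= / INR (fact n).
{ apply: Rinv_le_contravar; [exact: fact_pos | apply: le_INR; apply: fact_le; lia]. }
have h2 : 0 <= m ^ n by apply: pow_le.
have h3 := vnorm_ge0 x.
have h4 : 0 <= m ^ 2 by nra.
rewrite pow_add /Rdiv.
have h5 : 0 <= vnorm x * (m ^ 2 * m ^ n) by apply: Rmult_le_pos => //; apply: Rmult_le_pos.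
nra.
Qed.

Lemma Exp_bop B : is_bounded_op B -> is_bounded_op (Exp B).
Proof.
move=> hB; split; last split.
- move=> x y; rewrite /Exp -vtot_add; try exact: Exp_absum.
  congr vtot; apply: functional_extensionality => n; rewrite /expt (bop_add _ (bop_iter B n hB)); vring.
- move=> a x; rewrite /Exp -vtot_scal; try exact: Exp_absum.
  congr vtot; apply: functional_extensionality => n; rewrite /expt (bop_scal _ (bop_iter B n hB)); vring.
- have [m hm] := bop_bound B hB; exists (exp m) => x; rewrite Rmult_comm.
  by apply: Exp_norm_gen (proj1 hm) _ => n; apply: opbound_iter.
Qed.

Lemma expt_S B x n : is_bounded_op B -> B (expt B x n) = vscal (Cof (INR (S n))) (expt B x (S n)).
Proof.
move=> hB; rewrite /expt (bop_scal _ hB) vscal_assoc; congr vscal.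
rewrite -CofM; congr Cof; have h := fact_pos n.
rewrite fact_simpl mult_INR; field; split; [lra | by apply: not_0_INR].
Qed.

(** The double series of the terms [B^i C^j x / (i! j!)] is summed by rows and by antidiagonals;
    along the antidiagonals it is the binomial theorem for commuting operators. *)
Lemma Exp_add B C x : is_bounded_op B -> is_bounded_op C -> opcomm B C ->
  Exp (opD B C) x = Exp B (Exp C x).
Proof.
move=> hB hC hcom.
pose F i j := expt B (expt C x j) i.
have EF i : vtot (F i) = expt B (Exp C x) i.
{ rewrite /F /Exp; pose G := opZ (Cof (/ INR (fact i))) (Nat.iter i B).
  have hG : is_bounded_op G by apply: bop_opZ; apply: bop_iter.
  exact: (vtot_bop G (expt C x) hG (Exp_absum C x hC)). }
apply: vtot_unique; rewrite -[Exp B (Exp C x)]/(vtot (expt B (Exp C x))).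
have -> : expt B (Exp C x) = fun i => vtot (F i) by apply: functional_extensionality => i; rewrite EF.
have -> : expt (opD B C) x = fun k => vsum (fun i => F i (k - i)%nat) (S k).
{ apply: functional_extensionality; elim=> [|k IH].
    by rewrite /F /expt /= Rinv_1 -/C1; vring.
  have inj (p q : X) : vscal (Cof (INR (S k))) p = vscal (Cof (INR (S k))) q -> p = q.
  { move=> E; rewrite -(vscal_one X p) -(vscal_one X q).
    have -> : C1 = Cmul (Cof (/ INR (S k))) (Cof (INR (S k))).
    { by rewrite -CofM Rinv_l //; apply: not_0_INR. }
    by rewrite -!vscal_assoc E. }
  apply: inj; rewrite -expt_S; last exact: bop_opD.
  rewrite IH {1}/opD (vsum_bop B _ _ hB) (vsum_bop C _ _ hC).
  have EB i : B (F i (k - i)%nat) = vscal (Cof (INR (S i))) (F (S i) (k - i)%nat).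
  { exact: expt_S. }
  have EC i : (i <= k)%nat -> C (F i (k - i)%nat) = vscal (Cof (INR (S k - i))) (F i (S k - i)%nat).
  { move=> hi; have -> : (S k - i = S (k - i))%nat by lia.
    rewrite /F -[expt B (expt C x (k - i)) i]/(vscal _ _) (bop_scal _ hC) (opcomm_iter C B i) //.
    rewrite (expt_S C x (k - i) hC) (bop_scal _ (bop_iter B i hB)).
    rewrite -[expt B _ i]/(vscal (Cof (/ INR (fact i))) _); vring. }
  (* Applying [B + C] to the terms of degree [k] yields each term of degree [k + 1] with weight
     [i + (k + 1 - i)]; [P] and [Q] collect the two summands. *)
  pose P i := vscal (Cof (INR i)) (F i (S k - i)%nat).
  pose Q i := vscal (Cof (INR (S k) - INR i)) (F i (S k - i)%nat).
  have -> : vsum (fun i => B (F i (k - i)%nat)) (S k) = vsum P (S (S k)).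
  { rewrite [RHS]vsum_recl /P (_ : Cof (INR 0) = C0) // vscal0 vadd_zero_l.
    by apply: vsum_ext => i hi; rewrite EB. }
  have -> : vsum (fun i => C (F i (k - i)%nat)) (S k) = vsum Q (S (S k)).
  { rewrite [RHS]vsumS /Q Rminus_diag -/C0 vscal0 vadd_zero.
    by apply: vsum_ext => i hi; rewrite EC; [rewrite minus_INR; [|lia] | lia]. }
  rewrite -vsum_add vsum_scal; apply: vsum_ext => i hi; rewrite /P /Q -vscal_distr_c.
  by congr vscal; ceq; ring. }
have [m [m0 hm]] := bop_bound B hB; have [n [n0 hn]] := bop_bound C hC.
apply: (vtot_fubini F (fun i => m ^ i / INR (fact i)) (fun j => n ^ j / INR (fact j) * vnorm x)
  (exp m) (exp n * vnorm x)).
- by move=> i; apply: Rdiv_le_0_compat; [apply: pow_le | apply: fact_pos].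
- by move=> i; apply: Rmult_le_pos (vnorm_ge0 _); apply: Rdiv_le_0_compat; [apply: pow_le | apply: fact_pos].
- exact: bsum_exp.
- by rewrite Rmult_comm; apply: bsum_le (bsum_scal (vnorm x) _ _ (vnorm_ge0 x) (bsum_exp n n0)) => k; lra.
move=> i j; rewrite /F; apply: Rle_trans (expt_norm B _ m (vnorm (expt C x j)) _ _) _.
  by move=> k; apply: opbound_iter.
rewrite Rmult_comm; apply: Rmult_le_compat_l.
  by apply: Rdiv_le_0_compat; [apply: pow_le | apply: fact_pos].
by rewrite Rmult_comm; apply: expt_norm => k; apply: opbound_iter.
Qed.

Lemma Exp_zero x : Exp (opZ C0 opI) x = x.
Proof.
rewrite /Exp (vtot_finite _ 1); first by rewrite /= /expt /= Rinv_1 -/C1; vring.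
case=> [|n] hn; first lia.
by rewrite /expt /= /opZ vscal0; vring.
Qed.
Lemma opZ0 A B : opZ C0 A = opZ C0 B.
Proof. by apply: functional_extensionality => x; rewrite /opZ !vscal0. Qed.
Lemma Exp_opZ_add a b A x : is_bounded_op A ->
  Exp (opZ (Cadd a b) A) x = Exp (opZ a A) (Exp (opZ b A) x).
Proof.
move=> hA; rewrite -Exp_add; try exact: bop_opZ.
  by congr (Exp _ _); apply: functional_extensionality => y; rewrite /opZ /opD; vring.
by move=> y; rewrite /opZ !(bop_scal _ hA); vring.
Qed.

End Exponential.

(** * Coefficient estimates *)

Section Cauchy.
Context {X : CBanach}.
Implicit Types (x y z : X) (a b : Cplx) (A B : X -> X) (u v : nat -> X).
Add Ring sz_ring : (@sz_ring_theory X).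
Ltac vring := apply: sz_vec_inj; rewrite ?szE; ring.

(* Averaging over the N-th roots of unity isolates one coefficient of the series up to the
   terms of index at least N. *)
Lemma cauchy_estimate u (R0 K D : R) : 0 <= R0 -> bsum (fun m => vnorm (u m) * R0 ^ m) D ->
  (forall t, 0 <= t <= 2 * PI ->
     vnorm (vtot (fun m => vscal (Cpow (Cmul (Cof R0) (Cis (- t))) m) (u m))) <= K) ->
  forall n, vnorm (u n) * R0 ^ n <= K.
Proof.
move=> hR hD hK n; apply: le_eps_all => eps he.
have hb0 m : 0 <= vnorm (u m) * R0 ^ m by apply: Rmult_le_pos (vnorm_ge0 _) (pow_le _ _ hR).
have [N0 hN0] := bsum_tail _ _ _ hb0 hD he.
(* Beyond [N0] the tail is below [eps], and [N > n] makes [n] one of the indices separated by [N]-th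
   roots of unity. *)
set N := (N0 + S n)%nat.
have hN : bsum (fun m => vnorm (u (N + m)%nat) * R0 ^ (N + m)) eps by apply: hN0; lia.
have hNpos : 0 < INR N by apply: lt_0_INR; lia.
have PI0 := PI_RGT_0.
pose t j := 2 * PI * INR j / INR N.
pose z j := Cmul (Cof R0) (Cis (- t j)).
(* Inverse to the phase of the term of index [n] at the node [z j], so that this term alone survives
   summation over [j]. *)
pose c j := Cis (INR n * t j).
have hz j m : vnorm (vscal (Cpow (z j) m) (u m)) = vnorm (u m) * R0 ^ m.
{ rewrite vnorm_scal CnormX /z CnormM Cnorm_Cis Cnorm_Cof Rmult_1_r Rabs_right; [ring | lra]. }
pose S0 j := vsum (fun m => vscal (Cpow (z j) m) (u m)) N.
have hS j : (j < N)%nat -> vnorm (S0 j) <= K + eps.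
{ move=> hj; have ht : 0 <= t j <= 2 * PI.
  { have h1 := lt_INR _ _ hj; have h2 := pos_INR j; rewrite /t; split.
      by apply: Rdiv_le_0_compat => //; nra.
    apply: (Rmult_le_reg_r (INR N)) => //; rewrite /Rdiv Rmult_assoc Rinv_l; nra. }
  have h1 := hK _ ht.
  have h2 : vnorm (vsub (vtot (fun m => vscal (Cpow (z j) m) (u m))) (S0 j)) <= eps.
  { apply: vtot_tail.
      by exists D; apply: bsum_le hD => m; rewrite hz; lra.
    by apply: bsum_le hN => m; rewrite hz; lra. }
  rewrite vnorm_subC in h2.
  by have := vnorm_split (S0 j) (vtot (fun m => vscal (Cpow (z j) m) (u m))); rewrite -/(z j) in h1; lra. }
have E : vsum (fun j => vscal (c j) (S0 j)) N = vscal (Cof (INR N * R0 ^ n)) (u n).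
{ have -> : vsum (fun j => vscal (c j) (S0 j)) N =
    vsum (fun m => vsum (fun j => vscal (Cmul (c j) (Cpow (z j) m)) (u m)) N) N.
  { rewrite vsum_exchange; apply: vsum_ext => j hj; rewrite /S0 vsum_scal.
    by apply: vsum_ext => m hm; rewrite vscal_assoc. }
  have Ec m : (fun j => Cmul (c j) (Cpow (z j) m)) =
    fun j => Cmul (Cof (R0 ^ m)) (Cpow (Cis (2 * PI * (INR n - INR m) / INR N)) j).
  { apply: functional_extensionality => j.
    rewrite /z Cpow_mul -Cof_pow !Cis_pow /c.
    have -> : INR j * (2 * PI * (INR n - INR m) / INR N) = INR n * t j + INR m * - t j.
    { rewrite /t; field; lra. }
    rewrite CisD; ring. }
  have Em m : vsum (fun j => vscal (Cmul (c j) (Cpow (z j) m)) (u m)) N =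
    vscal (Cmul (Cof (R0 ^ m)) (csum (Cpow (Cis (2 * PI * (INR n - INR m) / INR N))) N)) (u m).
  { rewrite -vscal_assoc -(vsum_scalr _ (u m)) vsum_scal; apply: vsum_ext => j hj.
    by rewrite vscal_assoc; congr vscal; exact: (f_equal (fun f => f j) (Ec m)). }
  rewrite (vsum_single _ n); first last.
  - move=> m hm hmn; rewrite Em roots_of_unity_sum; [vring | lia | lia | lia].
  - by lia.
  rewrite Em Rminus_diag Rmult_0_r /Rdiv Rmult_0_l Cis0.
  congr vscal; have -> : csum (Cpow C1) N = Cof (INR N).
  { elim: (N) => [|k IH] //; rewrite S_INR CofD -IH /=; congr Cadd.
    by elim: (k) => [|i IHi] //=; rewrite IHi; ring. }
  by rewrite CofM; ring. }
have h : vnorm (vsum (fun j => vscal (c j) (S0 j)) N) <= INR N * (K + eps).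
{ apply: Rle_trans (vsum_norm _ _) _.
  have -> : INR N * (K + eps) = rsum (fun _ => K + eps) N.
  { by elim: (N) => [|k IH]; rewrite ?S_INR /=; lra. }
  by apply: rsum_le => j hj; rewrite vnorm_scal Cnorm_Cis Rmult_1_l; apply: hS. }
rewrite E vnorm_scal Cnorm_Cof Rabs_right in h.
  by apply: (Rmult_le_reg_l (INR N)) => //; lra.
by apply: Rle_ge; apply: Rmult_le_pos; [lra | apply: pow_le].
Qed.

End Cauchy.

(** * Exponentials of polynomial growth *)

Section Weight.
Variable al : R.
Hypothesis hal : 0 <= al < 1.
Definition weight (s : R) := 1 + powR s al.

Lemma Rpower_pos x p : 0 < Rpower x p.
Proof. exact: exp_pos. Qed.
Lemma powR_ge0 s p : 0 <= powR s p.
Proof.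
rewrite /powR; case: Rle_dec => h; last by apply: Rlt_le; apply: Rpower_pos.
by case: Req_EM_T => _; lra.
Qed.
Lemma powR_Rpower s p : 0 < s -> powR s p = Rpower s p.
Proof. by move=> h; rewrite /powR; case: Rle_dec => // h'; lra. Qed.
Lemma powR_mono s s' : 0 <= s -> s <= s' -> powR s al <= powR s' al.
Proof.
move=> h h'; rewrite /powR; case: Rle_dec => h1; case: Rle_dec => h2; try lra.
- case: Req_EM_T => E; last by apply: Rlt_le; apply: Rpower_pos.
  by rewrite E Rpower_O; lra.
- by apply: Rle_Rpower_l; lra.
Qed.
Lemma Rpower_ge1 s p : 1 <= s -> 0 <= p -> 1 <= Rpower s p.
Proof. by move=> h hp; rewrite -(Rpower_O s); [apply: Rle_Rpower; lra | lra]. Qed.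
Lemma weight_ge1 s : 1 <= weight s.
Proof. by rewrite /weight; have := powR_ge0 s al; lra. Qed.
Lemma weight_mono s s' : 0 <= s -> s <= s' -> weight s <= weight s'.
Proof. by move=> h h'; rewrite /weight; have := powR_mono s s' h h'; lra. Qed.
Lemma weight_Rpower s : 1 <= s -> weight s <= 2 * Rpower s al.
Proof. by move=> h; rewrite /weight powR_Rpower; [have := Rpower_ge1 s al h; lra | lra]. Qed.
Lemma weight_linear s : 0 <= s -> weight s <= 2 + s.
Proof.
move=> h; rewrite /weight; case: (Rle_dec 1 s) => h1.
  rewrite powR_Rpower; last lra.
  by have := Rle_Rpower s al 1 ltac:(lra) ltac:(lra); rewrite Rpower_1; lra.
have := powR_mono s 1 h ltac:(lra); rewrite (powR_Rpower 1); last lra.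
rewrite /Rpower ln_1 Rmult_0_r exp_0; lra.
Qed.
End Weight.

(** Serves as the passage to the limit [s -> infinity] below. For [a > 0] the bound fails at the
    point where [s^p = K / a + 1]. *)
Lemma le0_of_Rpower_decay a K p : 0 < p -> (forall s, 1 <= s -> a <= K * Rpower s (- p)) -> a <= 0.
Proof.
move=> hp H; apply: Rnot_lt_le => ha.
have hK : 0 < K.
{ by have := H 1 ltac:(lra); rewrite /Rpower ln_1 Rmult_0_r exp_0; lra. }
set v := K / a + 1.
have hv : 1 <= v by have := Rdiv_lt_0_compat K a hK ha; rewrite /v; lra.
have hp' : 0 < / p by apply: Rinv_0_lt_compat.
have := H (Rpower v (/ p)) (Rpower_ge1 v (/ p) hv ltac:(lra)).
rewrite Rpower_mult (_ : / p * - p = - 1); last by field; lra.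
rewrite Rpower_Ropp Rpower_1; last lra.
move=> h; have : a * v <= K.
{ apply: (Rmult_le_reg_r (/ v)); first by apply: Rinv_0_lt_compat; lra.
  by rewrite Rmult_assoc Rinv_r ?Rmult_1_r; lra. }
by rewrite /v; have -> : a * (K / a + 1) = K + a by [field; lra]; lra.
Qed.

Lemma Cnorm_Ci : Cnorm Ci = 1.
Proof. by rewrite /Cnorm /= -[RHS]sqrt_1; f_equal; ring. Qed.
Lemma Cnorm_le_parts a : Cnorm a <= Rabs (Cre a) + Rabs (Cim a).
Proof.
have E : a = Cadd (Cof (Cre a)) (Cmul Ci (Cof (Cim a))) by ceq; ring.
rewrite {1}E; apply: Rle_trans (Cnorm_triangle _ _) _.
by rewrite CnormM Cnorm_Ci !Cnorm_Cof; lra.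
Qed.
Lemma one_sub_cos_le h : 1 - cos h <= h ^ 2 / 2.
Proof.
have E2 : cos h = 1 - 2 * sin (h / 2) * sin (h / 2) by rewrite -cos_2a_sin; congr cos; field.
have : Rabs (sin (h / 2)) <= Rabs (h / 2).
{ have := Cis_lipschitz (h / 2) (- (h / 2)); have := Cim_le (Csub (Cis (h / 2)) (Cis (- (h / 2)))).
  rewrite /= sin_neg (_ : sin (h / 2) + - - sin (h / 2) = 2 * sin (h / 2)); last by ring.
  rewrite (_ : h / 2 - - (h / 2) = 2 * (h / 2)); last by field.
  rewrite !(Rabs_mult 2) (Rabs_right 2); lra. }
move=> H; have := Rsqr_le_abs_1 _ _ H; rewrite /Rsqr; nra.
Qed.
(** The scalar counterpart of [Exp_remainder]: the real part is [1 - cos h <= h^2 / 2], and the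
    imaginary part [h - sin h] is at most [h^3 / 2]. *)
Lemma Cis_remainder h : 0 <= h -> Cnorm (Csub (mkC 1 h) (Cis h)) <= h ^ 2 * (1 + h).
Proof.
move=> hh; apply: Rle_trans (Cnorm_le_parts _) _; rewrite /=.
have h1 := one_sub_cos_le h; have h2 : cos h <= 1 by case: (COS_bound h).
rewrite (Rabs_right (1 + - cos h)); last lra.
have : Rabs (h + - sin h) <= h * (h ^ 2 / 2).
{ case: (Req_dec h 0) => [->|h0]; first by rewrite sin_0 (_ : 0 + - 0 = 0) ?Rabs_R0; lra.
  have [c [E hc]] := MVT_cor2 sin cos 0 h ltac:(lra) (fun c _ => derivable_pt_lim_sin c).
  rewrite sin_0 in E; have -> : h + - sin h = h * (1 - cos c) by lra.
  have := one_sub_cos_le c; have : cos c <= 1 by case: (COS_bound c).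
  move=> h3 h4; rewrite Rabs_right; last nra.
  apply: Rmult_le_compat_l; first lra.
  nra. }
nra.
Qed.

Section Growth.
Context {X : CBanach}.
Implicit Types (x y z : X) (a b : Cplx) (A B : X -> X) (u v : nat -> X).
Add Ring sz_ring : (@sz_ring_theory X).
Ltac vring := apply: sz_vec_inj; rewrite ?szE; ring.

Definition iexp (T : X -> X) (t : R) : X -> X := Exp (opZ (Cmul Ci (Cof t)) T).
Lemma iexp_bop T t : is_bounded_op T -> is_bounded_op (iexp T t).
Proof. by move=> hT; apply: Exp_bop; apply: bop_opZ. Qed.
Lemma iexp_add T s t x : is_bounded_op T -> iexp T (s + t) x = iexp T s (iexp T t x).
Proof. by move=> hT; rewrite /iexp -Exp_opZ_add // CofD; congr (Exp (opZ _ _) _); ring. Qed.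
Lemma iexp0 T x : iexp T 0 x = x.
Proof.
rewrite /iexp (_ : Cmul Ci (Cof 0) = C0); last by ceq; ring.
by rewrite (opZ0 T opI) Exp_zero.
Qed.
Lemma iexp_lim T t x : is_bounded_op T -> vlim (exp_partial T t x) (iexp T t x).
Proof.
move=> hT; have := vlim_shift _ _ (Exp_lim _ x (bop_opZ (Cmul Ci (Cof t)) T hT)).
congr vlim; apply: functional_extensionality; elim=> [|n IH].
  by rewrite /= /expt /= Rinv_1 -/C1; vring.
have -> : exp_partial T t x (S n) = vadd (exp_partial T t x n)
  (vscal (Cmul (Cpow (Cmul Ci (Cof t)) (S n)) (Cof (/ INR (fact (S n))))) (Nat.iter (S n) T x)) by [].
rewrite vsumS IH /expt (iter_opZ _ _ (S n) _ hT) vscal_assoc.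
by congr (vadd _ (vscal _ _)); ring.
Qed.

(** The exponential series has to be matched with [Cis], which is built from cos and sin. For
    nonnegative times, the increments of [r |-> exp(i r) Cis (- r) w] over a step [h] are of order
    [h^2], so by [mean_value] with derivative 0 it is constant; the group law gives negative
    times. *)
Lemma iexp_scalar t x : iexp opI t x = vscal (Cis t) x.
Proof.
have bI := @bop_opI X.
have pos s y : 0 <= s -> iexp opI s y = vscal (Cis s) y.
{ move=> hs; have key w : iexp opI s (vscal (Cis (- s)) w) = w.
  { apply: vsub_eq0; apply: vnorm_small0 => eps he.
    have := mean_value (fun r => iexp opI r (vscal (Cis (- r)) w)) (fun _ => vzero) s
      (exp s * (exp s + (1 + s)) * vnorm w) 0 hs.
    rewrite /= iexp0 Ropp_0 Cis0 vscal_one Rmult_0_l => H; apply: (Rle_trans _ 0); last lra.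
    apply: H; last by move=> r _; rewrite vnorm_zero; lra.
    move=> r h hr hh hrh.
    have Eb q : opbound (opZ (Cmul Ci (Cof q)) (@opI X)) (Rabs q).
    { have := opbound_opZ (Cmul Ci (Cof q)) opI 1; rewrite CnormM Cnorm_Ci Cnorm_Cof Rmult_1_l Rmult_1_r.
      by apply; split; [lra | move=> v; rewrite /opI; lra]. }
    pose v0 := vscal (Cis (- r)) w; pose v1 := vscal (Cis (- (r + h))) w.
    have Nv1 : vnorm v1 = vnorm w by rewrite /v1 vnorm_scal Cnorm_Cis; ring.
    have -> : vsub (vsub (iexp opI (r + h) v1) (iexp opI r v0)) (vscal (Cof h) vzero) =
      iexp opI r (vsub (iexp opI h v1) v0).
    { rewrite iexp_add // (bop_sub _ (iexp_bop opI r bI)); vring. }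
    have e1 : vnorm (vsub (iexp opI h v1) v0) <= h ^ 2 * (exp s + (1 + s)) * vnorm w.
    { have -> : vsub (iexp opI h v1) v0 = vadd (vsub (vsub (iexp opI h v1) v1) (opZ (Cmul Ci (Cof h)) opI v1))
        (vscal (Csub (mkC 1 h) (Cis h)) v1).
      { have E : v0 = vscal (Cis h) v1.
        { by rewrite /v0 /v1 vscal_assoc -CisD; congr (vscal (Cis _) _); ring. }
        have -> : mkC 1 h = Cadd C1 (Cmul Ci (Cof h)) by ceq; ring.
        rewrite E /opZ /opI; vring. }
      apply: Rle_trans (vnorm_triangle _ _ _) _.
      have := Exp_remainder _ v1 _ (Eb h) (bop_opZ _ _ bI).
      rewrite -/(iexp opI h v1) Nv1 vnorm_scal Nv1 (Rabs_right h); last lra.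
      have := Cis_remainder h hh; have := vnorm_ge0 w.
      have : exp h <= exp s by apply: exp_le; lra.
      move=> h1 h2 h3 h4.
      have h5 : h ^ 2 * exp h * vnorm w <= h ^ 2 * exp s * vnorm w.
      { by apply: Rmult_le_compat_r => //; apply: Rmult_le_compat_l => //; nra. }
      have h6 : Cnorm (Csub (mkC 1 h) (Cis h)) * vnorm w <= h ^ 2 * (1 + s) * vnorm w.
      { apply: Rmult_le_compat_r => //; apply: Rle_trans h3 _.
        by apply: Rmult_le_compat_l; [nra | lra]. }
      lra. }
    have e2 : forall p, vnorm (iexp opI r p) <= vnorm p * exp s.
    { move=> p; apply: (Rle_trans _ (vnorm p * exp (Rabs r))).
        by apply: Exp_norm_gen (Rabs_pos _) _ => n; apply: opbound_iter.
      apply: Rmult_le_compat_l (vnorm_ge0 _) _; apply: exp_le; rewrite Rabs_right; lra. }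
    apply: Rle_trans (e2 _) _; have := exp_pos s; have := vnorm_ge0 w.
    nra. }
  rewrite -(key (vscal (Cis s) y)) vscal_assoc -CisD.
  by rewrite (_ : - s + s = 0) ?Cis0 ?vscal_one; [|ring]. }
case: (Rle_dec 0 t) => ht; first exact: pos.
have E : iexp opI (- t) (vscal (Cis t) x) = x.
{ by rewrite pos ?vscal_assoc -?CisD ?Rplus_opp_l ?Cis0 ?vscal_one; [|lra]. }
by rewrite -{1}E -iexp_add // Rplus_opp_r iexp0.
Qed.

Variable al : R.
Hypothesis hal : 0 <= al < 1.
Notation w := (weight al).

Definition growth (T : X -> X) C := forall t y, vnorm (iexp T t y) <= C * w (Rabs t) * vnorm y.

Lemma growth_exp_it_bound T C : is_bounded_op T ->
  (forall t, exp_it_bound T t (C * (1 + powR (Rabs t) al))) -> growth T C.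
Proof. by move=> hT H t y; apply: H; apply: iexp_lim. Qed.

Lemma growth_opp T C : is_bounded_op T -> growth T C -> growth (opZ (Copp C1) T) C.
Proof.
move=> hT H t y; rewrite -Rabs_Ropp; apply: Rle_trans (H (- t) y); right; congr vnorm.
rewrite /iexp; congr (Exp _ _); apply: functional_extensionality => v.
by rewrite /opZ vscal_assoc; congr vscal; ceq; ring.
Qed.
Definition shiftop (T : X -> X) p := opD T (opZ (Cof (- p)) opI).
Lemma shiftop_bop T p : is_bounded_op T -> is_bounded_op (shiftop T p).
Proof. by move=> hT; apply: bop_opD => //; apply: bop_opZ; apply: bop_opI. Qed.
(** Subtracting the real scalar [p] multiplies the group by a unimodular factor. *)
Lemma growth_shift T C p : is_bounded_op T -> growth T C -> growth (shiftop T p) C.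
Proof.
move=> hT H t y.
have -> : iexp (shiftop T p) t y = iexp T t (iexp opI (- t * p) y).
{ rewrite /iexp -Exp_add; try by apply: bop_opZ; try exact: bop_opI.
    congr (Exp _ _); apply: functional_extensionality => v; rewrite /opZ /shiftop /opD /opZ /opI.
    by rewrite vscal_distr_v vscal_assoc; congr (vadd _ (vscal _ _)); ceq; ring.
  by move=> v; rewrite /opZ /opI (bop_scal _ hT); vring. }
apply: Rle_trans (H _ _) _; rewrite iexp_scalar vnorm_scal Cnorm_Cis; lra.
Qed.

(** If [T^2 y = 0] then [exp(isT) y = y + i s T y] grows linearly unless [T y = 0], while only
    growth of order [s^al] with [al < 1] is allowed. *)
Lemma growth_nilpotent T C y : is_bounded_op T -> 0 < C -> growth T C -> T (T y) = vzero -> T y = vzero.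
Proof.
move=> hT hC H hy; apply: vnorm_eq0; apply: Rle_antisym (vnorm_ge0 _).
apply: (le0_of_Rpower_decay _ ((2 * C + 1) * vnorm y) (1 - al)); first lra.
move=> s hs.
have E : iexp T s y = vadd y (vscal (Cmul Ci (Cof s)) (T y)).
{ rewrite /iexp /Exp (vtot_finite _ 2).
    by rewrite /= /expt /= Rinv_1 -/C1 /opZ; vring.
  case=> [|[|n]] hn; try lia.
  rewrite /expt iter_opZ // -[Nat.iter _ _ _]/(T (T (Nat.iter n T y))).
  by rewrite -!iter_comm hy (bop_zero _ (bop_iter T n hT)) !vscalz. }
have h1 := H s y; rewrite E in h1.
have h2 : s * vnorm (T y) <= (C * w (Rabs s) + 1) * vnorm y.
{ have -> : s * vnorm (T y) = vnorm (vscal (Cmul Ci (Cof s)) (T y)).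
  { by rewrite vnorm_scal CnormM Cnorm_Ci Cnorm_Cof Rabs_right; [ring | lra]. }
  have := vnorm_sub (vadd y (vscal (Cmul Ci (Cof s)) (T y))) y; rewrite vsub_addl; lra. }
rewrite Rabs_right in h2; last lra.
have h3 := weight_Rpower al hal s hs; have h4 := Rpower_ge1 s al hs (proj1 hal).
have h5 : s * vnorm (T y) <= ((2 * C + 1) * Rpower s al) * vnorm y.
{ apply: Rle_trans h2 _; apply: Rmult_le_compat_r (vnorm_ge0 _) _; nra. }
have -> : - (1 - al) = al + - (1) by ring.
rewrite Rpower_plus Rpower_Ropp Rpower_1; last lra.
apply: (Rmult_le_reg_l s); first lra.
apply: Rle_trans h5 _; right; field; lra.
Qed.

Lemma exp_series T a x : is_bounded_op T ->
  Exp (opZ a T) x = vtot (fun m => vscal (Cpow a m) (expt T x m)).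
Proof.
move=> hT; congr vtot; apply: functional_extensionality => n.
by rewrite /expt iter_opZ //; vring.
Qed.

(* For zeta = b + i a, exp(zeta T) = exp(i a T) exp(- i b S) exp(b (T + i S)), and only the
   last factor is not of polynomial growth. *)
Lemma Exp_growth T S0 C D (a b : R) x : is_bounded_op T -> is_bounded_op S0 -> opcomm T S0 ->
  0 < C -> 0 < D -> growth T C -> growth S0 D ->
  vnorm (Exp (opZ (mkC b a) T) x) <=
    C * w (Rabs a) * (D * w (Rabs b)) * vnorm (Exp (opZ (Cof b) (opD T (opZ Ci S0))) x).
Proof.
move=> hT hS hc hC hD gT gS.
have -> : mkC b a = Cadd (Cmul Ci (Cof a)) (Cof b) by ceq; ring.
rewrite Exp_opZ_add //; apply: Rle_trans (gT _ _) _.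
have h1 := weight_ge1 al (Rabs a).
rewrite [X in _ <= X]Rmult_assoc; apply: Rmult_le_compat_l; first nra.
have -> : Exp (opZ (Cof b) T) x = iexp S0 (- b) (Exp (opZ (Cof b) (opD T (opZ Ci S0))) x).
{ have hA : is_bounded_op (opD T (opZ Ci S0)) by apply: bop_opD => //; apply: bop_opZ.
  rewrite /iexp -Exp_add; try exact: bop_opZ.
    congr (Exp _ _); apply: functional_extensionality => v; rewrite /opZ /opD /opZ.
    have -> : Cof (- b) = Copp (Cof b) by ceq; ring.
    vring.
  by move=> v; rewrite /opZ /opD !(bop_scal _ hS, bop_add _ hS, bop_scal _ hT) -hc; vring. }
by apply: Rle_trans (gS _ _) _; rewrite Rabs_Ropp; lra.
Qed.

(** Cauchy estimates for the entire function [z |-> exp(zT) x], whose coefficients are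
    [T^n x / n!]. *)
Lemma Cauchy_exp T x K R0 : is_bounded_op T -> 0 <= R0 ->
  (forall z : Cplx, Cnorm z = R0 -> vnorm (Exp (opZ z T) x) <= K) ->
  forall n, vnorm (Nat.iter n T x) * R0 ^ n <= INR (fact n) * K.
Proof.
move=> hT hR H n; have [m [m0 hm]] := bop_iter_bound T x hT.
have := cauchy_estimate (expt T x) R0 K (vnorm x * exp (m * R0)) hR.
have Hs : bsum (fun k => vnorm (expt T x k) * R0 ^ k) (vnorm x * exp (m * R0)).
{ apply: bsum_le (bsum_scal (vnorm x) _ _ (vnorm_ge0 x) (bsum_exp (m * R0) ltac:(nra))) => k.
  have := expt_norm T x m (vnorm x) hm k; have := pow_le R0 k hR; rewrite Rpow_mult_distr /Rdiv; nra. }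
move=> /(_ Hs); have HH : forall t, 0 <= t <= 2 * PI ->
  vnorm (vtot (fun m => vscal (Cpow (Cmul (Cof R0) (Cis (- t))) m) (expt T x m))) <= K.
{ move=> t _; rewrite -exp_series //; apply: H.
  by rewrite CnormM Cnorm_Cis Cnorm_Cof Rabs_right; [ring | lra]. }
move=> /(_ HH n); rewrite /expt vnorm_scal Cnorm_Cof Rabs_right.
  move=> h; have hf := fact_pos n; apply: (Rmult_le_reg_l (/ INR (fact n))).
    exact: Rinv_0_lt_compat.
  rewrite -Rmult_assoc; apply: Rle_trans h _; right; field; lra.
by apply: Rle_ge; apply: Rlt_le; apply: Rinv_0_lt_compat; apply: fact_pos.
Qed.

(** A Liouville argument. With [A^2 c = 0], [exp(bA) c = c + b A c] grows linearly, so [exp(zT) c]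
    is of order [|z|^(1 + 2 al)] with exponent below 3 and its coefficient [T^3 c / 3!] vanishes.
    Two uses of [growth_nilpotent] bring this down to [T c]. *)
Lemma ascent_real T S0 C D c : is_bounded_op T -> is_bounded_op S0 -> opcomm T S0 ->
  0 < C -> 0 < D -> growth T C -> growth S0 D ->
  opD T (opZ Ci S0) (opD T (opZ Ci S0) c) = vzero -> T c = vzero.
Proof.
move=> hT hS hc hC hD gT gS; set A := opD T (opZ Ci S0) => hAc.
have hA : is_bounded_op A by apply: bop_opD => //; apply: bop_opZ.
have T3 : T (T (T c)) = vzero.
{ apply: vnorm_eq0; apply: Rle_antisym (vnorm_ge0 _).
  (* The exponent is [3 - (1 + 2 al)]; 24 is [3!] times the 4 coming from two weights bounded by
     [2 s^al]. *)
  apply: (le0_of_Rpower_decay _ (24 * C * D * (vnorm c + vnorm (A c))) (2 - 2 * al)); first lra.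
  move=> s hs.
  have H (z : Cplx) : Cnorm z = s -> vnorm (Exp (opZ z T) c) <= C * w s * (D * w s) * (s * (vnorm c + vnorm (A c))).
  { case: z => b a hz; apply: Rle_trans (Exp_growth T S0 C D a b c hT hS hc hC hD gT gS) _.
    have ha := Cim_le (mkC b a); have hb := Cre_le (mkC b a); rewrite hz /= in ha hb.
    have wa := weight_mono al hal _ _ (Rabs_pos a) ha; have wb := weight_mono al hal _ _ (Rabs_pos b) hb.
    have wa1 := weight_ge1 al (Rabs a); have wb1 := weight_ge1 al (Rabs b).
    have c0 := vnorm_ge0 c; have c1 := vnorm_ge0 (A c).
    apply: Rmult_le_compat.
    - by apply: Rmult_le_pos; nra.
    - exact: vnorm_ge0.
    - by apply: Rmult_le_compat; nra.
    have -> : Exp (opZ (Cof b) A) c = vadd c (vscal (Cof b) (A c)).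
    { rewrite /Exp (vtot_finite _ 2).
        by rewrite /= /expt /= Rinv_1 -/C1 /opZ; vring.
      case=> [|[|n]] hn; try lia.
      rewrite /expt iter_opZ // -[Nat.iter _ _ _]/(A (A (Nat.iter n A c))).
      by rewrite -!iter_comm hAc (bop_zero _ (bop_iter A n hA)) !vscalz. }
    apply: Rle_trans (vnorm_triangle _ _ _) _; rewrite vnorm_scal Cnorm_Cof; nra. }
  have := Cauchy_exp T c _ s hT ltac:(lra) H 3; rewrite /= => h.
  have w1 := weight_Rpower al hal s hs; have w2 := weight_ge1 al s.
  have c0 := vnorm_ge0 c; have c1 := vnorm_ge0 (A c).
  set N := vnorm c + vnorm (A c) in h *.
  have h2 : w s * w s <= 4 * (Rpower s al * Rpower s al) by nra.
  have -> : - (2 - 2 * al) = al + al + - (1) + - (1) by ring.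
  rewrite !Rpower_plus Rpower_Ropp Rpower_1; last lra.
  apply: (Rmult_le_reg_r (s * (s * (s * 1)))); first by nra.
  apply: Rle_trans h _.
  have -> : 24 * C * D * N * (Rpower s al * Rpower s al * / s * / s) * (s * (s * (s * 1))) =
    (6 * C * D * N * s) * (4 * (Rpower s al * Rpower s al)) by field; lra.
  have -> : (1 + 1 + 1 + 1 + 1 + 1) * (C * w s * (D * w s) * (s * N)) = (6 * C * D * N * s) * (w s * w s) by ring.
  apply: Rmult_le_compat_l h2; apply: Rmult_le_pos; last lra.
  by apply: Rmult_le_pos; [nra | rewrite /N; lra]. }
by do 2 (apply: (growth_nilpotent T C _ hT hC gT)).
Qed.

(** Shifting [T] and [S0] by the real and imaginary parts of [l] reduces to [l = 0]. Both shifted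
    operators annihilate [c]: for the second one, [S' - i T' = - i N] has the same form with the
    roles exchanged. *)
Lemma ascent T S0 C D l c : is_bounded_op T -> is_bounded_op S0 -> opcomm T S0 ->
  0 < C -> 0 < D -> growth T C -> growth S0 D ->
  let N y := vsub (vadd (T y) (vscal Ci (S0 y))) (vscal l y) in
  N (N c) = vzero -> N c = vzero.
Proof.
move=> hT hS hc hC hD gT gS N.
pose T' := shiftop T (Cre l); pose S' := shiftop S0 (Cim l).
have hT' : is_bounded_op T' by apply: shiftop_bop.
have hS' : is_bounded_op S' by apply: shiftop_bop.
have gT' : growth T' C by apply: growth_shift.
have gS' : growth S' D by apply: growth_shift.
have hc' : opcomm T' S'.
{ move=> v; rewrite /T' /S' /shiftop /opD /opZ /opI.
  by rewrite (bop_add _ hT) (bop_add _ hS) (bop_scal _ hT) (bop_scal _ hS) hc; vring. }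
have EN y : N y = opD T' (opZ Ci S') y.
{ rewrite /N /T' /S' /shiftop /opD /opZ /opI.
  have El : l = Cadd (Copp (Cof (- Cre l))) (Cmul Ci (Copp (Cof (- Cim l)))) by ceq; ring.
  rewrite {1}El; vring. }
have EN2 y : opD S' (opZ Ci (opZ (Copp C1) T')) y = vscal (Copp Ci) (N y).
{ rewrite EN /opD /opZ; have E : vscal (Cmul Ci Ci) (S' y) = vopp (S' y).
  { by rewrite voppE; congr vscal; ceq; ring. }
  rewrite vscal_distr_v !vscal_assoc.
  have -> : Cmul (Copp Ci) Ci = C1 by ceq; ring.
  vring. }
move=> hN.
have hN0 : is_bounded_op N.
{ have -> : N = opD T' (opZ Ci S') by apply: functional_extensionality.
  by apply: bop_opD => //; apply: bop_opZ. }
have h1 : T' c = vzero.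
{ by apply: (ascent_real T' S' C D c) => //; rewrite -!EN. }
have h2 : S' c = vzero.
{ apply: (ascent_real S' (opZ (Copp C1) T') D C c) => //.
  - exact: bop_opZ.
  - by move=> v; rewrite /opZ (bop_scal _ hS') hc'.
  - exact: growth_opp.
  - by rewrite !EN2 (bop_scal _ hN0) hN !vscalz. }
by rewrite EN /opD /opZ h1 h2; vring.
Qed.

End Growth.

(** * Local resolvents and growth of orbits *)

(* cb n k is the binomial coefficient (n + k choose k). *)
Fixpoint cb (n : nat) : nat -> R :=
  match n with
  | O => fun _ => 1
  | S m => fix aux k := match k with O => 1 | S j => cb m (S j) + aux j end
  end.
Lemma cb0n k : cb 0 k = 1. Proof. by []. Qed.
Lemma cbn0 n : cb n 0 = 1. Proof. by case: n. Qed.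
Lemma cbSS n k : cb (S n) (S k) = cb n (S k) + cb (S n) k. Proof. by []. Qed.
Lemma cb_ge0 n k : 0 <= cb n k.
Proof.
elim: n k => [|n IHn] k; first by rewrite cb0n; lra.
elim: k => [|k IHk]; first by rewrite cbn0; lra.
by rewrite cbSS; have := IHn (S k); lra.
Qed.
Lemma cb_mono n k : cb n k <= cb (S n) k.
Proof. case: k => [|k]; [by rewrite !cbn0; lra | by rewrite cbSS; have := cb_ge0 (S n) k; lra]. Qed.
(** The left side is one term of the binomial expansion of [(1 + y)^(n + k)]. *)
Lemma cb_le n k y : 0 <= y -> cb n k * y ^ k <= (1 + y) ^ (n + k).
Proof.
move=> hy; have h1 : 1 <= 1 + y by lra.
elim: n k => [|n IHn] k.
  by rewrite cb0n Rmult_1_l /=; apply: pow_incr; lra.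
elim: k => [|k IHk].
  by rewrite cbn0 Rmult_1_l Nat.add_0_r; apply: pow_R1_Rle.
rewrite cbSS; have h2 := IHn (S k); rewrite -/(pow _ _) in h2 *.
have -> : (1 + y) ^ (S n + S k) = (1 + y) ^ (n + S k) + y * (1 + y) ^ (S n + k).
{ have -> : (S n + S k = S (S n + k))%nat by lia.
  have -> : (n + S k = S n + k)%nat by lia.
  by rewrite -tech_pow_Rmult; ring. }
have -> : (cb n (S k) + cb (S n) k) * y ^ S k = cb n (S k) * y ^ S k + y * (cb (S n) k * y ^ k).
{ by rewrite /=; ring. }
by apply: Rplus_le_compat => //; apply: Rmult_le_compat_l.
Qed.
(** Since (n choose k) is at most (n + k choose k), the sum dominates the expansion of [(1 + y)^n].
    Through this, bounds for all [k] turn into an exponential gain in [n]. *)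
Lemma cb_sum_ge n y : 0 <= y -> forall m, (n <= m)%nat -> (1 + y) ^ n <= rsum (fun k => cb n k * y ^ k) (S m).
Proof.
move=> hy; elim: n => [|n IH] m hm.
  rewrite rsum_recl cb0n /=; have := rsum_ge0 (fun i => 1 * (y * y ^ i)) m; move=> H.
  have : 0 <= rsum (fun i => 1 * (y * y ^ i)) m; last lra.
  by apply: H => i _; have := pow_le y i hy; nra.
case: m hm => [|m] hm; first lia.
have h1 := IH (S m) ltac:(lia); have h2 := IH m ltac:(lia).
have -> : rsum (fun k => cb (S n) k * y ^ k) (S (S m)) =
  rsum (fun k => cb n k * y ^ k) (S (S m)) + y * rsum (fun k => cb (S n) k * y ^ k) (S m).
{ rewrite rsum_recl [in RHS]rsum_recl !cbn0 Rplus_assoc; congr (_ + _).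
  rewrite -rsum_scal -rsum_add; apply: rsum_ext => i _.
  by rewrite cbSS -tech_pow_Rmult; ring. }
have h3 : rsum (fun k => cb n k * y ^ k) (S m) <= rsum (fun k => cb (S n) k * y ^ k) (S m).
{ by apply: rsum_le => i _; apply: Rmult_le_compat_r (pow_le _ _ hy) (cb_mono n i). }
rewrite -tech_pow_Rmult; nra.
Qed.

Section Chains.
Context {X : CBanach}.
Implicit Types (x y z : X) (A B : X -> X) (u v a b : nat -> X) (l m w : Cplx).
Add Ring sz_ring : (@sz_ring_theory X).
Ltac vring := apply: sz_vec_inj; rewrite ?szE; ring.

(* The Taylor coefficients at l of an analytic solution of (z - A) u(z) = x. *)
Definition chain_rel A x l a :=
  vsub (vscal l (a O)) (A (a O)) = x /\
  forall k, vsub (vscal l (a (S k))) (A (a (S k))) = vopp (a k).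
(** The bound carries no constant of its own: the extra factor [d] absorbs it, so a common [d] means
    a common estimate. *)
Definition chain A x l d := exists a, chain_rel A x l a /\ forall k, vnorm (a k) * d ^ S k <= 1.

(** The differences satisfy [N c_0 = 0] and [N c_(k+1) = c_k]. If [N c_k = 0] then
    [N^2 c_(k+1) = 0], and the ascent hypothesis gives [c_k = N c_(k+1) = 0]. This stands in for the
    single-valued extension property. *)
Lemma chain_unique A x l a b : is_bounded_op A ->
  (forall c0, let N y := vsub (A y) (vscal l y) in N (N c0) = vzero -> N c0 = vzero) ->
  chain_rel A x l a -> chain_rel A x l b -> forall k, a k = b k.
Proof.
move=> hA asc [ha0 ha] [hb0 hb].
pose N y := vsub (A y) (vscal l y).
pose c k := vsub (a k) (b k).
have hc k : N (c (S k)) = c k.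
{ have -> : N (c (S k)) = vsub (vsub (vscal l (b (S k))) (A (b (S k)))) (vsub (vscal l (a (S k))) (A (a (S k)))).
  { rewrite /N /c (bop_sub _ hA); vring. }
  by rewrite ha hb /c; vring. }
have hN0 : N vzero = vzero by rewrite /N (bop_zero _ hA); vring.
have step k : N (c k) = vzero -> c k = vzero.
{ move=> h; rewrite -hc; apply: asc; by rewrite -!/(N _) hc. }
have all k : c k = vzero.
{ elim: k => [|k IH]; apply: step; last by rewrite hc.
  have -> : N (c O) = vsub (vsub (vscal l (b O)) (A (b O))) (vsub (vscal l (a O)) (A (a O))).
  { rewrite /N /c (bop_sub _ hA); vring. }
  by rewrite ha0 hb0; vring. }
by move=> k; apply: vsub_eq0; exact: all.
Qed.

Lemma chain_mono A x l d d' : 0 <= d' -> d' <= d -> chain A x l d -> chain A x l d'.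
Proof.
move=> h0 h [a [h1 h2]]; exists a; split => // k; apply: Rle_trans (h2 k).
by apply: Rmult_le_compat_l (vnorm_ge0 _) _; apply: pow_incr.
Qed.

Lemma vsum_cvg_bounded u y : vlim (vsum u) y -> exists M, 0 <= M /\ forall n, vnorm (u n) <= M.
Proof.
move=> H; have [N hN] := H 1 ltac:(lra).
have h0 := rsum_ge0 (fun n => vnorm (u n)) N (fun i _ => vnorm_ge0 (u i)).
exists (2 + rsum (fun n => vnorm (u n)) N); split; first lra.
move=> n; case: (Nat.le_gt_cases N n) => hn.
  have h1 := hN n hn; have h2 := hN (S n) ltac:(lia).
  have -> : u n = vsub (vsub (vsum u (S n)) y) (vsub (vsum u n) y) by rewrite vsumS; vring.
  by have := vnorm_sub (vsub (vsum u (S n)) y) (vsub (vsum u n) y); lra.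
have := rsum_mono (fun n => vnorm (u n)) (S n) N (fun i => vnorm_ge0 (u i)) ltac:(lia).
rewrite rsumS; have := rsum_ge0 (fun n => vnorm (u n)) n (fun i _ => vnorm_ge0 (u i)); lra.
Qed.

Lemma pser_partialE a l (z : Cplx) n : pser_partial X a l z n = vsum (fun k => vscal (Cpow (Csub z l) k) (a k)) (S n).
Proof.
elim: n => [|n IH]; first by rewrite /= vadd_zero_l.
by rewrite vsumS -IH.
Qed.

(** The power series of [(z - A) u(z) - x] around [l] vanishes on a small circle; the coefficient
    estimate with bound 0 kills all its coefficients, which is [chain_rel]. *)
Lemma local_resolvent_chain A x l : is_bounded_op A -> local_resolvent A x l ->
  exists d, 0 < d /\ chain A x l d.
Proof.
move=> hA [U [hU [Ul [u [hu hz]]]]].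
have [r1 [r10 hr1]] := hU l Ul; have [r2 [r20 [a ha]]] := hu l Ul.
set r := Rmin r1 r2 / 2.
have hm1 := Rmin_l r1 r2; have hm2 := Rmin_r r1 r2; have hm0 := Rmin_pos _ _ r10 r20.
have hr : 0 < r by rewrite /r; lra.
have cvg w : Cnorm w <= r -> vlim (vsum (fun k => vscal (Cpow w k) (a k))) (u (Cadd l w)) /\
  vsub (vscal (Cadd l w) (u (Cadd l w))) (A (u (Cadd l w))) = x.
{ move=> hw; have E : Csub (Cadd l w) l = w by ring.
  have hUw : U (Cadd l w) by apply: hr1; rewrite E /r in hw *; lra.
  split; last exact: hz.
  apply: vlim_unshift; have := ha (Cadd l w) hUw; rewrite E => /(_ ltac:(rewrite /r in hw; lra)).
  congr vlim; apply: functional_extensionality => n; by rewrite pser_partialE E. }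
have [M [M0 hM]] : exists M, 0 <= M /\ forall k, vnorm (a k) * r ^ k <= M.
{ have [h _] := cvg (Cof r) ltac:(rewrite Cnorm_Cof Rabs_right; lra).
  have [M [M0 hM]] := vsum_cvg_bounded _ _ h; exists M; split => // k.
  by have := hM k; rewrite vnorm_scal CnormX Cnorm_Cof Rabs_right; lra. }
(* Boundedness of the terms at radius [r] gives absolute convergence at half of it. *)
pose R0 := r / 2; have hR0 : 0 < R0 by rewrite /R0; lra.
have sa : bsum (fun k => vnorm (a k) * R0 ^ k) (M * / (1 - / 2)).
{ apply: bsum_le (bsum_scal M _ _ M0 (bsum_geom (/ 2) ltac:(lra))) => k.
  rewrite /R0 /Rdiv Rpow_mult_distr -Rmult_assoc; apply: Rmult_le_compat_r (hM k).
  by apply: pow_le; lra. }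
have sw w : Cnorm w = R0 -> absum (fun k => vscal (Cpow w k) (a k)).
{ move=> hw; eexists; apply: bsum_le sa => k; rewrite vnorm_scal CnormX hw; lra. }
pose G y := vsub (vscal l y) (A y).
have hG : is_bounded_op G.
{ have -> : G = opD (opZ l opI) (opZ (Copp C1) A).
  { by apply: functional_extensionality => y; rewrite /G /opD /opZ /opI; vring. }
  by apply: bop_opD; apply: bop_opZ => //; apply: bop_opI. }
(* The coefficients of [(l + w - A) u(l + w) - x] in powers of [w]. *)
pose c k := match k with O => vsub (G (a O)) x | S j => vadd (G (a (S j))) (a j) end.
have sGS w : Cnorm w = R0 -> absum (fun k => vscal (Cpow w (S k)) (G (a (S k)))).
{ move=> hw; have := absum_shift _ (absum_bop G _ hG (sw w hw)).
  congr absum; apply: functional_extensionality => k; by rewrite (bop_scal _ hG). }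
have sS w : Cnorm w = R0 -> absum (fun k => vscal (Cpow w (S k)) (a k)).
{ move=> hw; have := absum_scal w _ (sw w hw).
  congr absum; apply: functional_extensionality => k; by rewrite vscal_assoc. }
have Ec w k : vscal (Cpow w (S k)) (c (S k)) =
  vadd (vscal (Cpow w (S k)) (G (a (S k)))) (vscal (Cpow w (S k)) (a k)).
{ by rewrite /c; vring. }
have sc w : Cnorm w = R0 -> absum (fun k => vscal (Cpow w k) (c k)).
{ move=> hw; apply: absum_unshift; have := absum_add _ _ (sGS w hw) (sS w hw).
  congr absum; by apply: functional_extensionality => k; rewrite Ec. }
have tc w : Cnorm w = R0 -> vtot (fun k => vscal (Cpow w k) (c k)) = vzero.
{ move=> hw; have [h1 h2] := cvg w ltac:(rewrite hw /R0; lra).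
  have Eu := vtot_unique _ _ h1.
  have EG : vtot (fun k => vscal (Cpow w (S k)) (G (a (S k)))) = vsub (G (u (Cadd l w))) (G (a O)).
  { have E1 := vtot_bop G _ hG (sw w hw); rewrite Eu in E1.
    rewrite vtot_recl in E1; last exact: absum_bop (sw w hw).
    rewrite -E1 /= vscal_one vsub_addl; congr vtot; apply: functional_extensionality => k.
    by rewrite (bop_scal _ hG). }
  rewrite vtot_recl; last exact: sc.
  have -> : (fun k => vscal (Cpow w (S k)) (c (S k))) =
    fun k => vadd (vscal (Cpow w (S k)) (G (a (S k)))) (vscal (Cpow w (S k)) (a k)).
  { by apply: functional_extensionality => k; rewrite Ec. }
  rewrite vtot_add; [|exact: sGS|exact: sS].
  have -> : vtot (fun k => vscal (Cpow w (S k)) (a k)) = vscal w (u (Cadd l w)).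
  { rewrite -Eu -vtot_scal; last exact: sw.
    by congr vtot; apply: functional_extensionality => k; rewrite vscal_assoc. }
  rewrite EG /= vscal_one -{1}h2 /G; vring. }
have hc0 k : c k = vzero.
{ have hn k' : vnorm (vscal (Cpow (Cof R0) k') (c k')) = vnorm (c k') * R0 ^ k'.
  { by rewrite vnorm_scal CnormX Cnorm_Cof Rabs_right; lra. }
  have [D hD] := sc (Cof R0) ltac:(rewrite Cnorm_Cof Rabs_right; lra).
  have hD' : bsum (fun j => vnorm (c j) * R0 ^ j) D by apply: bsum_le hD => k'; rewrite hn; lra.
  have h := cauchy_estimate c R0 0 D ltac:(lra) hD'.
  have h' := h (fun t _ => ltac:(rewrite tc ?vnorm_zero; [lra | rewrite CnormM Cnorm_Cis Cnorm_Cof Rabs_right; lra])) k.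
  apply: vnorm_eq0; apply: Rle_antisym (vnorm_ge0 _).
  apply: (Rmult_le_reg_r (R0 ^ k)); first exact: pow_lt.
  by rewrite Rmult_0_l. }
have hM1 : 0 < / (M + 1) by apply: Rinv_0_lt_compat; lra.
(* The second entry pays for the extra factor [d] in [chain], as [d (M + 1) <= 1]. *)
exists (Rmin r (/ (M + 1))); split; first exact: Rmin_pos.
set d := Rmin _ _; have d1 : d <= r by apply: Rmin_l.
have d2 : d <= / (M + 1) by apply: Rmin_r.
have d0 : 0 < d by apply: Rmin_pos.
exists a; split.
  split; first by apply: vsub_eq0; exact: (hc0 O).
  move=> k; have := hc0 (S k); rewrite /= -/(G (a (S k))) => E.
  have -> : G (a (S k)) = vsub (vadd (G (a (S k))) (a k)) (a k) by vring.
  by rewrite E; vring.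
move=> k; have h1 := hM k.
have h2 : vnorm (a k) * d ^ k <= M.
{ apply: Rle_trans h1; apply: Rmult_le_compat_l (vnorm_ge0 _) _; apply: pow_incr; lra. }
have h3 : d * (M + 1) <= 1.
{ by apply: Rle_trans (Rmult_le_compat_r (M + 1) _ _ ltac:(lra) d2) _; rewrite Rinv_l; lra. }
rewrite -tech_pow_Rmult; have h4 := vnorm_ge0 (a k); have h5 := pow_le d k ltac:(lra).
have h6 : 0 <= vnorm (a k) * d ^ k by apply: Rmult_le_pos.
nra.
Qed.

(** Taylor re-expansion at [m]: the new coefficients are the sums over [n] of
    [(n + k choose k) h^n a_(n+k)]. For [|h| <= d / 4] the terms are at most [2^k / d^(k+1)] times
    [2^(-n)], and summation gives exactly [(2 / d)^(k+1)]. *)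
Lemma chain_reexpand A x l m d : is_bounded_op A -> 0 < d -> chain A x l d ->
  Cnorm (Csub m l) <= d / 4 -> chain A x m (d / 2).
Proof.
move=> hA hd [a [[ha0 ha] hb]] hml; set h := Csub m l in hml.
pose t k n := vscal (Cmul (Cpow h n) (Cof (cb n k))) (a (n + k)%nat).
have bt k n : vnorm (t k n) <= (2 ^ k / d ^ S k) * (/ 2) ^ n.
{ rewrite /t vnorm_scal CnormM CnormX Cnorm_Cof Rabs_right; last by apply: Rle_ge; apply: cb_ge0.
  have h1 := cb_le n k 1 ltac:(lra); rewrite pow1 Rmult_1_r in h1.
  have h2 := hb (n + k)%nat.
  have h3 : Cnorm h ^ n <= (d / 4) ^ n by apply: pow_incr; split; [apply: Cnorm_ge0|].
  have dk : 0 < d ^ S (n + k) by apply: pow_lt.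
  have h4 : vnorm (a (n + k)%nat) <= / d ^ S (n + k).
  { by apply: (Rmult_le_reg_r (d ^ S (n + k))) => //; rewrite Rinv_l; lra. }
  have -> : 2 ^ k / d ^ S k * (/ 2) ^ n = (d / 4) ^ n * (1 + 1) ^ (n + k) * / d ^ S (n + k).
  { have -> : S (n + k) = (n + S k)%nat by lia.
    rewrite !pow_add /Rdiv !Rpow_mult_distr !pow_inv.
    have -> : (4 = 2 * 2) by ring.
    rewrite Rpow_mult_distr (_ : 1 + 1 = 2); last by ring.
    have := pow_nonzero d n ltac:(lra); have := pow_nonzero d (S k) ltac:(lra).
    have := pow_nonzero 2 n ltac:(lra) => *; field; done. }
  have c0 := cb_ge0 n k; have n0 := pow_le _ n (Cnorm_ge0 h).
  apply: Rmult_le_compat h4; [|exact: vnorm_ge0|].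
    by apply: Rmult_le_pos.
  by apply: Rmult_le_compat. }
have ck k : 0 <= 2 ^ k / d ^ S k.
{ by apply: Rdiv_le_0_compat; [apply: pow_le; lra | apply: pow_lt]. }
have geo := bsum_geom (/ 2) ltac:(lra).
have st k : bsum (fun n => vnorm (t k n)) (2 ^ k / d ^ S k * / (1 - / 2)).
{ by apply: bsum_le (bt k) (bsum_scal _ _ _ (ck k) geo). }
have sat k : absum (t k) by eexists; apply: st.
pose b k := vtot (t k).
pose G y := vsub (vscal l y) (A y).
have hG : is_bounded_op G.
{ have -> : G = opD (opZ l opI) (opZ (Copp C1) A).
  { by apply: functional_extensionality => y; rewrite /G /opD /opZ /opI; vring. }
  by apply: bop_opD; apply: bop_opZ => //; apply: bop_opI. }
have EG y : vsub (vscal m y) (A y) = vadd (G y) (vscal h y).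
{ have -> : m = Cadd l h by rewrite /h; ring.
  rewrite /G; vring. }
exists b; split; last first.
  move=> k; have := vtot_norm _ _ (st k); rewrite -/(b k) => hk.
  have hp : 0 <= (d / 2) ^ S k by apply: pow_le; lra.
  apply: Rle_trans (Rmult_le_compat_r _ _ _ hp hk) _.
  right; rewrite /Rdiv Rpow_mult_distr pow_inv -!tech_pow_Rmult.
  have := pow_nonzero d k ltac:(lra); have := pow_nonzero 2 k ltac:(lra) => *; field; lra.
split.
  rewrite EG /b -(vtot_bop _ _ hG (sat O)) vtot_recl; last exact: absum_bop (sat O).
  have -> : (fun n => G (t O (S n))) = fun n => vscal (Copp h) (t O n).
  { apply: functional_extensionality => n; rewrite /t (bop_scal _ hG) !cbn0 !Nat.add_0_r.
    rewrite [G (a (S n))]ha -[Cpow h (S n)]/(Cmul h (Cpow h n)); vring. }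
  rewrite vtot_scal; last exact: sat.
  have -> : t O O = a O by rewrite /t /= -/C1; vring.
  by rewrite [G (a O)]ha0; vring.
move=> k; rewrite EG /b -(vtot_bop _ _ hG (sat (S k))).
have EGt n : G (t (S k) n) = vscal (Copp (Cmul (Cpow h n) (Cof (cb n (S k))))) (a (n + k)%nat).
{ rewrite /t (bop_scal _ hG).
  have -> : (n + S k = S (n + k))%nat by lia.
  by rewrite [G (a (S (n + k)))]ha; vring. }
have sG := absum_bop _ _ hG (sat (S k)).
rewrite vtot_recl // [vtot (t k)]vtot_recl //.
(* Pascal's rule splits off the terms of the coefficient of index [k]. *)
have -> : (fun n => G (t (S k) (S n))) =
  fun n => vadd (vscal (Copp C1) (t k (S n))) (vscal (Copp h) (t (S k) n)).
{ apply: functional_extensionality => n; rewrite EGt cbSS CofD /t.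
  have -> : (n + S k = S n + k)%nat by lia.
  rewrite -[Cpow h (S n)]/(Cmul h (Cpow h n)); vring. }
rewrite vtot_add; [|by apply: absum_scal; apply: absum_shift|by apply: absum_scal].
rewrite vtot_scal; last exact: absum_shift.
rewrite vtot_scal // EGt /t !cb0n /= -/C1; vring.
Qed.

(** For [|z| > rho] the sum of [A^n x w^(n+1)] with [w = 1 / z] solves the equation. The chain
    consists of its Taylor coefficients at [z]; differentiating [k] times in [z] produces the
    binomial coefficients and the sign. *)
Lemma neumann_chain A x K rho (z : Cplx) w : is_bounded_op A -> 0 < rho ->
  (forall n, vnorm (Nat.iter n A x) <= K * rho ^ n) ->
  Cmul z w = C1 -> Cnorm w * rho < 1 ->
  let s k := vtot (fun n => vscal (Cpow w n) (vscal (Cof (cb n k)) (Nat.iter n A x))) in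
  (forall k, exists D, bsum (fun n => vnorm (vscal (Cof (cb n k)) (Nat.iter n A x)) * Cnorm w ^ n) D) /\
  chain_rel A x z (fun k => vscal (Cmul (Cpow (Copp C1) k) (Cpow w (S k))) (s k)).
Proof.
move=> hA hrho hK hzw hw s.
pose t k n := vscal (Cpow w n) (vscal (Cof (cb n k)) (Nat.iter n A x)).
have K0 : 0 <= K by have := hK O; have := vnorm_ge0 x => /=; lra.
have hw0 := Cnorm_ge0 w.
have tn k n : vnorm (t k n) = vnorm (vscal (Cof (cb n k)) (Nat.iter n A x)) * Cnorm w ^ n.
{ by rewrite /t vnorm_scal CnormX; ring. }
have bt k : exists D, bsum (fun n => vnorm (t k n)) D.
{ set q := Cnorm w * rho in hw.
  have q0 : 0 <= q by apply: Rmult_le_pos; lra.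
  (* The room left by [q < 1] absorbs the binomial coefficients through [cb_le]. *)
  have [y [y0 qy]] : exists y : R, 0 < y /\ 0 <= (1 + y) * q < 1 by exists ((1 - q) / 2); nra.
  have hc : 0 <= K * ((1 + y) / y) ^ k.
  { by apply: Rmult_le_pos => //; apply: pow_le; apply: Rdiv_le_0_compat; lra. }
  exists (K * ((1 + y) / y) ^ k * / (1 - (1 + y) * q)); apply: bsum_le (bsum_scal _ _ _ hc (bsum_geom _ qy)) => n.
  rewrite tn vnorm_scal Cnorm_Cof Rabs_right; last by apply: Rle_ge; apply: cb_ge0.
  have h1 := cb_le n k y ltac:(lra); have yk : 0 < y ^ k by apply: pow_lt.
  have h2 : cb n k <= (1 + y) ^ (n + k) / y ^ k.
  { by apply: (Rmult_le_reg_r (y ^ k)) => //; rewrite /Rdiv Rmult_assoc Rinv_l; lra. }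
  have -> : K * ((1 + y) / y) ^ k * ((1 + y) * q) ^ n =
    (1 + y) ^ (n + k) / y ^ k * (K * rho ^ n) * Cnorm w ^ n.
  { rewrite /q pow_add /Rdiv !Rpow_mult_distr pow_inv; field; lra. }
  apply: Rmult_le_compat_r; first exact: pow_le.
  apply: Rmult_le_compat => //; [exact: cb_ge0 | exact: vnorm_ge0]. }
split; first by move=> k; have [D hD] := bt k; exists D; apply: bsum_le hD => n; rewrite tn; lra.
have at_ k : absum (t k) by have [D hD] := bt k; exists D.
have Et k n : vscal w (A (t k n)) = vscal (Cmul (Cpow w (S n)) (Cof (cb n k))) (Nat.iter (S n) A x).
{ by rewrite /t !(bop_scal _ hA) -[Cpow w (S n)]/(Cmul w (Cpow w n)) -[Nat.iter (S n) A x]/(A (Nat.iter n A x)); vring. }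
have aAt k : absum (fun n => vscal w (A (t k n))) by apply: absum_scal; apply: absum_bop.
have EA k : vscal w (A (s k)) = vtot (fun n => vscal w (A (t k n))).
{ by rewrite vtot_scal ?(vtot_bop A _ hA (at_ k)) //; apply: absum_bop. }
have t0 k : t k O = x by rewrite /t cb0n /= -/C1; vring.
(* [(1 - w A) s_k = s_(k-1)], with [x] in place of [s_(-1)]: Pascal's rule again. *)
have rel k : vsub (s k) (vscal w (A (s k))) = match k with O => x | S j => s j end.
{ have Es j : s j = vadd x (vtot (fun n => t j (S n))).
  { by rewrite -{1}(t0 j); exact: (vtot_recl (t j) (at_ j)). }
  rewrite EA Es.
  have es : vtot (fun n => t k (S n)) = vadd (vtot (fun n => vscal w (A (t k n))))
    (match k with O => vzero | S j => vtot (fun n => t j (S n)) end).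
  { case: k => [|j].
      rewrite vadd_zero; congr vtot; apply: functional_extensionality => n.
      by rewrite Et /t !cbn0; vring.
    rewrite -vtot_add; [|exact: aAt|exact: absum_shift (at_ j)].
    congr vtot; apply: functional_extensionality => n.
    by rewrite Et /t cbSS CofD; vring. }
  rewrite es; case: (k) => [|j]; first by vring.
  rewrite Es; vring. }
split.
  rewrite (bop_scal _ hA) /=.
  have -> : vsub (vscal z (vscal (Cmul C1 (Cmul w C1)) (s O))) (vscal (Cmul C1 (Cmul w C1)) (A (s O))) =
    vadd (vsub (s O) (vscal w (A (s O)))) (vscal (Csub (Cmul z w) C1) (s O)) by vring.
  by rewrite rel hzw; vring.
move=> k; rewrite (bop_scal _ hA).
have Ep j : Cpow w (S j) = Cmul w (Cpow w j) by [].
have Em j : Cpow (Copp C1) (S j) = Copp (Cpow (Copp C1) j).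
{ by rewrite -[Cpow _ (S j)]/(Cmul (Copp C1) (Cpow (Copp C1) j)); ring. }
have -> : vsub (vscal z (vscal (Cmul (Cpow (Copp C1) (S k)) (Cpow w (S (S k)))) (s (S k))))
    (vscal (Cmul (Cpow (Copp C1) (S k)) (Cpow w (S (S k)))) (A (s (S k)))) =
  vadd (vscal (Cmul (Cpow (Copp C1) (S k)) (Cpow w (S k))) (vsub (s (S k)) (vscal w (A (s (S k))))))
    (vscal (Cmul (Csub (Cmul z w) C1) (Cmul (Cpow (Copp C1) (S k)) (Cpow w (S k)))) (s (S k))).
{ rewrite (Ep (S k)); vring. }
by rewrite rel hzw Em; vring.
Qed.

(** On the circle of radius [r1] uniqueness identifies the given chains with the Neumann ones, so
    the bounds [d^(-(k+1))] apply to power series in [1 / z] with coefficients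
    [(n + k choose k) A^n x]. Cauchy estimates for all [k] together give the rate
    [r1 / (1 + d / (2 r1))], which lies below [rho] once [r1] is close to [rho]. *)
Lemma growth_improve A x K rho r1 d : is_bounded_op A ->
  (forall l c0, let N y := vsub (A y) (vscal l y) in N (N c0) = vzero -> N c0 = vzero) ->
  0 < rho < r1 -> 0 < d -> (forall n, vnorm (Nat.iter n A x) <= K * rho ^ n) ->
  (forall t, 0 <= t <= 2 * PI -> chain A x (Cmul (Cof r1) (Cis t)) d) ->
  forall n, vnorm (Nat.iter n A x) <= 2 * r1 / d * (r1 / (1 + d / (2 * r1))) ^ n.
Proof.
move=> hA asc hrho hd hK hch n.
have hr1 : 0 < / r1 by apply: Rinv_0_lt_compat; lra.
have hcn : Cnorm (Cof (/ r1)) = / r1 by rewrite Cnorm_Cof Rabs_right; lra.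
have key k : cb n k * vnorm (Nat.iter n A x) * (/ r1) ^ n <= (r1 / d) ^ S k.
{ have := cauchy_estimate (fun n => vscal (Cof (cb n k)) (Nat.iter n A x)) (/ r1) ((r1 / d) ^ S k).
  have hw t : Cnorm (Cmul (Cof (/ r1)) (Cis (- t))) = / r1 by rewrite CnormM Cnorm_Cis hcn; ring.
  have hzw t : Cmul (Cmul (Cof r1) (Cis t)) (Cmul (Cof (/ r1)) (Cis (- t))) = C1.
  { have -> : forall p q p0 q0, Cmul (Cmul p q) (Cmul p0 q0) = Cmul (Cmul p p0) (Cmul q q0) by intros; ring.
    rewrite CisK -CofM Rinv_r; last lra.
    by rewrite -/C1; ring. }
  have hwr t : Cnorm (Cmul (Cof (/ r1)) (Cis (- t))) * rho < 1.
  { rewrite hw; apply: (Rmult_lt_reg_l r1); first lra.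
    rewrite -Rmult_assoc Rinv_r; lra. }
  have NC t := neumann_chain A x K rho _ _ hA (proj1 hrho) hK (hzw t) (hwr t).
  have [D hD] := proj1 (NC 0) k; rewrite hw in hD.
  move=> /(_ D (Rlt_le _ _ hr1) hD) H; have {}H := H _ n.
  rewrite vnorm_scal Cnorm_Cof Rabs_right in H; last by apply: Rle_ge; apply: cb_ge0.
  apply: H => t ht; have [a [ca ba]] := hch t ht.
  have := chain_unique A x _ _ _ hA (asc _) ca (proj2 (NC t)) k.
  set s := vtot _ => E; have := ba k; rewrite E vnorm_scal CnormM !CnormX hw CnormN Cnorm1 pow1 Rmult_1_l.
  have p1 : 0 < (/ r1) ^ S k by apply: pow_lt.
  have p2 : 0 < d ^ S k by apply: pow_lt.
  move=> h; apply: (Rmult_le_reg_r ((/ r1) ^ S k * d ^ S k)); first exact: Rmult_lt_0_compat.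
  rewrite -!Rpow_mult_distr (_ : r1 / d * (/ r1 * d) = 1) ?pow1; last by field; lra.
  by rewrite Rpow_mult_distr; lra. }
(* Half of [d / r1], so that the bounds [(r1 / d)^(k+1) y^k] form a geometric series of ratio
   1/2. *)
set y := d / (2 * r1).
have hy : 0 < y by apply: Rdiv_lt_0_compat; lra.
have h1 := cb_sum_ge n y ltac:(lra) n (Nat.le_refl n).
set v := vnorm (Nat.iter n A x) * (/ r1) ^ n.
have v0 : 0 <= v by apply: Rmult_le_pos; [exact: vnorm_ge0 | apply: pow_le; lra].
have h2 : v * rsum (fun k => cb n k * y ^ k) (S n) <= r1 / d * / (1 - / 2).
{ have hc : 0 <= r1 / d by apply: Rdiv_le_0_compat; lra.
  apply: Rle_trans (bsum_scal _ _ _ hc (bsum_geom (/ 2) ltac:(lra)) (S n)).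
  rewrite -rsum_scal; apply: rsum_le => k _.
  have h3 := Rmult_le_compat_r (y ^ k) _ _ (pow_le y k ltac:(lra)) (key k).
  have -> : r1 / d * (/ 2) ^ k = (r1 / d) ^ S k * y ^ k.
  { rewrite -tech_pow_Rmult Rmult_assoc -Rpow_mult_distr.
    by congr (_ * _ ^ k); rewrite /y; field; lra. }
  rewrite /v; lra. }
have h4 : v * (1 + y) ^ n <= 2 * r1 / d.
{ apply: Rle_trans (Rmult_le_compat_l v _ _ v0 h1) _; apply: Rle_trans h2 _; right; field; lra. }
have p1 : 0 < (1 + y) ^ n by apply: pow_lt; lra.
have p2 : 0 < r1 ^ n by apply: pow_lt; lra.
have -> : vnorm (Nat.iter n A x) = v * (1 + y) ^ n * (r1 / (1 + y)) ^ n.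
{ rewrite /v /Rdiv Rpow_mult_distr !pow_inv; field; lra. }
apply: Rmult_le_compat_r h4; apply: pow_le; apply: Rdiv_le_0_compat; lra.
Qed.

(** Otherwise the infimum [rs] of the admissible rates exceeds [r]. Every point of the circle of
    radius [rs] then has a local solution, compactness yields a common [d] also on slightly larger
    circles, and [growth_improve] produces a rate below [rs]. *)
Lemma local_radius_growth A x r : is_bounded_op A ->
  (forall l c0, let N y := vsub (A y) (vscal l y) in N (N c0) = vzero -> N c0 = vzero) ->
  is_local_spectral_radius A x r ->
  forall rho, r < rho -> exists K, forall n, vnorm (Nat.iter n A x) <= K * rho ^ n.
Proof.
move=> hA asc [hr _] rho hrho.
have r0 : 0 <= r by apply: hr; left.
pose E q := 0 < q /\ exists K, forall n, vnorm (Nat.iter n A x) <= K * q ^ n.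
apply: NNPP => hn.
have hE q : E q -> rho < q.
{ move=> [q0 [K hK]]; apply: Rnot_le_lt => h; apply: hn; exists K => n.
  have K0 : 0 <= K by have := hK O; have := vnorm_ge0 x => /=; lra.
  by apply: Rle_trans (hK n) _; apply: Rmult_le_compat_l => //; apply: pow_incr; lra. }
(* [completeness] provides suprema, hence the passage to negatives. *)
have [s hs] : {s | is_lub (fun q => E (- q)) s}.
{ apply: completeness.
    by exists 0 => q [h _]; lra.
  have [M hM] := bop_bound A hA; exists (- (M + 1)); rewrite /E Ropp_involutive; split; first by have := proj1 hM; lra.
  exists (vnorm x) => n; apply: Rle_trans (opbound_iter A M n x hM) _; rewrite Rmult_comm.
  by apply: Rmult_le_compat_l (vnorm_ge0 _) _; apply: pow_incr; have := proj1 hM; lra. }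
set rs := - s.
have hrs : rho <= rs.
{ have : s <= - rho; last by rewrite /rs; lra.
  by apply: (proj2 hs) => q /hE; lra. }
have near q : rs < q -> exists q', E q' /\ q' < q.
{ move=> hq; apply: NNPP => hne; have : s <= - q; last by rewrite /rs in hq; lra.
  apply: (proj2 hs) => q0 hq0; apply: Rnot_lt_le => h; apply: hne; exists (- q0); split => //; lra. }
have low q : E q -> rs <= q.
{ by move=> hq; have : - q <= s; [apply: (proj1 hs); rewrite Ropp_involutive | rewrite /rs; lra]. }
have loc t : exists d, 0 < d /\ chain A x (Cmul (Cof rs) (Cis t)) d.
{ apply: local_resolvent_chain => //; apply: NNPP => hspec.
  have : rs <= r; last lra.
  apply: hr; right; exists (Cmul (Cof rs) (Cis t)); split => //.
  by rewrite CnormM Cnorm_Cis Cnorm_Cof Rabs_right; lra. }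
pose dl t := proj1_sig (constructive_indefinite_description _ (loc t)).
have hdl t : 0 < dl t /\ chain A x (Cmul (Cof rs) (Cis t)) (dl t).
{ exact: (proj2_sig (constructive_indefinite_description _ (loc t))). }
(* Radius and angle will each contribute at most [dl t / 8] to the distance of the centres, together
   the [d / 4] allowed by [chain_reexpand]. *)
have hq8 t : 0 < dl t / (8 * (rs + 1)) by apply: Rdiv_lt_0_compat; have := proj1 (hdl t); lra.
have [D hD] := compactness_value_1d 0 (2 * PI) (fun t => mkposreal _ (hq8 t)).
have D0 := cond_pos D.
have unif r1 : rs <= r1 <= rs + D -> forall t, 0 <= t <= 2 * PI ->
  chain A x (Cmul (Cof r1) (Cis t)) (4 * D).
{ move=> hr1 t ht; have [t' [_ [h1 h2]]] := NNPP _ (hD t ht); rewrite /= in h1 h2.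
  have [d0 dc] := hdl t'; set d := dl t' in h1 h2 d0 dc.
  have E1 : d / (8 * (rs + 1)) * (8 * (rs + 1)) = d by field; lra.
  have h3 : 8 * D <= d by nra.
  apply: (chain_mono _ _ _ (d / 2)); [lra | lra |].
  apply: chain_reexpand dc _ => //.
  have -> : Csub (Cmul (Cof r1) (Cis t)) (Cmul (Cof rs) (Cis t')) =
    Cadd (Cmul (Cof (r1 - rs)) (Cis t)) (Cmul (Cof rs) (Csub (Cis t) (Cis t'))) by ceq; ring.
  apply: Rle_trans (Cnorm_triangle _ _) _; rewrite !CnormM Cnorm_Cis !Cnorm_Cof.
  rewrite !Rabs_right; [|lra|lra].
  have := Cis_lipschitz t t'; have := Rabs_pos (t - t') => h4 h5.
  have h6 : rs * Cnorm (Csub (Cis t) (Cis t')) <= (rs + 1) * (d / (8 * (rs + 1))).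
  { by apply: Rmult_le_compat; [lra | apply: Cnorm_ge0 | lra | lra]. }
  lra. }
(* As [h] is at most [D / 2] and [rs / 2], one has [(rs + h)^2 < rs (rs + h + 2 D)]: the improved
   rate contradicts the minimality of [rs]. *)
pose h := Rmin D rs / 2.
have m1 := Rmin_l D rs; have m2 := Rmin_r D rs; have m0 : 0 < Rmin D rs by apply: Rmin_pos; lra.
have hh : 0 < h by rewrite /h; lra.
have [q [[q0 [K hK]] hq]] := near (rs + h) ltac:(lra).
have G := growth_improve A x K q (rs + h) (4 * D) hA asc (conj q0 hq) ltac:(lra) hK
  (unif (rs + h) ltac:(rewrite /h; lra)).
have : rs <= (rs + h) / (1 + 4 * D / (2 * (rs + h))).
{ apply: low; split; last by eexists; exact: G.
  apply: Rdiv_lt_0_compat; first lra.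
  have : 0 < 4 * D / (2 * (rs + h)) by apply: Rdiv_lt_0_compat; lra.
  lra. }
have -> : (rs + h) / (1 + 4 * D / (2 * (rs + h))) = (rs + h) * (rs + h) / (rs + h + 2 * D) by field; lra.
move=> hf; have : rs * (rs + h + 2 * D) <= (rs + h) * (rs + h).
{ apply: (Rmult_le_reg_r (/ (rs + h + 2 * D))); first by apply: Rinv_0_lt_compat; lra.
  by rewrite Rmult_assoc Rinv_r ?Rmult_1_r; lra. }
rewrite /h in hh m0 *; nra.
Qed.

End Chains.

(** With [N = n + 1] this is [N! <= e N (N / e)^N]; the induction step is
    [(1 + 1 / m)^(m + 1) >= e]. *)
Lemma fact_exp_le n : INR (fact (S n)) * exp (INR (S n)) <= exp 1 * INR (S n) ^ S (S n).
Proof.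
elim: n => [|n IH]; first by rewrite /=; lra.
have hn : 0 < INR (S n) by apply: lt_0_INR; lia.
set m := INR (S n) in IH hn *.
have Em : INR (S (S n)) = m + 1 by rewrite S_INR.
rewrite fact_simpl mult_INR Em exp_plus.
have e1 : exp 1 * m ^ S (S n) <= (m + 1) ^ S (S n).
{ have h : m / (m + 1) <= exp (- / (m + 1)).
  { have -> : m / (m + 1) = 1 + - / (m + 1) by field; lra.
    exact: exp_ineq1_le. }
  have h2 : (m / (m + 1)) ^ S (S n) <= exp (- 1).
  { have -> : exp (- 1) = exp (- / (m + 1)) ^ S (S n).
    { rewrite -Rpower_pow; last exact: exp_pos.
      rewrite /Rpower ln_exp Em; congr exp; field; lra. }
    apply: pow_incr; split => //; apply: Rdiv_le_0_compat; lra. }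
  have p1 : 0 < (m + 1) ^ S (S n) by apply: pow_lt; lra.
  rewrite /Rdiv Rpow_mult_distr pow_inv exp_Ropp in h2.
  have p2 := exp_pos 1.
  have h3 := Rmult_le_compat_r ((m + 1) ^ S (S n) * exp 1) _ _ ltac:(nra) h2.
  have E1 : m ^ S (S n) * / (m + 1) ^ S (S n) * ((m + 1) ^ S (S n) * exp 1) = exp 1 * m ^ S (S n) by field; lra.
  have E2 : / exp 1 * ((m + 1) ^ S (S n) * exp 1) = (m + 1) ^ S (S n) by field; lra.
  by rewrite E1 E2 in h3. }
have e0 := exp_pos 1.
have -> : exp 1 * (m + 1) ^ S (S (S n)) = exp 1 * (m + 1) * (m + 1) ^ S (S n) by rewrite -tech_pow_Rmult; ring.
have -> : (m + 1) * INR (fact (S n)) * (exp m * exp 1) = exp 1 * (m + 1) * (INR (fact (S n)) * exp m) by ring.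
by apply: Rmult_le_compat_l; [nra | lra].
Qed.

(** * From the orbit of T + iS to the orbit of T *)

Section PowerGrowth.
Context {X : CBanach}.
Implicit Types (x y z : X) (a b : Cplx) (A B : X -> X) (u v : nat -> X).

(** The Cauchy estimate for [exp(zT) x] at radius [N / s1], the minimiser of [exp(s1 R0) / R0^N],
    combined with [fact_exp_le], gives [T^N x = O(N s1^N)]. *)
Lemma power_growth al T S0 C D x K s s' : 0 <= al < 1 ->
  is_bounded_op T -> is_bounded_op S0 -> opcomm T S0 ->
  0 < C -> 0 < D -> growth (X := X) al T C -> growth al S0 D -> 0 < s < s' ->
  (forall n, vnorm (Nat.iter n (opD T (opZ Ci S0)) x) <= K * s ^ n) ->
  exists K', 0 <= K' /\ forall n, vnorm (Nat.iter n T x) <= K' * s' ^ n.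
Proof.
move=> hal hT hS hc hC hD gT gS hs; set A := opD T (opZ Ci S0) => hK.
have hA : is_bounded_op A by apply: bop_opD => //; apply: bop_opZ.
have K0 : 0 <= K by have := hK O; have := vnorm_ge0 x => /=; lra.
(* The lower half of the gap absorbs the polynomial growth of the exponentials, the upper half the
   factor [N]. *)
pose s1 := (s + s') / 2; pose e := s1 - s; have e0 : 0 < e by rewrite /e /s1; lra.
have s10 : 0 < s1 by rewrite /s1; lra.
pose K1 := C * D * K * (2 + 2 / e) ^ 2.
have K10 : 0 <= K1 by apply: Rmult_le_pos; [repeat apply: Rmult_le_pos; lra | apply: pow2_ge_0].
have H R0 : 0 <= R0 -> forall n, vnorm (Nat.iter n T x) * R0 ^ n <= INR (fact n) * (K1 * exp (s1 * R0)).
{ move=> hR; apply: Cauchy_exp => //; case=> b a hz.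
  have ha := Cim_le (mkC b a); have hb := Cre_le (mkC b a); rewrite hz /= in ha hb.
  apply: Rle_trans (Exp_growth al T S0 C D a b x hT hS hc hC hD gT gS) _.
  have wa := Rle_trans _ _ _ (weight_mono al hal _ _ (Rabs_pos a) ha) (weight_linear al hal _ hR).
  have wb := Rle_trans _ _ _ (weight_mono al hal _ _ (Rabs_pos b) hb) (weight_linear al hal _ hR).
  have wa1 := weight_ge1 al (Rabs a); have wb1 := weight_ge1 al (Rabs b).
  have hE : vnorm (Exp (opZ (Cof b) A) x) <= K * exp (s * R0).
  { apply: (Rle_trans _ (K * exp (Rabs b * s))).
      apply: Exp_norm_gen; first by have := Rabs_pos b; nra.
      move=> n; rewrite iter_opZ // vnorm_scal CnormX Cnorm_Cof Rpow_mult_distr.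
      by have := hK n; have := pow_le _ n (Rabs_pos b); nra.
    by apply: Rmult_le_compat_l => //; apply: exp_le; nra. }
  (* Each of the two factors [2 + R0] costs [exp(e R0 / 2)], in total the step from [s] to [s1]. *)
  have h2 : 2 + R0 <= (2 + 2 / e) * exp (e / 2 * R0).
  { have h := exp_ineq1_le (e / 2 * R0).
    have h0 : 0 < 2 / e by apply: Rdiv_lt_0_compat; lra.
    apply: (Rle_trans _ ((2 + 2 / e) * (1 + e / 2 * R0))); last by apply: Rmult_le_compat_l; lra.
    have -> : (2 + 2 / e) * (1 + e / 2 * R0) = 2 + R0 + 2 / e + e * R0 by field; lra.
    nra. }
  have -> : K1 * exp (s1 * R0) = C * ((2 + 2 / e) * exp (e / 2 * R0)) * (D * ((2 + 2 / e) * exp (e / 2 * R0))) * (K * exp (s * R0)).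
  { have -> : s1 * R0 = e / 2 * R0 + e / 2 * R0 + s * R0 by rewrite /e; field.
    by rewrite !exp_plus /K1; ring. }
  have g0 : 0 <= (2 + 2 / e) * exp (e / 2 * R0) by lra.
  apply: Rmult_le_compat hE; [by apply: Rmult_le_pos; nra | exact: vnorm_ge0 |].
  by apply: Rmult_le_compat; nra. }
(* [s' = (1 + y) s1], and Bernoulli's inequality gives [N <= (1 + y)^N / y]. *)
pose y := s' / s1 - 1.
have y0 : 0 < y.
{ have : s1 * (s' / s1) = s' by field; lra.
  by rewrite /y /s1 => ?; nra. }
exists (vnorm x + K1 * exp 1 / y); split.
  have := vnorm_ge0 x; have : 0 <= K1 * exp 1 / y; last lra.
  by apply: Rdiv_le_0_compat => //; have := exp_pos 1; nra.
case=> [|n].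
  rewrite /= Rmult_1_r; have : 0 <= K1 * exp 1 / y; last lra.
  by apply: Rdiv_le_0_compat => //; have := exp_pos 1; nra.
have hn : 0 < INR (S n) by apply: lt_0_INR; lia.
have hR : 0 <= INR (S n) / s1 by apply: Rdiv_le_0_compat; lra.
have h := H _ hR (S n); have hf := fact_exp_le n.
have Ee : s1 * (INR (S n) / s1) = INR (S n) by field; lra.
rewrite Ee in h.
set m := INR (S n) in hn hR h hf Ee.
have h1 : vnorm (Nat.iter (S n) T x) * (m / s1) ^ S n <= K1 * (exp 1 * m ^ S (S n)).
{ apply: Rle_trans h _; have -> : INR (fact (S n)) * (K1 * exp m) = K1 * (INR (fact (S n)) * exp m) by ring.
  exact: Rmult_le_compat_l. }
have mp : 0 < m ^ S n by apply: pow_lt.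
have sp : 0 < s1 ^ S n by apply: pow_lt.
have h2 : vnorm (Nat.iter (S n) T x) <= K1 * exp 1 * m * s1 ^ S n.
{ apply: (Rmult_le_reg_r ((m / s1) ^ S n)); first by apply: pow_lt; apply: Rdiv_lt_0_compat.
  apply: Rle_trans h1 _; right; rewrite /Rdiv Rpow_mult_distr pow_inv -(tech_pow_Rmult m (S n)); field; lra. }
have hb : m * y <= (1 + y) ^ S n by have := poly (S n) y y0; rewrite -/m; lra.
have E : (1 + y) ^ S n * s1 ^ S n = s' ^ S n.
{ by rewrite -Rpow_mult_distr; congr (_ ^ _); rewrite /y; field; lra. }
apply: Rle_trans h2 _.
have h3 : m <= (1 + y) ^ S n / y.
{ apply: (Rmult_le_reg_r y) => //; rewrite /Rdiv Rmult_assoc Rinv_l; lra. }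
have e1 := exp_pos 1.
apply: (Rle_trans _ (K1 * exp 1 * ((1 + y) ^ S n / y) * s1 ^ S n)).
  by apply: Rmult_le_compat_r; [lra | apply: Rmult_le_compat_l => //; nra].
have -> : K1 * exp 1 * ((1 + y) ^ S n / y) * s1 ^ S n = K1 * exp 1 / y * s' ^ S n by rewrite -E; field; lra.
apply: Rmult_le_compat_r; first by apply: pow_le; lra.
by have := vnorm_ge0 x; lra.
Qed.

End PowerGrowth.

(** * Formal power series *)

Section FormalSeries.
Definition fps := nat -> R.
Implicit Types (f g h : fps).
Definition fps0 : fps := fun _ => 0.
Definition fps1 : fps := fun n => match n with O => 1 | _ => 0 end.
Definition fadd f g : fps := fun n => f n + g n.
Definition fopp f : fps := fun n => - f n.
Definition fsub f g : fps := fun n => f n - g n.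
Definition fmul f g : fps := fun n => rsum (fun i => f i * g (n - i)%nat) (S n).
Definition fder f : fps := fun n => INR (S n) * f (S n).

Lemma fmulC f g : fmul f g = fmul g f.
Proof.
apply: functional_extensionality => n; rewrite /fmul -rsum_rev; apply: rsum_ext => i hi.
have -> : (S n - 1 - i = n - i)%nat by lia.
by have -> : (n - (n - i) = i)%nat by [lia]; ring.
Qed.
Lemma fmulA f g h : fmul f (fmul g h) = fmul (fmul f g) h.
Proof.
apply: functional_extensionality => n; rewrite /fmul.
have := rsum_triangle (fun i j => f i * g j * h (n - i - j)%nat) (S n) => E.
transitivity (rsum (fun i => rsum (fun j => f i * g j * h (n - i - j)%nat) (S n - i)) (S n)).
  apply: rsum_ext => i hi; have -> : (S n - i = S (n - i))%nat by lia.
  by rewrite -rsum_scal; apply: rsum_ext => j _; ring.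
rewrite -E; apply: rsum_ext => k hk; rewrite Rmult_comm -rsum_scal; apply: rsum_ext => i hi.
by have -> : (n - i - (k - i) = n - k)%nat by [lia]; ring.
Qed.
Lemma fmul1 f : fmul fps1 f = f.
Proof.
apply: functional_extensionality => n; rewrite /fmul rsum_recl Nat.sub_0_r.
rewrite (rsum_ext _ (fun _ => 0)) ?rsum0 /=; [ring | by move=> i _ /=; ring].
Qed.
Lemma fmulDl f g h : fmul (fadd f g) h = fadd (fmul f h) (fmul g h).
Proof.
apply: functional_extensionality => n; rewrite /fmul /fadd -rsum_add.
by apply: rsum_ext => i _; ring.
Qed.
Lemma fps_ring_theory : ring_theory fps0 fps1 fadd fmul fsub fopp eq.
Proof.
split; intros; try (by apply: functional_extensionality => n; rewrite /fadd /fopp /fsub /fps0; ring).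
- exact: fmul1.
- exact: fmulC.
- exact: fmulA.
- exact: fmulDl.
Qed.
Add Ring fps_ring : fps_ring_theory.

Lemma fder_add f g : fder (fadd f g) = fadd (fder f) (fder g).
Proof. by apply: functional_extensionality => n; rewrite /fder /fadd; ring. Qed.
Lemma fder_sub f g : fder (fsub f g) = fsub (fder f) (fder g).
Proof. by apply: functional_extensionality => n; rewrite /fder /fsub; ring. Qed.
Lemma fder_mul f g : fder (fmul f g) = fadd (fmul (fder f) g) (fmul f (fder g)).
Proof.
apply: functional_extensionality => n; rewrite /fadd /fmul /fder.
have -> : rsum (fun i => INR (S i) * f (S i) * g (n - i)%nat) (S n) =
  rsum (fun i => INR i * (f i * g (S n - i)%nat)) (S (S n)).
{ rewrite [RHS]rsum_recl Rmult_0_l Rplus_0_l; apply: rsum_ext => i _ /=; ring. }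
have -> : rsum (fun i => f i * (INR (S (n - i)) * g (S (n - i)))) (S n) =
  rsum (fun i => (INR (S n) - INR i) * (f i * g (S n - i)%nat)) (S (S n)).
{ rewrite [RHS]rsumS Rminus_diag Rmult_0_l Rplus_0_r; apply: rsum_ext => i hi.
  rewrite -minus_INR; last lia.
  have -> : (S n - i = S (n - i))%nat by lia.
  ring. }
rewrite -rsum_add -rsum_scal; apply: rsum_ext => i _; ring.
Qed.
Lemma fder_eq0 f : fder f = fps0 -> f O = 0 -> f = fps0.
Proof.
move=> H h0; apply: functional_extensionality; case=> [|n] //.
have := f_equal (fun q => q n) H; rewrite /fder /fps0 => E.
by case: (Rmult_integral _ _ E) => // E'; have := not_0_INR (S n) ltac:(lia).
Qed.
(** Each coefficient of [f] is determined by the earlier ones, all of which vanish. *)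
Lemma fder_linear_eq0 f g : fder f = fmul g f -> f O = 0 -> f = fps0.
Proof.
move=> H h0; have K : forall n m, (m <= n)%nat -> f m = 0.
{ elim=> [|n IH] m hm; first by have -> : m = O by lia.
  case: (Nat.eq_dec m (S n)) => [->|hne]; last by apply: IH; lia.
  have := f_equal (fun q => q n) H; rewrite /fder /fmul.
  rewrite (rsum_ext _ (fun _ => 0)) ?rsum0; last by move=> i hi; rewrite IH; [ring | lia].
  by move=> E; case: (Rmult_integral _ _ E) => // E'; have := not_0_INR (S n) ltac:(lia). }
by apply: functional_extensionality => n; exact: (K n n).
Qed.

(** Submultiplicativity of a weighted l^1-norm, through the triangular rearrangement. *)
Lemma bsum_fmul f g q F G : 0 <= q -> bsum (fun n => Rabs (f n) * q ^ n) F ->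
  bsum (fun n => Rabs (g n) * q ^ n) G -> bsum (fun n => Rabs (fmul f g n) * q ^ n) (F * G).
Proof.
move=> hq hF hG n.
pose H i j := (Rabs (f i) * q ^ i) * (Rabs (g j) * q ^ j).
have H0 i j : 0 <= H i j.
{ by repeat apply: Rmult_le_pos; try apply: Rabs_pos; apply: pow_le. }
apply: (Rle_trans _ (rsum (fun k => rsum (fun i => H i (k - i)%nat) (S k)) n)).
  apply: rsum_le => k _; rewrite /fmul.
  have tri m : (m <= S k)%nat -> Rabs (rsum (fun i => f i * g (k - i)%nat) m) * q ^ k <= rsum (fun i => H i (k - i)%nat) m.
  { elim: m => [|m IH] hm; first by rewrite /= Rabs_R0; lra.
    rewrite !rsumS; apply: Rle_trans (Rmult_le_compat_r _ _ _ (pow_le _ _ hq) (Rabs_triang _ _)) _.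
    rewrite Rmult_plus_distr_r; apply: Rplus_le_compat; first by apply: IH; lia.
    rewrite /H Rabs_mult; right.
    have -> : q ^ k = q ^ m * q ^ (k - m) by rewrite -pow_add; congr (_ ^ _); lia.
    ring. }
  exact: tri.
rewrite rsum_triangle.
apply: (Rle_trans _ (rsum (fun i => (Rabs (f i) * q ^ i) * G) n)).
  apply: rsum_le => i _; rewrite /H rsum_scal; apply: Rmult_le_compat_l => //.
  by apply: Rmult_le_pos; [apply: Rabs_pos | apply: pow_le].
rewrite (rsum_ext _ (fun i => G * (Rabs (f i) * q ^ i))); last by move=> i _; ring.
by rewrite rsum_scal Rmult_comm; apply: Rmult_le_compat_r => //; exact: bsum_ge0 hG.
Qed.

(* Course-of-values recursion for t' = 1 + t^2. *)
Fixpoint tan_table (n : nat) : fps :=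
  match n with
  | O => fps0
  | S m => fun k => if Nat.leb k m then tan_table m k
                    else (fps1 m + fmul (tan_table m) (tan_table m) m) / INR (S m)
  end.
Definition tanq : fps := fun n => tan_table n n.
Definition cosq : fps := fun n => Cre (Cpow Ci n) / INR (fact n).
Definition sinq : fps := fun n => Cim (Cpow Ci n) / INR (fact n).

Lemma tan_table_stable n k : (k <= n)%nat -> tan_table n k = tanq k.
Proof.
elim: n => [|n IH] hk; first by have -> : k = O by lia.
case: (Nat.eq_dec k (S n)) => [->|hne] //=.
by have -> : Nat.leb k n = true by [apply/Nat.leb_le; lia]; apply: IH; lia.
Qed.
Lemma fder_tanq : fder tanq = fadd fps1 (fmul tanq tanq).
Proof.
apply: functional_extensionality => n; rewrite /fder /fadd.
have h : INR (S n) <> 0 by apply: not_0_INR.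
have -> : tanq (S n) = (fps1 n + fmul (tan_table n) (tan_table n) n) / INR (S n).
{ rewrite /tanq -[LHS]/(if Nat.leb (S n) n then tan_table n (S n)
    else (fps1 n + fmul (tan_table n) (tan_table n) n) / INR (S n)).
  by have -> : Nat.leb (S n) n = false by apply/Nat.leb_gt; lia. }
have -> : fmul (tan_table n) (tan_table n) n = fmul tanq tanq n.
{ by apply: rsum_ext => i hi; rewrite !tan_table_stable //; lia. }
by field.
Qed.
Lemma tanq_ge0 n : 0 <= tanq n.
Proof.
have K : forall n m, (m <= n)%nat -> 0 <= tanq m.
{ elim=> [|k IH] m hm; first by have -> : m = O by [lia]; rewrite /tanq /= /fps0; lra.
  case: (Nat.eq_dec m (S k)) => [->|hne]; last by apply: IH; lia.
  have := f_equal (fun q => q k) fder_tanq; rewrite /fder /fadd => E.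
  have hk : 0 < INR (S k) by apply: lt_0_INR; lia.
  have : 0 <= fps1 k + fmul tanq tanq k.
  { apply: Rplus_le_le_0_compat; first by case: (k) => [|j]; rewrite /fps1; lra.
    by apply: rsum_ge0 => i hi; apply: Rmult_le_pos; apply: IH; lia. }
  rewrite -E => h; apply: (Rmult_le_reg_l (INR (S k))) => //; lra. }
exact: (K n n).
Qed.
Lemma fder_cosq : fder cosq = fopp sinq.
Proof.
apply: functional_extensionality => n; rewrite /fder /fopp /cosq /sinq fact_simpl mult_INR.
have h : INR (S n) <> 0 by apply: not_0_INR.
have h2 := INR_fact_neq_0 n.
rewrite -[Cpow Ci (S n)]/(Cmul Ci (Cpow Ci n)) [Cre _]/=; field; done.
Qed.
Lemma fder_sinq : fder sinq = cosq.
Proof.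
apply: functional_extensionality => n; rewrite /fder /cosq /sinq fact_simpl mult_INR.
have h : INR (S n) <> 0 by apply: not_0_INR.
have h2 := INR_fact_neq_0 n.
rewrite -[Cpow Ci (S n)]/(Cmul Ci (Cpow Ci n)) [Cim _]/=; field; done.
Qed.
Lemma cosq_sinq : fadd (fmul cosq cosq) (fmul sinq sinq) = fps1.
Proof.
have H : fsub (fadd (fmul cosq cosq) (fmul sinq sinq)) fps1 = fps0.
{ apply: fder_eq0; last by rewrite /fsub /fadd /fmul /cosq /sinq /=; field.
  have E1 : fder fps1 = fps0.
  { by apply: functional_extensionality => n; rewrite /fder /fps1 /fps0; ring. }
  rewrite fder_sub fder_add !fder_mul fder_cosq fder_sinq E1; ring. }
have -> : fadd (fmul cosq cosq) (fmul sinq sinq) =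
  fadd (fsub (fadd (fmul cosq cosq) (fmul sinq sinq)) fps1) fps1 by ring.
by rewrite H; ring.
Qed.
(** The series [f = cos tan - sin] satisfies [f' = tan f] and has no constant term. *)
Lemma cosq_tanq : fmul cosq tanq = sinq.
Proof.
have H : fsub (fmul cosq tanq) sinq = fps0.
{ apply: (fder_linear_eq0 _ tanq); last by rewrite /fsub /fmul /tanq /sinq /= /fps0; field.
  rewrite fder_sub fder_mul fder_cosq fder_sinq fder_tanq; ring. }
have -> : fmul cosq tanq = fadd (fsub (fmul cosq tanq) sinq) sinq by ring.
by rewrite H; ring.
Qed.
Definition sec2q := fder tanq.
(** As an identity of coefficients it carries over to any operator on an orbit where the series
    converge absolutely. *)
Lemma cosq_sec2q : fmul cosq (fmul cosq sec2q) = fps1.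
Proof.
rewrite /sec2q fder_tanq.
have -> : fmul cosq (fmul cosq (fadd fps1 (fmul tanq tanq))) =
  fadd (fmul cosq cosq) (fmul (fmul cosq tanq) (fmul cosq tanq)) by ring.
by rewrite cosq_tanq cosq_sinq.
Qed.

(* The partial sums P of the series of tan satisfy P' <= 1 + P^2, so atan o P has derivative
   at most 1. *)
Lemma tanq_le q N : 0 <= q < PI / 2 -> rsum (fun n => tanq n * q ^ n) N <= tan q.
Proof.
move=> hq; pose P M y := rsum (fun n => tanq n * y ^ n) M.
pose Q M y := rsum (fun n => sec2q n * y ^ n) M.
have P0 M y : 0 <= y -> 0 <= P M y.
{ by move=> hy; apply: rsum_ge0 => i _; apply: Rmult_le_pos; [exact: tanq_ge0 | exact: pow_le]. }
have dP M y : is_derive (P (S M)) y (Q M y).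
{ elim: M => [|M IH].
    by rewrite /P /Q /=; auto_derive => //; ring.
  have E : P (S (S M)) = fun y => P (S M) y + tanq (S M) * y ^ S M by [].
  rewrite E /Q rsumS -/(Q M y); apply: (is_derive_plus (P (S M))) => //.
  rewrite /sec2q /fder.
  by auto_derive => //; rewrite -[match M with O => 1 | S _ => INR M + 1 end]/(INR (S M)) /=; ring. }
(* [Q M] truncates the series of [1 + tan^2], and the square of [P M] contains at least the same
   terms, all nonnegative. *)
have Q_le M y : 0 <= y -> Q M y <= 1 + P M y ^ 2.
{ move=> hy; rewrite /Q /sec2q fder_tanq /fadd.
  rewrite (rsum_ext _ (fun n => fps1 n * y ^ n + fmul tanq tanq n * y ^ n)); last by move=> i _; ring.
  rewrite rsum_add; apply: Rplus_le_compat.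
    case: M => [|M]; first by rewrite /=; lra.
    rewrite rsum_recl (rsum_ext _ (fun _ => 0)) ?rsum0 /=; [lra | by move=> i _ /=; ring].
  pose H i j := (tanq i * y ^ i) * (tanq j * y ^ j).
  have H0 i j : 0 <= H i j.
  { by repeat apply: Rmult_le_pos; try apply: tanq_ge0; apply: pow_le. }
  have -> : rsum (fun n => fmul tanq tanq n * y ^ n) M = rsum (fun k => rsum (fun i => H i (k - i)%nat) (S k)) M.
  { apply: rsum_ext => k _; rewrite /fmul Rmult_comm -rsum_scal; apply: rsum_ext => i hi; rewrite /H.
    have -> : y ^ k = y ^ i * y ^ (k - i) by rewrite -pow_add; congr (_ ^ _); lia.
    ring. }
  rewrite rsum_triangle.
  apply: (Rle_trans _ (rsum (fun i => rsum (H i) M) M)).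
    by apply: rsum_le => i _; apply: rsum_mono => //; lia.
  right; rewrite (rsum_ext _ (fun i => P M y * (tanq i * y ^ i))).
    by rewrite rsum_scal /= Rmult_1_r.
  by move=> i _; rewrite /H rsum_scal Rmult_comm. }
have PS M y : 0 <= y -> P M y <= P (S M) y.
{ by move=> hy; rewrite /P rsumS; have := Rmult_le_pos _ _ (tanq_ge0 M) (pow_le y M hy); lra. }
case: N => [|M].
  rewrite /=; case: (Req_dec q 0) => [->|h]; first by rewrite tan_0; lra.
  by apply: Rlt_le; apply: tan_gt_0; lra.
rewrite -/(P (S M) q).
have hd y : is_derive (fun y => y - atan (P (S M) y)) y (1 - Q M y / (1 + P (S M) y ^ 2)).
{ apply: (is_derive_minus (fun y => y)); first exact: is_derive_id.
  have := is_derive_comp atan (P (S M)) y _ _ (is_derive_atan (P (S M) y)) (dP M y).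
  by rewrite /scal /= /mult /= /Rdiv Rmult_1_r. }
have h : atan (P (S M) q) <= q.
{ case: (Req_dec q 0) => [E|h].
    have -> : P (S M) q = 0.
    { rewrite /P rsum_recl E (rsum_ext _ (fun _ => 0)) ?rsum0 /=; first by rewrite /tanq /= /fps0; ring.
      by move=> i _ /=; ring. }
    by rewrite atan_0; lra.
  have [c [hc E]] := MVT_gen (fun y => y - atan (P (S M) y)) 0 q (fun y => 1 - Q M y / (1 + P (S M) y ^ 2))
    (fun y _ => hd y)
    (fun y _ => ltac:(apply: derivable_continuous_pt; eexists; apply/is_derive_Reals; exact: hd)).
  rewrite Rmin_left ?Rmax_right in hc; try lra.
  have P00 : P (S M) 0 = 0.
  { rewrite /P rsum_recl (rsum_ext _ (fun _ => 0)) ?rsum0 /=; first by rewrite /tanq /= /fps0; ring.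
    by move=> i _ /=; ring. }
  rewrite P00 atan_0 in E.
  have h1 : Q M c / (1 + P (S M) c ^ 2) <= 1.
  { have h2 := Q_le M c ltac:(lra); have h3 := PS M c ltac:(lra); have h4 := P0 M c ltac:(lra).
    apply: (Rmult_le_reg_r (1 + P (S M) c ^ 2)); first by nra.
    rewrite /Rdiv Rmult_assoc Rinv_l; nra. }
  nra. }
have hb := atan_bound (P (S M) q).
rewrite -(tan_atan (P (S M) q)); case: h => [h|->]; last lra.
by apply: Rlt_le; apply: tan_increasing; lra.
Qed.

Lemma sec2q_le q N : 0 <= q < PI / 2 -> rsum (fun n => sec2q n * q ^ n) N <= 1 + tan q * tan q.
Proof.
move=> hq; have tn : bsum (fun n => Rabs (tanq n) * q ^ n) (tan q).
{ move=> M; apply: Rle_trans (tanq_le q M hq); right; apply: rsum_ext => i _.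
  by rewrite Rabs_right //; apply: Rle_ge; apply: tanq_ge0. }
have h := bsum_fmul tanq tanq q _ _ (proj1 hq) tn tn.
apply: (Rle_trans _ (rsum (fun n => fps1 n * q ^ n + Rabs (fmul tanq tanq n) * q ^ n) N)).
  apply: rsum_le => i _; rewrite /sec2q fder_tanq /fadd Rmult_plus_distr_r.
  apply: Rplus_le_compat_l; apply: Rmult_le_compat_r; [apply: pow_le; lra | exact: Rle_abs].
rewrite rsum_add; apply: Rplus_le_compat (h N).
case: N => [|M]; first by rewrite /=; lra.
rewrite rsum_recl (rsum_ext _ (fun _ => 0)) ?rsum0 /=; [lra | by move=> i _ /=; ring].
Qed.
Lemma sec2q_ge0 n : 0 <= sec2q n.
Proof. by apply: Rmult_le_pos; [exact: pos_INR | exact: tanq_ge0]. Qed.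
Lemma cosq_bsum q : 0 <= q -> bsum (fun n => Rabs (cosq n) * q ^ n) (exp q).
Proof.
move=> hq; apply: bsum_le (bsum_exp q hq) => n; rewrite /cosq /Rdiv Rabs_mult.
have hf := Rinv_0_lt_compat _ (fact_pos n).
rewrite (Rabs_right (/ _)); last lra.
have : Rabs (Cre (Cpow Ci n)) <= 1.
{ by apply: Rle_trans (Cre_le _) _; rewrite CnormX Cnorm_Ci pow1; lra. }
have := pow_le q n hq; have := Rabs_pos (Cre (Cpow Ci n)) => h1 h2 h3.
rewrite (Rmult_comm (q ^ n)); apply: Rmult_le_compat_r => //; nra.
Qed.

End FormalSeries.

(** * Power series applied to a single orbit *)

Section SeriesCalculus.
Context {X : CBanach}.
Implicit Types (x y z : X) (A B : X -> X).
Add Ring sz_ring : (@sz_ring_theory X).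
Ltac vring := apply: sz_vec_inj; rewrite ?szE; ring.

(** Convergence is judged on the orbit of [y], so [f(B) y] may exist beyond what the norm of [B]
    allows. *)
Definition fser f B y : X := vtot (fun n => vscal (Cof (f n)) (Nat.iter n B y)).

Lemma fser_term f B y K q n : (forall n, vnorm (Nat.iter n B y) <= K * q ^ n) ->
  vnorm (vscal (Cof (f n)) (Nat.iter n B y)) <= K * (Rabs (f n) * q ^ n).
Proof.
move=> H; rewrite vnorm_scal Cnorm_Cof; have := H n; have := Rabs_pos (f n); nra.
Qed.
Lemma fser_absum f B y K q F : (forall n, vnorm (Nat.iter n B y) <= K * q ^ n) ->
  bsum (fun n => Rabs (f n) * q ^ n) F -> absum (fun n => vscal (Cof (f n)) (Nat.iter n B y)).
Proof.
move=> H hF; have K0 : 0 <= K by have := H O; have := vnorm_ge0 y => /=; lra.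
exact: absum_le (fun n => fser_term f B y K q n H) (bsum_scal K _ _ K0 hF).
Qed.
Lemma fser_iter_bound f B y K q F : is_bounded_op B -> 0 <= q ->
  (forall n, vnorm (Nat.iter n B y) <= K * q ^ n) ->
  bsum (fun n => Rabs (f n) * q ^ n) F ->
  forall m, vnorm (Nat.iter m B (fser f B y)) <= K * F * q ^ m.
Proof.
move=> hB hq H hF m; have K0 : 0 <= K by have := H O; have := vnorm_ge0 y => /=; lra.
rewrite /fser -(vtot_bop _ _ (bop_iter B m hB) (fser_absum f B y K q F H hF)).
apply: vtot_norm.
have -> : K * F * q ^ m = (K * q ^ m) * F by ring.
have Kq : 0 <= K * q ^ m by apply: Rmult_le_pos => //; apply: pow_le.
apply: bsum_le (bsum_scal _ _ _ Kq hF) => n.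
rewrite (bop_scal _ (bop_iter B m hB)) vnorm_scal Cnorm_Cof -Nat.iter_add.
have := H (m + n)%nat; rewrite pow_add; have := Rabs_pos (f n); nra.
Qed.
Lemma fser_mul f g B y K q F G : is_bounded_op B -> 0 <= q ->
  (forall n, vnorm (Nat.iter n B y) <= K * q ^ n) ->
  bsum (fun n => Rabs (f n) * q ^ n) F -> bsum (fun n => Rabs (g n) * q ^ n) G ->
  fser f B (fser g B y) = fser (fmul f g) B y.
Proof.
move=> hB hq H hF hG; have K0 : 0 <= K by have := H O; have := vnorm_ge0 y => /=; lra.
pose W i j := vscal (Cof (f i)) (Nat.iter i B (vscal (Cof (g j)) (Nat.iter j B y))).
have EW i : vtot (W i) = vscal (Cof (f i)) (Nat.iter i B (fser g B y)).
{ have hop : is_bounded_op (opZ (Cof (f i)) (Nat.iter i B)) by apply: bop_opZ; apply: bop_iter.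
  exact: (vtot_bop _ _ hop (fser_absum g B y K q G H hG)). }
symmetry; apply: vtot_unique.
have -> : fser f B (fser g B y) = vtot (fun i => vtot (W i)).
{ by congr vtot; apply: functional_extensionality => i; rewrite EW. }
have -> : (fun n => vscal (Cof (fmul f g n)) (Nat.iter n B y)) = fun k => vsum (fun i => W i (k - i)%nat) (S k).
{ apply: functional_extensionality => k.
  transitivity (vsum (fun i => vscal (Cof (f i * g (k - i)%nat)) (Nat.iter k B y)) (S k)).
    rewrite vsum_scalr; congr vscal; rewrite /fmul; elim: (S k) => [|m IH] //.
    by rewrite rsumS CofD IH.
  apply: vsum_ext => i hi; rewrite /W (bop_scal _ (bop_iter B i hB)) -Nat.iter_add CofM vscal_assoc.
  by congr (vscal _ (Nat.iter _ _ _)); lia. }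
apply: (vtot_fubini W (fun i => Rabs (f i) * q ^ i) (fun j => K * (Rabs (g j) * q ^ j)) F (K * G)) => //.
- by move=> n; apply: Rmult_le_pos; [exact: Rabs_pos | exact: pow_le].
- by move=> n; repeat apply: Rmult_le_pos => //; [exact: Rabs_pos | exact: pow_le].
- exact: bsum_scal.
move=> i j; rewrite /W (bop_scal _ (bop_iter B i hB)) !vnorm_scal !Cnorm_Cof -Nat.iter_add.
have := H (i + j)%nat; rewrite pow_add => h.
have h1 := Rabs_pos (f i); have h2 := Rabs_pos (g j).
have -> : Rabs (f i) * q ^ i * (K * (Rabs (g j) * q ^ j)) = Rabs (f i) * (Rabs (g j) * (K * (q ^ i * q ^ j))) by ring.
by apply: Rmult_le_compat_l => //; apply: Rmult_le_compat_l.
Qed.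

Definition opcos B y := vscal (Cof (/ 2)) (vadd (Exp (opZ Ci B) y) (Exp (opZ (Copp Ci) B) y)).

Lemma opcos_fser B y : is_bounded_op B -> opcos B y = fser cosq B y.
Proof.
move=> hB; have h1 : is_bounded_op (opZ Ci B) by apply: bop_opZ.
have h2 : is_bounded_op (opZ (Copp Ci) B) by apply: bop_opZ.
rewrite /opcos /Exp -vtot_add; try exact: Exp_absum.
rewrite -vtot_scal; last by apply: absum_add; exact: Exp_absum.
congr vtot; apply: functional_extensionality => n.
rewrite /expt !iter_opZ // -!vscal_distr_v !vscal_assoc -vscal_distr_c vscal_assoc.
congr vscal; have hc : Cre (Cpow (Copp Ci) n) = Cre (Cpow Ci n) /\ Cim (Cpow (Copp Ci) n) = - Cim (Cpow Ci n).
{ elim: n => [|n [I1 I2]]; first by rewrite /=; split; ring.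
  rewrite -[Cpow (Copp Ci) (S n)]/(Cmul (Copp Ci) (Cpow (Copp Ci) n)) -[Cpow Ci (S n)]/(Cmul Ci (Cpow Ci n)).
  by rewrite [Cre _]/= [Cim (Cmul _ _)]/= I1 I2 /=; split; ring. }
have hf := INR_fact_neq_0 n.
by case: hc => I1 I2; ceq; rewrite I1 I2 /cosq /=; field.
Qed.

(** The witness is [sec^2(B) y]. Its orbit has the same rate as that of [y], which permits a second
    application. *)
Lemma opcos_square_inverse B y K q : is_bounded_op B -> 0 <= q < PI / 2 ->
  (forall n, vnorm (Nat.iter n B y) <= K * q ^ n) ->
  exists z, opcos B (opcos B z) = y /\
    forall n, vnorm (Nat.iter n B z) <= K * (1 + tan q * tan q) * q ^ n.
Proof.
move=> hB hq H.
have hs : bsum (fun n => Rabs (sec2q n) * q ^ n) (1 + tan q * tan q).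
{ move=> N; apply: Rle_trans (sec2q_le q N hq); right; apply: rsum_ext => i _.
  by rewrite Rabs_right //; apply: Rle_ge; apply: sec2q_ge0. }
have hc := cosq_bsum q (proj1 hq).
exists (fser sec2q B y); split; last exact: fser_iter_bound (proj1 hq) H hs.
have hcs := bsum_fmul cosq sec2q q _ _ (proj1 hq) hc hs.
rewrite !opcos_fser // (fser_mul cosq sec2q B y K q _ _ hB (proj1 hq) H hc hs).
rewrite (fser_mul cosq (fmul cosq sec2q) B y K q _ _ hB (proj1 hq) H hc hcs) cosq_sec2q.
rewrite /fser (vtot_finite _ 1); first by rewrite /= -/C1; vring.
by case=> [|n] hn; [lia | rewrite /= -/C0; vring].
Qed.

End SeriesCalculus.

(** * Random walk and Wallis integrals *)

Section Walk.
(* Nat.iter n rw F j is the mean of F at the n-th step of the simple random walk from j. *)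
Definition rw (F : Z -> R) : Z -> R := fun j => (F (j + 1)%Z + F (j - 1)%Z) / 2.
Implicit Types (F G : Z -> R) (i j k : Z) (n d : nat).

Lemma rwS n F j :
  Nat.iter (S n) rw F j = (Nat.iter n rw F (j + 1)%Z + Nat.iter n rw F (j - 1)%Z) / 2.
Proof. by []. Qed.
(** Only positions that the walk can reach at time [n] matter. At odd times, starting from 0, this
    excludes the even positions, in particular 0, where the divisions by the position used below
    have no meaning. *)
Lemma rw_le n F G j0 :
  (forall j, (Z.abs (j - j0) <= Z.of_nat n)%Z -> Z.odd (j - j0) = Nat.odd n -> F j <= G j) ->
  Nat.iter n rw F j0 <= Nat.iter n rw G j0.
Proof.
elim: n j0 => [|n IH] j0 H.
  by apply: H; rewrite ?Z.sub_diag.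
have step e : (e = 1 \/ e = -1)%Z -> Nat.iter n rw F (j0 + e)%Z <= Nat.iter n rw G (j0 + e)%Z.
{ move=> he; apply: IH => j h1 h2; apply: H; first lia.
  have -> : (j - j0 = (j - (j0 + e)) + e)%Z by lia.
  rewrite Z.odd_add h2 Nat.odd_succ -Nat.negb_odd.
  by case: he => -> /=; rewrite ?Bool.xorb_true_r. }
have h1 := step 1%Z (or_introl eq_refl); have h2 := step (-1)%Z (or_intror eq_refl).
have E : (j0 + -1 = j0 - 1)%Z by lia.
by rewrite E in h2; rewrite !rwS; lra.
Qed.
Lemma rw_ext n F G j0 :
  (forall j, (Z.abs (j - j0) <= Z.of_nat n)%Z -> Z.odd (j - j0) = Nat.odd n -> F j = G j) ->
  Nat.iter n rw F j0 = Nat.iter n rw G j0.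
Proof. by move=> H; apply: Rle_antisym; apply: rw_le => j h1 h2; have := H j h1 h2; lra. Qed.
Lemma rw_add n F G j0 :
  Nat.iter n rw (fun j => F j + G j) j0 = Nat.iter n rw F j0 + Nat.iter n rw G j0.
Proof. elim: n j0 => [|n IH] j0 //; rewrite !rwS !IH; field. Qed.
Lemma rw_scal n c F j0 : Nat.iter n rw (fun j => c * F j) j0 = c * Nat.iter n rw F j0.
Proof. elim: n j0 => [|n IH] j0 //; rewrite !rwS !IH; field. Qed.
Lemma rw_const n c j0 : Nat.iter n rw (fun _ => c) j0 = c.
Proof. elim: n j0 => [|n IH] j0 //; rewrite !rwS !IH; field. Qed.
Lemma rw_rsum n (F : nat -> Z -> R) K j0 :
  Nat.iter n rw (fun j => rsum (fun m => F m j) K) j0 = rsum (fun m => Nat.iter n rw (F m) j0) K.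
Proof. by elim: K => [|K IH] /=; [exact: rw_const | rewrite rw_add IH]. Qed.
Lemma rw_opp n F j0 : Nat.iter n rw (fun j => F (- j)%Z) j0 = Nat.iter n rw F (- j0)%Z.
Proof.
elim: n j0 => [|n IH] j0 //; rewrite !rwS !IH.
have -> : (- (j0 + 1) = - j0 - 1)%Z by lia.
have -> : (- (j0 - 1) = - j0 + 1)%Z by lia.
field.
Qed.
Lemma rw_derive n (F G : R -> Z -> R) y j0 :
  (forall j, is_derive (fun y => F y j) y (G y j)) ->
  is_derive (fun y => Nat.iter n rw (F y) j0) y (Nat.iter n rw (G y) j0).
Proof.
move=> H; elim: n j0 => [|n IH] j0 //=.
have := is_derive_scal _ y (/ 2) _ (is_derive_plus _ _ y _ _ (IH (j0 + 1)%Z) (IH (j0 - 1)%Z)).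
rewrite /plus /= /rw /Rdiv (Rmult_comm _ (/ 2)) => h.
by apply: is_derive_ext h => t /=; field.
Qed.
Lemma rw_variance n j0 : Nat.iter n rw (fun j => IZR (j - j0) * IZR (j - j0)) j0 = INR n.
Proof.
have H m j : Nat.iter m rw (fun j => IZR (j - j0) * IZR (j - j0)) j = IZR (j - j0) * IZR (j - j0) + INR m.
{ elim: m j => [|m IH] j; first by rewrite /=; ring.
  rewrite S_INR rwS !IH.
  have -> : IZR (j + 1 - j0) = IZR (j - j0) + 1 by rewrite -plus_IZR; congr IZR; lia.
  have -> : IZR (j - 1 - j0) = IZR (j - j0) - 1 by rewrite -minus_IZR; congr IZR; lia.
  field. }
rewrite H Z.sub_diag; ring.
Qed.
(** Cauchy-Schwarz against the variance, in the form [|j| <= s / 2 + j^2 / (2 s)] with [s] the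
    standard deviation. *)
Lemma rw_abs n j0 : Nat.iter n rw (fun j => Rabs (IZR (j - j0))) j0 <= sqrt (INR n).
Proof.
case: n => [|n]; first by rewrite /= Z.sub_diag Rabs_R0 sqrt_0; lra.
set s := sqrt _; have s0 : 0 < s by apply: sqrt_lt_R0; apply: lt_0_INR; lia.
have ss : s * s = INR (S n) by apply: sqrt_sqrt; apply: pos_INR.
apply: (Rle_trans _ (Nat.iter (S n) rw (fun j => s / 2 + / (2 * s) * (IZR (j - j0) * IZR (j - j0))) j0)).
  apply: rw_le => j _ _; apply: (Rmult_le_reg_r (2 * s)); first lra.
  have -> : (s / 2 + / (2 * s) * (IZR (j - j0) * IZR (j - j0))) * (2 * s) = s * s + IZR (j - j0) * IZR (j - j0) by field; lra.
  have := Rabs_pos (IZR (j - j0)).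
  have -> : IZR (j - j0) * IZR (j - j0) = Rabs (IZR (j - j0)) * Rabs (IZR (j - j0)).
  { by rewrite -Rabs_mult Rabs_right //; nra. }
  have := pow2_ge_0 (s - Rabs (IZR (j - j0))); nra.
rewrite rw_add rw_const rw_scal rw_variance -ss; right; field; lra.
Qed.
Lemma rw_cos n y j0 : Nat.iter n rw (fun j => cos (IZR j * y)) j0 = cos y ^ n * cos (IZR j0 * y).
Proof.
elim: n j0 => [|n IH] j0; first by rewrite /=; ring.
rewrite rwS !IH -tech_pow_Rmult.
have -> : IZR (j0 + 1) * y = IZR j0 * y + y by rewrite plus_IZR; ring.
have -> : IZR (j0 - 1) * y = IZR j0 * y - y by rewrite minus_IZR; ring.
by rewrite cos_plus cos_minus; field.
Qed.

Lemma cos_odd_PI2 j : Z.odd j = true -> cos (IZR j * (PI / 2)) = 0.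
Proof.
move=> /Z.odd_spec [k ->]; apply: cos_eq_0_1; exists k.
by rewrite plus_IZR mult_IZR; field.
Qed.
Lemma sin_even_PI2 j : Z.odd j = false -> sin (IZR j * (PI / 2)) = 0.
Proof.
move=> h; have /Z.even_spec [k ->] : Z.even j = true by rewrite -Z.negb_odd h.
by apply: sin_eq_0_1; exists k; rewrite mult_IZR; field.
Qed.

Definition wallis d := RInt (fun y => cos y ^ d) 0 (PI / 2).
Definition wallis_cos d j := RInt (fun y => cos y ^ d * cos (IZR j * y)) 0 (PI / 2).

Lemma continuous_cospow d j y : continuous (fun y => cos y ^ d * cos (IZR j * y)) y.
Proof.
apply: (ex_derive_continuous (fun y => cos y ^ d * cos (IZR j * y))).
by auto_derive.
Qed.
Lemma ex_wallis_cos d j : ex_RInt (fun y => cos y ^ d * cos (IZR j * y)) 0 (PI / 2).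
Proof. by apply: (ex_RInt_continuous (V := R_CompleteNormedModule)) => y _; apply: continuous_cospow. Qed.
Lemma wallisE d : wallis d = wallis_cos d 0.
Proof. by apply: RInt_ext => y _; rewrite Rmult_0_l cos_0 Rmult_1_r. Qed.
Lemma wallis_cos_rec d j : wallis_cos (S d) j = (wallis_cos d (j - 1)%Z + wallis_cos d (j + 1)%Z) / 2.
Proof.
have h := ex_wallis_cos d (j - 1)%Z; have h' := ex_wallis_cos d (j + 1)%Z.
have E := RInt_plus _ _ _ _ h h'; have hp := ex_RInt_plus _ _ _ _ h h'.
have E2 := RInt_scal _ _ _ (/ 2) hp.
transitivity (scal (/ 2) (plus (wallis_cos d (j - 1)) (wallis_cos d (j + 1)))); last first.
  by rewrite /scal /plus /= /mult /=; field.
rewrite /wallis_cos -E -E2.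
apply: RInt_ext => y _; rewrite /scal /plus /= /mult /=.
have -> : IZR (j + 1) * y = IZR j * y + y by rewrite plus_IZR; ring.
have -> : IZR (j - 1) * y = IZR j * y - y by rewrite minus_IZR; ring.
by rewrite cos_plus cos_minus; field.
Qed.
Lemma wallis_cos_0 j : Z.odd j = false -> wallis_cos 0 j = if Z.eqb j 0 then PI / 2 else 0.
Proof.
move=> hj; rewrite /wallis_cos; case: (Z.eqb_spec j 0) => [->|hne].
  rewrite (RInt_ext _ (fun _ => 1)); first by rewrite RInt_const /scal /= /mult /=; ring.
  by move=> y _; rewrite Rmult_0_l cos_0 /=; ring.
have hj0 : IZR j <> 0 by apply: not_0_IZR.
have h : is_RInt (fun y => cos y ^ 0 * cos (IZR j * y)) 0 (PI / 2)
  (minus (sin (IZR j * (PI / 2)) / IZR j) (sin (IZR j * 0) / IZR j)).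
{ apply: (is_RInt_derive (fun y => sin (IZR j * y) / IZR j)).
    by move=> y _; auto_derive => //; rewrite /=; field.
  by move=> y _; apply: (continuous_cospow 0 j). }
rewrite (is_RInt_unique _ _ _ _ h) sin_even_PI2 // Rmult_0_r sin_0 /minus /plus /opp /=; field; done.
Qed.
(** Fourier inversion: [cos^d] is the characteristic function of the walk, and for positions of the
    right parity symmetry reduces the integral to [0, PI/2]. The proof checks that both sides obey
    the same recursion in [d]. *)
Lemma rw_indicator d k j0 : Z.odd (k - j0) = Nat.odd d ->
  Nat.iter d rw (fun j => if Z.eqb j k then 1 else 0) j0 = 2 / PI * wallis_cos d (k - j0)%Z.
Proof.
have PI0 := PI_RGT_0.
elim: d j0 => [|d IH] j0 h.
  rewrite wallis_cos_0 //=; case: (Z.eqb_spec j0 k) => h1; case: (Z.eqb_spec (k - j0) 0) => h2; try lia.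
    by field; lra.
  by field; lra.
have par e : (e = 1 \/ e = -1)%Z -> Z.odd (k - (j0 + e)) = Nat.odd d.
{ move=> he; have -> : (k - (j0 + e) = (k - j0) + - e)%Z by lia.
  rewrite Z.odd_add h Nat.odd_succ -Nat.negb_odd.
  by case: he => -> /=; rewrite Bool.xorb_true_r Bool.negb_involutive. }
rewrite wallis_cos_rec rwS.
have -> : (j0 - 1 = j0 + -1)%Z by lia.
rewrite (IH _ (par 1%Z (or_introl eq_refl))) (IH _ (par (-1)%Z (or_intror eq_refl))).
have -> : (k - (j0 + 1) = k - j0 - 1)%Z by lia.
have -> : (k - (j0 + -1) = k - j0 + 1)%Z by lia.
by field; lra.
Qed.
Lemma cospow_ge0 d y : 0 <= y <= PI / 2 -> 0 <= cos y ^ d.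
Proof. by move=> hy; apply: pow_le; apply: cos_ge_0; have := PI_RGT_0; lra. Qed.
Lemma wallis_cos_le d j : wallis_cos d j <= wallis d.
Proof.
have PI0 := PI_RGT_0; rewrite wallisE; apply: RInt_le; try exact: ex_wallis_cos; first lra.
move=> y hy; rewrite Rmult_0_l cos_0; apply: Rmult_le_compat_l; first by apply: cospow_ge0; lra.
by case: (COS_bound (IZR j * y)).
Qed.
(** Inserting [sin y <= 1] under the integral gives an explicit antiderivative. The true order is
    [d^(-1/2)]; the decay obtained later tolerates the loss. *)
Lemma wallis_lower d : / INR (S d) <= wallis d.
Proof.
have PI0 := PI_RGT_0; have hd : 0 < INR (S d) by apply: lt_0_INR; lia.
have h : is_RInt (fun y => cos y ^ d * sin y) 0 (PI / 2) (/ INR (S d)).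
{ have -> : / INR (S d) = minus (- cos (PI / 2) ^ S d / INR (S d)) (- cos 0 ^ S d / INR (S d)).
  { by rewrite cos_PI2 cos_0 pow1 /minus /plus /opp /= Rmult_0_l; field; rewrite S_INR in hd; case: (d) hd => /=; intros; lra. }
  apply: (is_RInt_derive (fun y => - cos y ^ S d / INR (S d))).
    move=> y _; auto_derive => //; rewrite -/(INR (S d)); field; exact: Rgt_not_eq.
  move=> y _; apply: (ex_derive_continuous (fun y => cos y ^ d * sin y)); by auto_derive. }
rewrite -(is_RInt_unique _ _ _ _ h) wallisE; apply: RInt_le.
- lra.
- by eexists; exact: h.
- exact: ex_wallis_cos.
move=> y hy; rewrite Rmult_0_l cos_0; apply: Rmult_le_compat_l; first by apply: cospow_ge0; lra.
by case: (SIN_bound y).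
Qed.
Lemma wallis_pos d : 0 < wallis d.
Proof. by apply: Rlt_le_trans (wallis_lower d); apply: Rinv_0_lt_compat; apply: lt_0_INR; lia. Qed.

Lemma odd_ne0 j : Z.odd j = true -> IZR j <> 0.
Proof. by move=> h; apply: not_0_IZR => E; rewrite E in h. Qed.

Section OddTime.
Variable d : nat.
Hypothesis hd : Nat.odd d = true.

Lemma rw_odd_ext F G : (forall j, Z.odd j = true -> F j = G j) -> Nat.iter d rw F 0%Z = Nat.iter d rw G 0%Z.
Proof. by move=> H; apply: rw_ext => j _; rewrite Z.sub_0_r hd; exact: H. Qed.

(** [q y] is the integral of [cos^d] from 0 to [y], as its derivative shows. *)
Let q y := Nat.iter d rw (fun j => sin (IZR j * y) / IZR j) 0%Z.

Lemma rw_sin_derive y : is_derive q y (cos y ^ d).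
Proof.
have -> : cos y ^ d = Nat.iter d rw (fun j => IZR j * cos (IZR j * y) / IZR j) 0%Z.
{ rewrite (rw_odd_ext _ (fun j => cos (IZR j * y))).
    by rewrite rw_cos Rmult_0_l cos_0 Rmult_1_r.
  by move=> j /odd_ne0 hj; field. }
apply: (rw_derive d (fun y j => sin (IZR j * y) / IZR j) (fun y j => IZR j * cos (IZR j * y) / IZR j)) => j.
by auto_derive => //; rewrite /Rdiv; ring.
Qed.
Lemma rw_sin_PI2 : Nat.iter d rw (fun j => sin (IZR j * (PI / 2)) / IZR j) 0%Z = wallis d.
Proof.
symmetry; apply: is_RInt_unique.
have -> : Nat.iter d rw (fun j => sin (IZR j * (PI / 2)) / IZR j) 0%Z = minus (q (PI / 2)) (q 0).
{ have -> : q 0 = 0.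
  { rewrite /q (rw_odd_ext _ (fun _ => 0)) ?rw_const // => j _; rewrite Rmult_0_r sin_0 /Rdiv; ring. }
  by rewrite /minus /plus /opp /= /q; ring. }
apply: (is_RInt_derive q); first by move=> y _; exact: rw_sin_derive.
by move=> y _; apply: (ex_derive_continuous (fun y => cos y ^ d)); auto_derive.
Qed.
Lemma rw_sin_le y : 0 <= y <= PI / 2 -> q y <= wallis d.
Proof.
move=> hy; rewrite -rw_sin_PI2 -/(q (PI / 2)).
have [c [hc E]] := MVT_gen q y (PI / 2) (fun y => cos y ^ d) (fun y _ => rw_sin_derive y)
  (fun y _ => ltac:(apply: derivable_continuous_pt; eexists; apply/is_derive_Reals; exact: rw_sin_derive)).
rewrite Rmin_left ?Rmax_right in hc; try lra.
have := cospow_ge0 d c ltac:(lra) => h.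
have : 0 <= cos c ^ d * (PI / 2 - y) by apply: Rmult_le_pos; lra.
lra.
Qed.
(* The function E[cos(f y) / f^2] vanishes at PI / 2 and its derivative is at least - wallis d. *)
Lemma rw_inv_sqr_le : Nat.iter d rw (fun j => / (IZR j * IZR j)) 0%Z <= PI / 2 * wallis d.
Proof.
have PI0 := PI_RGT_0.
pose p y := Nat.iter d rw (fun j => cos (IZR j * y) / (IZR j * IZR j)) 0%Z.
have hp y : is_derive p y (- q y).
{ have -> : - q y = Nat.iter d rw (fun j => - (IZR j * sin (IZR j * y)) / (IZR j * IZR j)) 0%Z.
  { have -> : - q y = -1 * q y by ring.
    rewrite /q -rw_scal; apply: rw_odd_ext => j /odd_ne0 hj; field; done. }
  apply: (rw_derive d (fun y j => cos (IZR j * y) / (IZR j * IZR j))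
    (fun y j => - (IZR j * sin (IZR j * y)) / (IZR j * IZR j))) => j.
  by auto_derive => //; rewrite /Rdiv; ring. }
have [c [hc E]] := MVT_gen p 0 (PI / 2) (fun y => - q y) (fun y _ => hp y)
  (fun y _ => ltac:(apply: derivable_continuous_pt; eexists; apply/is_derive_Reals; exact: hp)).
rewrite Rmin_left ?Rmax_right in hc; try lra.
have E1 : p (PI / 2) = 0.
{ rewrite /p (rw_odd_ext _ (fun _ => 0)) ?rw_const // => j hj; rewrite cos_odd_PI2 //; rewrite /Rdiv; ring. }
have E0 : p 0 = Nat.iter d rw (fun j => / (IZR j * IZR j)) 0%Z.
{ by apply: rw_odd_ext => j _; rewrite Rmult_0_r cos_0 /Rdiv Rmult_1_l. }
have := rw_sin_le c hc => h; rewrite -E0.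
rewrite E1 in E; have : q c * (PI / 2) <= wallis d * (PI / 2) by apply: Rmult_le_compat_r; lra.
lra.
Qed.
(** An odd function averaged over a symmetric walk. *)
Lemma rw_sin_inv_sqr : Nat.iter d rw (fun j => sin (IZR j * (PI / 2)) / (IZR j * IZR j)) 0%Z = 0.
Proof.
set v := Nat.iter _ _ _ _.
have : v = -1 * v; last lra.
rewrite {2}/v -rw_scal -[0%Z in RHS]Z.opp_0 -rw_opp; apply: rw_odd_ext => j /odd_ne0 hj.
rewrite opp_IZR Ropp_mult_distr_l_reverse sin_neg; field; done.
Qed.
(** Each single position has probability at most [2 / PI * wallis d]. The odd positions are listed
    in pairs [2k + 1], [- 2k - 1], matching the pairing in the series of the theorem. *)
Lemma rw_sum_le (h : Z -> R) K : (forall j, 0 <= h j) -> (d <= 2 * K)%nat ->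
  Nat.iter d rw h 0%Z <= 2 / PI * wallis d *
    rsum (fun k : nat => h (2 * Z.of_nat k + 1)%Z + h (2 * (- Z.of_nat k - 1) + 1)%Z) K.
Proof.
move=> h0 hK; have PI0 := PI_RGT_0.
pose ind (k j : Z) := if Z.eqb j k then 1 else 0.
have ind0 k j : 0 <= ind k j by rewrite /ind; case: Z.eqb; lra.
pose a (k : nat) := (2 * Z.of_nat k + 1)%Z; pose b (k : nat) := (2 * (- Z.of_nat k - 1) + 1)%Z.
apply: (Rle_trans _ (Nat.iter d rw (fun j => rsum (fun k : nat => h (a k) * ind (a k) j + h (b k) * ind (b k) j) K) 0%Z)).
  apply: rw_le => j hj1 hj2; rewrite Z.sub_0_r hd in hj1 hj2.
  have [k [hk ho]] : exists k : nat, (k < K)%nat /\ (j = a k \/ j = b k).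
  { move/Z.odd_spec: hj2 => [m hm]; rewrite /a /b; case: (Z_le_gt_dec 0 m) => h1.
      by exists (Z.to_nat m); split; [lia | left; lia].
    by exists (Z.to_nat (- m - 1)); split; [lia | right; lia]. }
  have T0 m : 0 <= h (a m) * ind (a m) j + h (b m) * ind (b m) j.
  { by apply: Rplus_le_le_0_compat; apply: Rmult_le_pos. }
  apply: Rle_trans (rsum_mono _ (S k) K T0 hk); rewrite rsumS.
  have h1 := rsum_ge0 (fun m => h (a m) * ind (a m) j + h (b m) * ind (b m) j) k (fun p _ => T0 p).
  have := Rmult_le_pos _ _ (h0 (a k)) (ind0 (a k) j); have := Rmult_le_pos _ _ (h0 (b k)) (ind0 (b k) j).
  have I1 e : ind e e = 1 by rewrite /ind Z.eqb_refl.
  by move: h1; case: ho => ->; rewrite I1; lra.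
rewrite rw_rsum -rsum_scal; apply: rsum_le => k _; rewrite rw_add !rw_scal.
have P c : Z.odd c = true -> Nat.iter d rw (ind c) 0%Z <= 2 / PI * wallis d.
{ move=> hc; rewrite rw_indicator Z.sub_0_r ?hd //; apply: Rmult_le_compat_l (wallis_cos_le d c).
  by apply: Rdiv_le_0_compat; lra. }
have ha := Rmult_le_compat_l _ _ _ (h0 (a k)) (P (a k) ltac:(apply/Z.odd_spec; eexists; reflexivity)).
have hb := Rmult_le_compat_l _ _ _ (h0 (b k)) (P (b k) ltac:(apply/Z.odd_spec; eexists; reflexivity)).
rewrite -/(a k) -/(b k); lra.
Qed.

End OddTime.

End Walk.

(** * Interpolation of the orbit *)

Section VectorWalk.
Context {X : CBanach}.
Implicit Types (F G : Z -> X) (i j k : Z) (n d : nat) (x y z w : X).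
Add Ring sz_ring : (@sz_ring_theory X).
Ltac vring := apply: sz_vec_inj; rewrite ?szE; ring.

Definition rwv F : Z -> X := fun j => vscal (Cof (/ 2)) (vadd (F (j + 1)%Z) (F (j - 1)%Z)).
(* The factor - i makes this operator turn the orbit of w into the orbit of opcos w, see
   orbit_opcos. *)
Definition dwv F : Z -> X :=
  fun j => vscal (Cmul (Copp Ci) (Cof (/ 2))) (vsub (F (j + 1)%Z) (F (j - 1)%Z)).

Lemma rwvS n F j : Nat.iter (S n) rwv F j =
  vscal (Cof (/ 2)) (vadd (Nat.iter n rwv F (j + 1)%Z) (Nat.iter n rwv F (j - 1)%Z)).
Proof. by []. Qed.
Lemma rwv_norm n F j : vnorm (Nat.iter n rwv F j) <= Nat.iter n rw (fun j => vnorm (F j)) j.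
Proof.
elim: n j => [|n IH] j; first by rewrite /=; lra.
rewrite rwvS rwS vnorm_scal Cnorm_Cof Rabs_right; last lra.
have := vnorm_triangle X (Nat.iter n rwv F (j + 1)%Z) (Nat.iter n rwv F (j - 1)%Z).
by have := IH (j + 1)%Z; have := IH (j - 1)%Z; lra.
Qed.
Lemma rwv_bop n (A : X -> X) F j : is_bounded_op A ->
  Nat.iter n rwv (fun j => A (F j)) j = A (Nat.iter n rwv F j).
Proof.
by move=> hA; elim: n j => [|n IH] j //; rewrite !rwvS !IH (bop_scal _ hA) (bop_add _ hA).
Qed.
Lemma rwv_scal n a F j : Nat.iter n rwv (fun j => vscal a (F j)) j = vscal a (Nat.iter n rwv F j).
Proof. exact: (rwv_bop n (opZ a opI) F j (bop_opZ a _ bop_opI)). Qed.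
Lemma rwv_sub n F G j :
  Nat.iter n rwv (fun j => vsub (F j) (G j)) j = vsub (Nat.iter n rwv F j) (Nat.iter n rwv G j).
Proof. by elim: n j => [|n IH] j //; rewrite !rwvS !IH; vring. Qed.
Lemma rwv_const n (a : Z -> Cplx) x j : Nat.iter n rwv (fun j => vscal (a j) x) j =
  vscal (mkC (Nat.iter n rw (fun j => Cre (a j)) j) (Nat.iter n rw (fun j => Cim (a j)) j)) x.
Proof.
elim: n j => [|n IH] j; first by rewrite /=; congr vscal; case: (a j).
rewrite rwvS !IH !rwS -vscal_distr_c vscal_assoc; congr vscal; ceq; field.
Qed.
Lemma rwv_odd_ext d F G : Nat.odd d = true -> (forall j, Z.odd j = true -> F j = G j) ->
  Nat.iter d rwv F 0%Z = Nat.iter d rwv G 0%Z.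
Proof.
move=> hd H; apply: vsub_eq0; apply: vnorm_small0 => eps he.
rewrite -rwv_sub; apply: Rle_trans (rwv_norm _ _ _) _.
rewrite (rw_odd_ext d hd _ (fun _ => 0)) ?rw_const; first lra.
move=> j hj; rewrite H // (_ : vsub (G j) (G j) = vzero); [exact: vnorm_zero | vring].
Qed.

Lemma rwv_dwv n F : Nat.iter n rwv (dwv F) = dwv (Nat.iter n rwv F).
Proof.
elim: n => [|n IH] //; rewrite -[LHS]/(rwv (Nat.iter n rwv (dwv F))) IH.
rewrite -[Nat.iter (S n) rwv F]/(rwv (Nat.iter n rwv F)).
apply: functional_extensionality => j; rewrite /rwv /dwv.
have -> : (j + 1 - 1 = j)%Z by lia.
have -> : (j - 1 + 1 = j)%Z by lia.
vring.
Qed.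
(** Multiplication by the position and averaging commute up to [i dwv]. Each of the [n + 1] steps
    contributes one such commutator, and [dwv] commutes with averaging. *)
Lemma rwv_mul_index n F j0 j :
  Nat.iter (S n) rwv (fun j => vscal (Cof (IZR (j - j0))) (F j)) j =
  vadd (vscal (Cof (IZR (j - j0))) (Nat.iter (S n) rwv F j))
       (vscal (Cmul Ci (Cof (INR (S n)))) (Nat.iter n rwv (dwv F) j)).
Proof.
have step H i : rwv (fun j => vscal (Cof (IZR (j - j0))) (H j)) i =
  vadd (vscal (Cof (IZR (i - j0))) (rwv H i)) (vscal Ci (dwv H i)).
{ rewrite /rwv /dwv.
  have -> : IZR (i + 1 - j0) = IZR (i - j0) + 1 by rewrite -plus_IZR; congr IZR; lia.
  have -> : IZR (i - 1 - j0) = IZR (i - j0) + - 1 by rewrite -plus_IZR; congr IZR; lia.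
  rewrite !CofD -/C1 (_ : Cof (- 1) = Copp C1); last by ceq; ring.
  rewrite (vscal_assoc _ Ci) (_ : Cmul Ci (Cmul (Copp Ci) (Cof (/ 2))) = Cof (/ 2)); last by ceq; ring.
  vring. }
elim: n j => [|n IH] j.
  by rewrite -[LHS]/(rwv (fun j => vscal (Cof (IZR (j - j0))) (F j)) j) step (_ : Cmul Ci (Cof (INR 1)) = Ci) //; ceq; ring.
rewrite -[LHS]/(rwv (Nat.iter (S n) rwv (fun j => vscal (Cof (IZR (j - j0))) (F j))) j).
have -> : Nat.iter (S n) rwv (fun j => vscal (Cof (IZR (j - j0))) (F j)) = fun i =>
  vadd (vscal (Cof (IZR (i - j0))) (Nat.iter (S n) rwv F i))
       (vscal (Cmul Ci (Cof (INR (S n)))) (Nat.iter n rwv (dwv F) i)).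
{ by apply: functional_extensionality => i; exact: IH. }
have -> : forall P Q, rwv (fun i => vadd (P i) (Q i)) j = vadd (rwv P j) (rwv Q j).
{ by move=> P Q; rewrite /rwv; vring. }
rewrite step -(rwv_dwv (S n)).
have -> : rwv (fun i => vscal (Cmul Ci (Cof (INR (S n)))) (Nat.iter n rwv (dwv F) i)) j =
  vscal (Cmul Ci (Cof (INR (S n)))) (Nat.iter (S n) rwv (dwv F) j).
{ by rewrite rwvS /rwv; vring. }
rewrite (S_INR (S n)) CofD -/C1; vring.
Qed.

(* Differencing gains a factor 1 / sqrt (n + 1), because (n + 1) E[dwv F] is E[f F(f)] up to a
   unit and the walk has standard deviation sqrt (n + 1). *)
Lemma rwv_dwv_gain n F j0 B : 0 <= B ->
  (forall j, (Z.abs (j - j0) <= Z.of_nat (S n))%Z -> vnorm (F j) <= B) ->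
  vnorm (Nat.iter n rwv (dwv F) j0) <= B / sqrt (INR (S n)).
Proof.
move=> hB H; have h := rwv_mul_index n F j0 j0.
have hn : 0 < INR (S n) by apply: lt_0_INR; lia.
have hs : 0 < sqrt (INR (S n)) by apply: sqrt_lt_R0.
have ss : sqrt (INR (S n)) * sqrt (INR (S n)) = INR (S n) by apply: sqrt_sqrt; lra.
rewrite Z.sub_diag -/C0 vscal0 vadd_zero_l in h.
have h1 : INR (S n) * vnorm (Nat.iter n rwv (dwv F) j0) <= B * sqrt (INR (S n)).
{ have -> : INR (S n) * vnorm (Nat.iter n rwv (dwv F) j0) =
    vnorm (vscal (Cmul Ci (Cof (INR (S n)))) (Nat.iter n rwv (dwv F) j0)).
  { by rewrite vnorm_scal CnormM Cnorm_Ci Cnorm_Cof Rabs_right; [ring | lra]. }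
  rewrite -h; apply: Rle_trans (rwv_norm _ _ _) _.
  apply: (Rle_trans _ (Nat.iter (S n) rw (fun j => B * Rabs (IZR (j - j0))) j0)).
    apply: rw_le => j hj _; rewrite vnorm_scal Cnorm_Cof Rmult_comm.
    by apply: Rmult_le_compat_r; [exact: Rabs_pos | exact: H].
  by rewrite rw_scal; apply: Rmult_le_compat_l (rw_abs _ _). }
apply: (Rmult_le_reg_l (INR (S n))) => //; apply: Rle_trans h1 _; right.
by rewrite -{2}ss; field; lra.
Qed.
(** Four blocks of [n] steps, each paired with one [dwv] and gaining [1 / sqrt (n + 1)], and one
    more step that makes the total odd. Each block shrinks the range of controlled positions by
    [n + 1]. *)
Lemma rwv_dwv4_bound n F B : 0 <= B ->
  (forall j, (Z.abs j <= 4 * Z.of_nat (S n) + 1)%Z -> vnorm (F j) <= B) ->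
  vnorm (Nat.iter (4 * n + 1) rwv (dwv (dwv (dwv (dwv F)))) 0%Z) <= B / (INR (S n) * INR (S n)).
Proof.
move=> hB H; pose V G := Nat.iter n rwv (dwv G).
have hn : 0 < INR (S n) by apply: lt_0_INR; lia.
have hs : 0 < sqrt (INR (S n)) by apply: sqrt_lt_R0.
have ss : sqrt (INR (S n)) * sqrt (INR (S n)) = INR (S n) by apply: sqrt_sqrt; lra.
set s := sqrt (INR (S n)) in hs ss.
have gain G m B' : 0 <= B' -> (forall j, (Z.abs j <= m + Z.of_nat (S n))%Z -> vnorm (G j) <= B') ->
  forall j, (Z.abs j <= m)%Z -> vnorm (V G j) <= B' / s.
{ by move=> hB' hG j hj; apply: rwv_dwv_gain => // p hp; apply: hG; lia. }
have pos B' : 0 <= B' -> 0 <= B' / s by move=> h; apply: Rdiv_le_0_compat.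
have h1 : forall j, (Z.abs j <= 3 * Z.of_nat (S n) + 1)%Z -> vnorm (V F j) <= B / s.
{ by apply: gain => // j hj; apply: H; lia. }
have h2 : forall j, (Z.abs j <= 2 * Z.of_nat (S n) + 1)%Z -> vnorm (V (V F) j) <= B / s / s.
{ by apply: gain; [exact: (pos _ hB) | move=> j hj; apply: h1; lia]. }
have h3 : forall j, (Z.abs j <= Z.of_nat (S n) + 1)%Z -> vnorm (V (V (V F)) j) <= B / s / s / s.
{ by apply: gain; [exact: (pos _ (pos _ hB)) | move=> j hj; apply: h2; lia]. }
have h4 : forall j, (Z.abs j <= 1)%Z -> vnorm (V (V (V (V F))) j) <= B / s / s / s / s.
{ by apply: gain; [exact: (pos _ (pos _ (pos _ hB))) | move=> j hj; apply: h3; lia]. }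
have E : Nat.iter (4 * n + 1) rwv (dwv (dwv (dwv (dwv F)))) = rwv (V (V (V (V F)))).
{ have -> : (4 * n + 1 = 1 + (n + (n + (n + n))))%nat by lia.
  rewrite !Nat.iter_add /V -[Nat.iter 1 rwv _]/(rwv _); congr rwv.
  by rewrite !rwv_dwv. }
rewrite E /rwv vnorm_scal Cnorm_Cof Rabs_right; last lra.
have hp := h4 (0 + 1)%Z ltac:(lia); have hm := h4 (0 - 1)%Z ltac:(lia).
have := vnorm_triangle X (V (V (V (V F))) (0 + 1)%Z) (V (V (V (V F))) (0 - 1)%Z).
have -> : B / (INR (S n) * INR (S n)) = B / s / s / s / s by rewrite -ss; field; lra.
lra.
Qed.

End VectorWalk.

(** * Bernstein's inequality on the orbit of x *)

Section Bernstein.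
Context {X : CBanach}.
Implicit Types (x y z w : X) (j : Z) (n d : nat).
Add Ring sz_ring : (@sz_ring_theory X).
Ltac vring := apply: sz_vec_inj; rewrite ?szE; ring.
Variables (al C : R) (T : X -> X).
Hypotheses (hal : 0 <= al < 1) (hC : 0 < C) (hT : is_bounded_op T) (gT : growth al T C).

(** This is [exp(i j (PI/2 - r T)) w]; averaged over [d] steps of the walk from 0 it is
    [cos^d(PI/2 - rT) w = sin^d(rT) w]. *)
Definition orbit (r : R) w : Z -> X :=
  fun j => vscal (Cis (IZR j * (PI / 2))) (iexp T (- (IZR j * r)) w).

Lemma orbit_norm r w j : vnorm (orbit r w j) <= C * weight al (Rabs (IZR j * r)) * vnorm w.
Proof. by rewrite /orbit vnorm_scal Cnorm_Cis Rmult_1_l -Rabs_Ropp; exact: gT. Qed.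

(** On orbits [dwv] acts as [sin(PI/2 - rT) = cos(rT)]. A preimage of [x] under cosines thus turns
    averages into averages of differences. *)
Lemma orbit_opcos r w : orbit r (opcos (opZ (Cof r) T) w) = dwv (orbit r w).
Proof.
apply: functional_extensionality => j; rewrite /dwv /orbit.
have E a : Exp (opZ (Cmul a (Cof r)) T) w = Exp (opZ a (opZ (Cof r) T)) w.
{ by congr (Exp _ _); apply: functional_extensionality => v; rewrite /opZ vscal_assoc. }
have Ep : iexp T (- (IZR (j + 1) * r)) w = iexp T (- (IZR j * r)) (Exp (opZ (Copp Ci) (opZ (Cof r) T)) w).
{ rewrite plus_IZR (_ : - ((IZR j + 1) * r) = - (IZR j * r) + - r); last by ring.
  rewrite iexp_add // -E /iexp; congr (Exp _ (Exp (opZ _ _) _)); ceq; ring. }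
have Em : iexp T (- (IZR (j - 1) * r)) w = iexp T (- (IZR j * r)) (Exp (opZ Ci (opZ (Cof r) T)) w).
{ rewrite minus_IZR (_ : - ((IZR j - 1) * r) = - (IZR j * r) + r); last by ring.
  by rewrite iexp_add // -E. }
rewrite Ep Em /opcos (bop_scal _ (iexp_bop T _ hT)) (bop_add _ (iexp_bop T _ hT)).
have -> : Cis (IZR (j + 1) * (PI / 2)) = Cmul Ci (Cis (IZR j * (PI / 2))).
{ rewrite plus_IZR Rmult_plus_distr_r Rmult_1_l CisD.
  by rewrite (_ : Cis (PI / 2) = Ci); [ring | rewrite /Cis cos_PI2 sin_PI2]. }
have -> : Cis (IZR (j - 1) * (PI / 2)) = Cmul (Copp Ci) (Cis (IZR j * (PI / 2))).
{ rewrite minus_IZR (_ : (IZR j - 1) * (PI / 2) = IZR j * (PI / 2) + - (PI / 2)); last by ring.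
  rewrite CisD (_ : Cis (- (PI / 2)) = Copp Ci); first by ring.
  by rewrite /Cis cos_neg sin_neg cos_PI2 sin_PI2; ceq; ring. }
set P := iexp T _ _; set Q := iexp T _ _.
have -> : vsub (vscal (Cmul Ci (Cis (IZR j * (PI / 2)))) Q) (vscal (Cmul (Copp Ci) (Cis (IZR j * (PI / 2)))) P)
  = vscal Ci (vscal (Cis (IZR j * (PI / 2))) (vadd P Q)) by vring.
rewrite !vscal_assoc; congr vscal.
have -> : Cmul (Cmul (Copp Ci) (Cof (/ 2))) Ci = Cof (/ 2) by ceq; ring.
ring.
Qed.


Lemma orbit_step r h w j m : opbound T m ->
  vnorm (vsub (vsub (orbit (r + h) w j) (orbit r w j))
              (vscal (Cmul Ci (Cof (- (IZR j * h)))) (T (orbit r w j)))) <=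
  (Rabs (IZR j * h) * m) ^ 2 * exp (Rabs (IZR j * h) * m) * vnorm (orbit r w j).
Proof.
move=> hm; pose B := opZ (Cmul Ci (Cof (- (IZR j * h)))) T.
have hB : is_bounded_op B by apply: bop_opZ.
have -> : orbit (r + h) w j = Exp B (orbit r w j).
{ rewrite /orbit (_ : - (IZR j * (r + h)) = - (IZR j * h) + - (IZR j * r)); last by ring.
  by rewrite iexp_add // (bop_scal _ (Exp_bop B hB)). }
apply: Exp_remainder => //.
have := opbound_opZ (Cmul Ci (Cof (- (IZR j * h)))) T m hm.
by rewrite CnormM Cnorm_Ci Cnorm_Cof Rabs_Ropp Rmult_1_l.
Qed.

Variables (t m : R) (x : X).
Hypotheses (ht : 0 < t) (hm : opbound T m).

Section OddTime.
Variable d : nat.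
Hypothesis hd : Nat.odd d = true.

(** [interp s] is P_d(s t T) x; [interp1] and [interp2] are its first and second derivatives in [s],
    the latter being [- c t^2 T^2 sin^d(s t T) x]. *)
Definition interp (s : R) : X :=
  vscal (Cof (/ wallis d)) (Nat.iter d rwv (fun j => vscal (Cof (/ (IZR j * IZR j))) (orbit (s * t) x j)) 0%Z).
Definition interp1 (s : R) : X :=
  vscal (Cof (/ wallis d)) (Nat.iter d rwv (fun j => vscal (Cof (/ (IZR j * IZR j)))
    (vscal (Cmul Ci (Cof (- (IZR j * t)))) (T (orbit (s * t) x j)))) 0%Z).
Definition interp2 (s : R) : X :=
  vscal (Cof (- (t * t) / wallis d)) (T (T (Nat.iter d rwv (orbit (s * t) x) 0%Z))).

Lemma orbit0 y j : orbit 0 y j = vscal (Cis (IZR j * (PI / 2))) y.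
Proof. by rewrite /orbit Rmult_0_r Ropp_0 iexp0. Qed.

Lemma interp_0 : interp 0 = vzero.
Proof.
rewrite /interp Rmult_0_l (rwv_odd_ext d _ (fun j => vscal (mkC 0 (sin (IZR j * (PI / 2)) / (IZR j * IZR j))) x)) //.
  by rewrite rwv_const /= rw_const rw_sin_inv_sqr // -/(Cof 0) -/C0 vscal0 vscalz.
move=> j hj; rewrite orbit0 vscal_assoc; congr vscal; ceq; rewrite ?cos_odd_PI2 // /Rdiv; ring.
Qed.
(** At [s = 0] the exponentials disappear, and the average of [sin(f PI/2) / f] is [wallis d], which
    cancels the factor in front. *)
Lemma interp1_0 : interp1 0 = vscal (Cof t) (T x).
Proof.
have W0 := wallis_pos d.
rewrite /interp1 Rmult_0_l (rwv_odd_ext d _ (fun j => vscal (mkC (t * (sin (IZR j * (PI / 2)) / IZR j)) 0) (T x))) //.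
  rewrite rwv_const /= rw_const rw_scal rw_sin_PI2 // vscal_assoc; congr vscal; ceq; field; lra.
move=> j hj; rewrite orbit0 (bop_scal _ hT) !vscal_assoc; congr vscal; have := odd_ne0 j hj => h.
by ceq; rewrite ?cos_odd_PI2 //; field.
Qed.

(** Independent of [s] in [0, 1], so that its weighted average over the walk can serve as the [L] of
    [mean_value]. *)
Definition step_const j := (Rabs (IZR j * t) * m) ^ 2 * exp (Rabs (IZR j * t) * m) *
  (C * weight al (Rabs (IZR j * t)) * vnorm x).

Lemma step_const_bound s h j : 0 <= s -> 0 <= h -> s + h <= 1 ->
  vnorm (vsub (vsub (orbit ((s + h) * t) x j) (orbit (s * t) x j))
              (vscal (Cof h) (vscal (Cmul Ci (Cof (- (IZR j * t)))) (T (orbit (s * t) x j))))) <=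
  step_const j * h ^ 2.
Proof.
move=> hs hh hsh; have [m0 _] := hm.
rewrite Rmult_plus_distr_r.
have -> : vscal (Cof h) (vscal (Cmul Ci (Cof (- (IZR j * t)))) (T (orbit (s * t) x j))) =
  vscal (Cmul Ci (Cof (- (IZR j * (h * t))))) (T (orbit (s * t) x j)).
{ by rewrite vscal_assoc; congr vscal; ceq; ring. }
apply: Rle_trans (orbit_step (s * t) (h * t) x j m hm) _; rewrite /step_const.
have E : Rabs (IZR j * (h * t)) = h * Rabs (IZR j * t).
{ by rewrite -{2}(Rabs_right h) -?Rabs_mult; [congr Rabs; ring | lra]. }
rewrite E; set u := Rabs (IZR j * t); have u0 : 0 <= u by apply: Rabs_pos.
have e1 : exp (h * u * m) <= exp (u * m).
{ apply: exp_le; have : 0 <= u * m by apply: Rmult_le_pos. nra. }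
have e0 := exp_pos (h * u * m).
have o1 : vnorm (orbit (s * t) x j) <= C * weight al u * vnorm x.
{ apply: Rle_trans (orbit_norm _ _ _) _; apply: Rmult_le_compat_r (vnorm_ge0 _) _.
  apply: Rmult_le_compat_l; first lra.
  apply: weight_mono => //; first exact: Rabs_pos.
  have -> : IZR j * (s * t) = s * (IZR j * t) by ring.
  by rewrite Rabs_mult (Rabs_right s) -/u; nra. }
have -> : (u * m) ^ 2 * exp (u * m) * (C * weight al u * vnorm x) * h ^ 2 =
  (h * u * m) ^ 2 * exp (u * m) * (C * weight al u * vnorm x) by ring.
have p := pow2_ge_0 (h * u * m).
apply: Rmult_le_compat => //; [by apply: Rmult_le_pos; lra | exact: vnorm_ge0 |].
by apply: Rmult_le_compat_l.
Qed.

Lemma interp_derive : exists L, forall s h, 0 <= s -> 0 <= h -> s + h <= 1 ->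
  vnorm (vsub (vsub (interp (s + h)) (interp s)) (vscal (Cof h) (interp1 s))) <= L * h ^ 2.
Proof.
have W0 := wallis_pos d.
exists (/ wallis d * Nat.iter d rw (fun j => Rabs (/ (IZR j * IZR j)) * step_const j) 0%Z) => s h hs hh hsh.
rewrite /interp /interp1.
set F := fun j => vscal _ (orbit ((s + h) * t) x j).
set G := fun j => vscal _ (orbit (s * t) x j).
set H := fun j => vscal (Cof (/ (IZR j * IZR j))) (vscal _ (T _)).
have -> : vsub (vsub (vscal (Cof (/ wallis d)) (Nat.iter d rwv F 0%Z)) (vscal (Cof (/ wallis d)) (Nat.iter d rwv G 0%Z)))
     (vscal (Cof h) (vscal (Cof (/ wallis d)) (Nat.iter d rwv H 0%Z))) =
  vscal (Cof (/ wallis d)) (Nat.iter d rwv (fun j => vsub (vsub (F j) (G j)) (vscal (Cof h) (H j))) 0%Z).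
{ rewrite !rwv_sub rwv_scal; vring. }
rewrite vnorm_scal Cnorm_Cof Rabs_right; last by apply: Rle_ge; apply: Rlt_le; apply: Rinv_0_lt_compat.
rewrite Rmult_assoc; apply: Rmult_le_compat_l; first by apply: Rlt_le; apply: Rinv_0_lt_compat.
apply: Rle_trans (rwv_norm _ _ _) _; rewrite Rmult_comm -rw_scal; apply: rw_le => j _ _.
have -> : vsub (vsub (F j) (G j)) (vscal (Cof h) (H j)) = vscal (Cof (/ (IZR j * IZR j)))
  (vsub (vsub (orbit ((s + h) * t) x j) (orbit (s * t) x j))
              (vscal (Cof h) (vscal (Cmul Ci (Cof (- (IZR j * t)))) (T (orbit (s * t) x j))))).
{ rewrite /F /G /H; vring. }
rewrite vnorm_scal Cnorm_Cof.
have := step_const_bound s h j hs hh hsh; have := Rabs_pos (/ (IZR j * IZR j)); nra.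
Qed.

Lemma interp1_derive : exists L, forall s h, 0 <= s -> 0 <= h -> s + h <= 1 ->
  vnorm (vsub (vsub (interp1 (s + h)) (interp1 s)) (vscal (Cof h) (interp2 s))) <= L * h ^ 2.
Proof.
have W0 := wallis_pos d; have [m0 hm'] := hm.
pose c j := Cmul (Cof (/ (IZR j * IZR j))) (Cmul Ci (Cof (- (IZR j * t)))).
exists (/ wallis d * Nat.iter d rw (fun j => Cnorm (c j) * (m * step_const j)) 0%Z) => s h hs hh hsh.
(* On odd positions the factor [1 / f^2] and the square of [- i f t] combine to [- t^2]. *)
have E2 : interp2 s = vscal (Cof (/ wallis d)) (Nat.iter d rwv (fun j => vscal (c j) (T
   (vscal (Cmul Ci (Cof (- (IZR j * t)))) (T (orbit (s * t) x j))))) 0%Z).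
{ rewrite /interp2 -(rwv_bop d T (orbit (s * t) x) 0%Z hT) -(rwv_bop d T (fun j => T (orbit (s * t) x j)) 0%Z hT).
  transitivity (vscal (Cof (/ wallis d))
    (Nat.iter d rwv (fun j => vscal (Cof (- (t * t))) (T (T (orbit (s * t) x j)))) 0%Z)).
    by rewrite rwv_scal vscal_assoc; congr vscal; ceq; rewrite /Rdiv; ring.
  congr vscal; apply: rwv_odd_ext => // j hj; rewrite (bop_scal _ hT) vscal_assoc; congr vscal.
  by have := odd_ne0 j hj => h0; rewrite /c; ceq; field. }
rewrite E2 /interp1.
set F := fun j => vscal _ (vscal _ (T (orbit ((s + h) * t) x j))).
set G := fun j => vscal _ (vscal _ (T (orbit (s * t) x j))).
set H := fun j => vscal (c j) _.
have -> : vsub (vsub (vscal (Cof (/ wallis d)) (Nat.iter d rwv F 0%Z)) (vscal (Cof (/ wallis d)) (Nat.iter d rwv G 0%Z)))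
     (vscal (Cof h) (vscal (Cof (/ wallis d)) (Nat.iter d rwv H 0%Z))) =
  vscal (Cof (/ wallis d)) (Nat.iter d rwv (fun j => vsub (vsub (F j) (G j)) (vscal (Cof h) (H j))) 0%Z).
{ rewrite !rwv_sub rwv_scal; vring. }
rewrite vnorm_scal Cnorm_Cof Rabs_right; last by apply: Rle_ge; apply: Rlt_le; apply: Rinv_0_lt_compat.
rewrite Rmult_assoc; apply: Rmult_le_compat_l; first by apply: Rlt_le; apply: Rinv_0_lt_compat.
apply: Rle_trans (rwv_norm _ _ _) _; rewrite Rmult_comm -rw_scal; apply: rw_le => j _ _.
have -> : vsub (vsub (F j) (G j)) (vscal (Cof h) (H j)) = vscal (c j) (T
  (vsub (vsub (orbit ((s + h) * t) x j) (orbit (s * t) x j))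
              (vscal (Cof h) (vscal (Cmul Ci (Cof (- (IZR j * t)))) (T (orbit (s * t) x j)))))).
{ rewrite /F /G /H !(bop_sub _ hT) !(bop_scal _ hT) /c; vring. }
rewrite vnorm_scal.
have h1 := step_const_bound s h j hs hh hsh; have h2 := Cnorm_ge0 (c j).
set v := vsub _ _ in h1 *; have h3 := hm' v.
have -> : h ^ 2 * (Cnorm (c j) * (m * step_const j)) = Cnorm (c j) * (m * (step_const j * h ^ 2)) by ring.
by apply: Rmult_le_compat_l => //; apply: Rle_trans h3 _; apply: Rmult_le_compat_l.
Qed.

(** Taylor's formula at 0 by two uses of [mean_value], the second one for
    [interp s - s interp1 0]. *)
Lemma interp_error eps : (forall s, 0 <= s <= 1 -> vnorm (interp2 s) <= eps) ->
  vnorm (vscal (Cof t) (T x)) <= vnorm (interp 1) + eps.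
Proof.
move=> H; have [L1 hL1] := interp1_derive; have [L hL] := interp_derive.
have e0 : 0 <= eps by apply: Rle_trans (vnorm_ge0 _) (H 0 ltac:(lra)).
have h1 s : 0 <= s <= 1 -> vnorm (vsub (interp1 s) (interp1 0)) <= eps.
{ move=> hs; apply: (Rle_trans _ (eps * s)); last nra.
  apply: (mean_value interp1 interp2 s L1 eps (proj1 hs)).
    by move=> s' h a b c; apply: hL1; lra.
  by move=> s' hs'; apply: H; lra. }
have h2 : vnorm (vsub (vsub (interp 1) (vscal (Cof 1) (interp1 0)))
                      (vsub (interp 0) (vscal (Cof 0) (interp1 0)))) <= eps * 1.
{ apply: (mean_value (fun s => vsub (interp s) (vscal (Cof s) (interp1 0)))
    (fun s => vsub (interp1 s) (interp1 0)) 1 L eps) => //; first lra.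
  move=> s h hs hh hsh; have := hL s h hs hh hsh.
  by congr (vnorm _ <= _); rewrite CofD; vring. }
rewrite interp_0 interp1_0 in h2.
have E : vsub (vsub (interp 1) (vscal (Cof 1) (vscal (Cof t) (T x)))) (vsub vzero (vscal (Cof 0) (vscal (Cof t) (T x)))) =
  vsub (interp 1) (vscal (Cof t) (T x)).
{ rewrite -/C0 -/C1; vring. }
rewrite E Rmult_1_r in h2.
by have := vnorm_split (vscal (Cof t) (T x)) (interp 1); rewrite vnorm_subC; lra.
Qed.

(** The weight [1 + |f t|^al] is split: its constant part meets the total mass PI/2 of the
    coefficients, the other part the pointwise bound [(2 / PI) / f^2]. *)
Lemma interp_norm sumZ :
  (forall K, rsum (fun k => calpha_term al (Z.of_nat k) + calpha_term al (- Z.of_nat k - 1)%Z) K <= sumZ) ->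
  vnorm (interp 1) <= C * vnorm x * (PI / 2 + 2 / PI * Rpower t al * sumZ).
Proof.
move=> hsum; have W0 := wallis_pos d; have PI0 := PI_RGT_0.
have iW : 0 < / wallis d by apply: Rinv_0_lt_compat.
have tp := Rpower_pos t al.
rewrite /interp vnorm_scal Cnorm_Cof Rabs_right; last lra.
pose h j := Rpower (Rabs (IZR j)) (- (2 - al)).
have H1 : vnorm (Nat.iter d rwv (fun j => vscal (Cof (/ (IZR j * IZR j))) (orbit (1 * t) x j)) 0%Z) <=
  C * vnorm x * (Nat.iter d rw (fun j => / (IZR j * IZR j)) 0%Z + Rpower t al * Nat.iter d rw h 0%Z).
{ apply: Rle_trans (rwv_norm _ _ _) _.
  rewrite -(rw_scal d (Rpower t al)) -rw_add -rw_scal; apply: rw_le => j _ hj.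
  rewrite Z.sub_0_r hd in hj; have j0 := odd_ne0 j hj.
  have aj : 0 < Rabs (IZR j) by apply: Rabs_pos_lt.
  have jj : 0 < / (IZR j * IZR j) by apply: Rinv_0_lt_compat; nra.
  rewrite vnorm_scal Cnorm_Cof (Rabs_right (/ _)); last lra.
  apply: Rle_trans (Rmult_le_compat_l _ _ _ (Rlt_le _ _ jj) (orbit_norm _ _ _)) _; right.
  rewrite Rmult_1_l /weight Rabs_mult (Rabs_right t) ?powR_Rpower; try lra; last by apply: Rmult_lt_0_compat.
  rewrite -Rpower_mult_distr //.
  have -> : h j = / (IZR j * IZR j) * Rpower (Rabs (IZR j)) al.
  { rewrite /h (_ : - (2 - al) = al + - (2)); last by ring.
    rewrite Rpower_plus Rpower_Ropp (_ : 2 = INR 2) // Rpower_pow //.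
    rewrite Rmult_comm; congr (/ _ * _).
    by rewrite /= Rmult_1_r -Rabs_mult Rabs_right //; nra. }
  ring. }
have H2 := rw_inv_sqr_le d hd.
have H3 := rw_sum_le d hd h d (fun j => Rlt_le _ _ (Rpower_pos _ _)) ltac:(lia).
have H4 : rsum (fun k : nat => h (2 * Z.of_nat k + 1)%Z + h (2 * (- Z.of_nat k - 1) + 1)%Z) d <= sumZ.
{ have E j : h (2 * j + 1)%Z = calpha_term al j by rewrite /h /calpha_term plus_IZR mult_IZR.
  by apply: Rle_trans (hsum d); right; apply: rsum_ext => k _; rewrite !E. }
have q0 : 0 < 2 / PI by apply: Rdiv_lt_0_compat; lra.
have Cx : 0 <= C * vnorm x by apply: Rmult_le_pos (vnorm_ge0 _); lra.
apply: Rle_trans (Rmult_le_compat_l _ _ _ (Rlt_le _ _ iW) H1) _.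
have -> : C * vnorm x * (PI / 2 + 2 / PI * Rpower t al * sumZ) =
  / wallis d * (C * vnorm x * (PI / 2 * wallis d + Rpower t al * (2 / PI * wallis d * sumZ))) by field; lra.
apply: Rmult_le_compat_l; first lra.
apply: Rmult_le_compat_l => //; apply: Rplus_le_compat => //.
apply: Rmult_le_compat_l; first lra.
apply: Rle_trans H3 _; apply: Rmult_le_compat_l => //; apply: Rmult_le_pos; lra.
Qed.

End OddTime.

Variables (K q : R).
Hypotheses (hq : 0 <= q * t < PI / 2) (hx : forall n, vnorm (Nat.iter n T x) <= K * q ^ n).

(** In powers of [p = n + 1]: the factor [1 / wallis] costs [p], the orbit of the auxiliary vector
    costs [p^al], and four differences gain [p^(-2)]. *)
Lemma interp2_decay : exists K', forall n s, 0 <= s <= 1 ->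
  vnorm (interp2 (4 * n + 1) s) <= K' * Rpower (INR (S n)) (- (1 - al)).
Proof.
have [m0 hm'] := hm.
pose th := q * t; pose sec := 1 + tan th * tan th.
have K0 : 0 <= K by have := hx O; have := vnorm_ge0 x => /=; lra.
have sec0 : 0 <= sec by rewrite /sec; nra.
pose Z0 := K * sec * sec.
(* [z] arises from [x] by applying [sec^2(s t T)] twice. The bound is uniform in [s] because the
   rate [th] is that of [s = 1]. *)
have inv s : 0 <= s <= 1 -> exists z, let A := opcos (opZ (Cof (s * t)) T) in
  A (A (A (A z))) = x /\ vnorm z <= Z0.
{ move=> hs; set B := opZ (Cof (s * t)) T; have hB : is_bounded_op B by apply: bop_opZ.
  have hBx n : vnorm (Nat.iter n B x) <= K * th ^ n.
  { rewrite /B iter_opZ // vnorm_scal CnormX Cnorm_Cof Rabs_right; last nra.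
    have h1 := hx n; have h2 : (s * t) ^ n <= t ^ n by apply: pow_incr; nra.
    have h3 : 0 <= (s * t) ^ n by apply: pow_le; nra.
    apply: (Rle_trans _ (t ^ n * (K * q ^ n))).
      by apply: Rmult_le_compat => //; exact: vnorm_ge0.
    by rewrite /th Rpow_mult_distr; right; ring. }
  have [z1 [E1 b1]] := opcos_square_inverse B x K th hB hq hBx.
  have [z2 [E2 b2]] := opcos_square_inverse B z1 _ th hB hq b1.
  exists z2; split; first by rewrite /= E2 E1.
  by have := b2 O; rewrite /= Rmult_1_r. }
(* Positions up to [4 p + 1 <= 5 p] occur, and [kap * p >= 1] makes [weight_Rpower] applicable. *)
pose kap := 5 * (t + 1).
have Z00 : 0 <= Z0 by rewrite /Z0; apply: Rmult_le_pos => //; apply: Rmult_le_pos.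
exists (t * t * (m * m) * 4 * (C * (2 * Rpower kap al) * Z0)) => n s hs.
have [z [Ez bz]] := inv s hs.
set d := (4 * n + 1)%nat; have W0 := wallis_pos d.
have n0 : 1 <= INR (S n) by rewrite S_INR; have := pos_INR n; lra.
set p := INR (S n) in n0 *.
have hW : / wallis d <= 4 * p.
{ have h := wallis_lower d; have hd : 0 < INR (S d) by apply: lt_0_INR; lia.
  have E : INR (S d) <= 4 * p.
  { rewrite /p /d -[4](_ : INR 4 = 4) -?mult_INR; last by rewrite /=; ring.
    by apply: le_INR; lia. }
  apply: Rle_trans E; rewrite -(Rinv_inv (INR (S d))); apply: Rinv_le_contravar => //.
  exact: Rinv_0_lt_compat. }
pose B := C * (2 * Rpower (kap * p) al) * Z0.
have B0 : 0 <= B.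
{ apply: Rmult_le_pos => //; have := Rpower_pos (kap * p) al; nra. }
have hF : forall j, (Z.abs j <= 4 * Z.of_nat (S n) + 1)%Z -> vnorm (orbit (s * t) z j) <= B.
{ move=> j hj; apply: Rle_trans (orbit_norm _ _ _) _.
  have hj' : Rabs (IZR j) <= 4 * p + 1.
  { rewrite -abs_IZR /p INR_IZR_INZ -(mult_IZR 4) -plus_IZR; exact: IZR_le. }
  have w1 : weight al (Rabs (IZR j * (s * t))) <= 2 * Rpower (kap * p) al.
  { apply: Rle_trans (weight_mono al hal _ (kap * p) (Rabs_pos _) _) _.
      rewrite Rabs_mult (Rabs_right (s * t)); last nra.
      have : s * t <= t by nra.
      have := Rabs_pos (IZR j); have : 0 <= s * t by nra.
      rewrite /kap; nra.
    by apply: weight_Rpower => //; rewrite /kap; nra. }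
  have w0 := weight_ge1 al (Rabs (IZR j * (s * t))).
  apply: Rmult_le_compat => //; [by nra | exact: vnorm_ge0 |].
  by apply: Rmult_le_compat_l; lra. }
have := rwv_dwv4_bound n _ B B0 hF; rewrite -!orbit_opcos Ez -/d => h.
set v := Nat.iter d rwv _ _ in h.
rewrite /interp2 vnorm_scal Cnorm_Cof.
have -> : Rabs (- (t * t) / wallis d) = t * t * / wallis d.
{ rewrite /Rdiv Ropp_mult_distr_l_reverse Rabs_Ropp Rabs_right //; apply: Rle_ge.
  by apply: Rmult_le_pos; [nra | apply: Rlt_le; apply: Rinv_0_lt_compat]. }
rewrite -/v; have hv : vnorm (T (T v)) <= m * m * (B / (p * p)).
{ apply: Rle_trans (hm' _) _; rewrite Rmult_assoc; apply: Rmult_le_compat_l => //.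
  by apply: Rle_trans (hm' _) _; apply: Rmult_le_compat_l. }
have iW : 0 < / wallis d by apply: Rinv_0_lt_compat.
apply: (Rle_trans _ (t * t * (4 * p) * (m * m * (B / (p * p))))).
  apply: Rmult_le_compat => //; [by apply: Rmult_le_pos; nra | exact: vnorm_ge0 |].
  by apply: Rmult_le_compat_l; nra.
right; rewrite /B -Rpower_mult_distr; [|rewrite /kap; lra|lra].
have -> : - (1 - al) = al + - (1) by ring.
rewrite Rpower_plus Rpower_Ropp Rpower_1; last lra.
field; lra.
Qed.

(** Since the bound of [interp_norm] is uniform in [d], letting [n] grow removes the error term. *)
Lemma bernstein_scaled sumZ :
  (forall M, rsum (fun k => calpha_term al (Z.of_nat k) + calpha_term al (- Z.of_nat k - 1)%Z) M <= sumZ) ->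
  t * vnorm (T x) <= C * vnorm x * (PI / 2 + 2 / PI * Rpower t al * sumZ).
Proof.
move=> hsum; have [K' hK'] := interp2_decay.
have K'0 : 0 <= K'.
{ have := hK' O 0 ltac:(lra); have := vnorm_ge0 (interp2 (4 * 0 + 1) 0).
  have := Rpower_pos (INR 1) (- (1 - al)); nra. }
apply: Rminus_le; apply: (le0_of_Rpower_decay _ K' (1 - al)); first lra.
move=> s hs; have [n hn] := INR_archimed 1 s ltac:(lra); rewrite Rmult_1_r in hn.
have hd : Nat.odd (4 * n + 1) = true by apply/Nat.odd_spec; exists (2 * n)%nat; lia.
have h1 := interp_error (4 * n + 1) hd _ (fun s' hs' => hK' n s' hs').
have h2 := interp_norm (4 * n + 1) hd sumZ hsum.
rewrite vnorm_scal Cnorm_Cof Rabs_right in h1; last lra.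
have h3 : Rpower (INR (S n)) (- (1 - al)) <= Rpower s (- (1 - al)).
{ rewrite !Rpower_Ropp; apply: Rinv_le_contravar; first exact: Rpower_pos.
  by apply: Rle_Rpower_l; [lra | rewrite S_INR; lra]. }
have := Rmult_le_compat_l _ _ _ K'0 h3; lra.
Qed.

End Bernstein.

(** [y^b] is [y] times the decreasing function [y^(-(1 - b))]. It makes the passage from rates above
    [r] to [r] itself explicit, even for [r = 0]. *)
Lemma Rpower_subadditive r h b : 0 <= r -> 0 < h -> 0 < b <= 1 ->
  Rpower (r + h) b <= powR r b + Rpower h b.
Proof.
move=> hr hh hb; case: (Req_dec r 0) => [->|r0].
  by rewrite Rplus_0_l; have := powR_ge0 0 b; lra.
have E y : 0 < y -> Rpower y b = y * / Rpower y (1 - b).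
{ move=> hy; rewrite -Rpower_Ropp -{2}(Rpower_1 y) // -Rpower_plus; congr Rpower; ring. }
rewrite powR_Rpower; last lra.
rewrite !E; try lra.
have dec y : 0 < y -> y <= r + h -> / Rpower (r + h) (1 - b) <= / Rpower y (1 - b).
{ move=> hy hyr; apply: Rinv_le_contravar; [exact: Rpower_pos | apply: Rle_Rpower_l; lra]. }
have h1 := dec r ltac:(lra) ltac:(lra); have h2 := dec h hh ltac:(lra).
rewrite Rmult_plus_distr_r; apply: Rplus_le_compat; apply: Rmult_le_compat_l => //; lra.
Qed.

(** With [t = PI / (2 s)] the quotient [t^al / t] is [(2 s / PI)^(1 - al)], and the coefficient
    [2 / PI] raises the power of [2 / PI] to [2 - al]. *)
Lemma bernstein_constant al s Z : 0 < s ->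
  (PI / 2 + 2 / PI * Rpower (PI / (2 * s)) al * Z) = PI / (2 * s) * (s + Rpower (2 / PI) (2 - al) * Z * Rpower s (1 - al)).
Proof.
move=> hs; have PI0 := PI_RGT_0.
have q0 : 0 < 2 / PI by apply: Rdiv_lt_0_compat; lra.
have -> : PI / (2 * s) = / (2 / PI * s) by field; lra.
have -> : Rpower (/ (2 / PI * s)) al = Rpower (2 / PI) (- al) * Rpower s (- al).
{ rewrite Rpower_mult_distr // /Rpower ln_Rinv; last by apply: Rmult_lt_0_compat.
  by congr exp; ring. }
have -> : Rpower (2 / PI) (2 - al) = (2 / PI) * (2 / PI) * Rpower (2 / PI) (- al).
{ rewrite (_ : 2 - al = 1 + 1 + - al); last by ring.
  by rewrite !Rpower_plus Rpower_1. }
have -> : Rpower s (1 - al) = s * Rpower s (- al).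
{ by rewrite /Rminus Rpower_plus Rpower_1. }
field; lra.
Qed.

(** * The bound for one operator in terms of the local spectral radius *)

Section Local.
Context {X : CBanach}.
Implicit Types (x : X).

Lemma bernstein_local al C D (T S0 : X -> X) x r Z : 0 <= al < 1 -> 0 < C -> 0 < D ->
  is_bounded_op T -> is_bounded_op S0 -> opcomm T S0 -> growth al T C -> growth al S0 D ->
  (forall M, rsum (fun k => calpha_term al (Z.of_nat k) + calpha_term al (- Z.of_nat k - 1)%Z) M <= Z) ->
  0 <= r ->
  (forall s, r < s -> exists K, forall n, vnorm (Nat.iter n (opD T (opZ Ci S0)) x) <= K * s ^ n) ->
  vnorm (T x) <= C * (r + Rpower (2 / PI) (2 - al) * Z * powR r (1 - al)) * vnorm x.
Proof.
move=> hal hC hD hT hS hc gT gS hZ hr hA; have PI0 := PI_RGT_0.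
set Ca := Rpower (2 / PI) (2 - al) * Z.
have Ca0 : 0 <= Ca by apply: Rmult_le_pos; [apply: Rlt_le; exact: Rpower_pos | exact: (hZ O)].
have main s : r < s -> vnorm (T x) <= C * (s + Ca * Rpower s (1 - al)) * vnorm x.
(* Two intermediate rates between [r] and [s]: the gap between them is spent in [power_growth], and
   the larger stays strictly below [s], as [q t < PI / 2] requires. *)
{ move=> hs; have [K hK] := hA ((2 * r + s) / 3) ltac:(lra).
  have [K' [_ hK']] := power_growth al T S0 C D x K ((2 * r + s) / 3) ((r + 2 * s) / 3)
    hal hT hS hc hC hD gT gS ltac:(lra) hK.
  pose t := PI / (2 * s); have ht : 0 < t by apply: Rdiv_lt_0_compat; lra.
  have Et : t * s = PI / 2 by rewrite /t; field; lra.
  have [m hm] := bop_bound T hT.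
  have hq : 0 <= (r + 2 * s) / 3 * t < PI / 2 by rewrite -Et; nra.
  have := bernstein_scaled al C T hal hC hT gT t m x ht hm K' ((r + 2 * s) / 3) hq hK' Z hZ.
  rewrite bernstein_constant ?(Rmult_comm (C * vnorm x)); last lra.
  rewrite -/t -/Ca Rmult_assoc => h; have := Rmult_le_reg_l _ _ _ ht h; lra. }
(* The limit towards [r] is taken along the rates [r + 1 / s]. *)
apply: Rminus_le; apply: (le0_of_Rpower_decay _ (C * vnorm x * (1 + Ca)) (1 - al)); first lra.
move=> s hs; have hs' : 0 < / s by apply: Rinv_0_lt_compat; lra.
have h1 := main (r + / s) ltac:(lra).
have h2 := Rpower_subadditive r (/ s) (1 - al) hr hs' ltac:(lra).
have E : Rpower (/ s) (1 - al) = Rpower s (- (1 - al)).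
{ by rewrite /Rpower ln_Rinv; [congr exp; ring | lra]. }
have h3 : / s <= Rpower s (- (1 - al)).
{ rewrite -{1}(Rpower_1 s) -?Rpower_Ropp; last lra.
  by apply: Rle_Rpower; lra. }
rewrite E in h2; have hx := vnorm_ge0 x; have hCx : 0 <= C * vnorm x by apply: Rmult_le_pos; lra.
have h4 : r + / s + Ca * Rpower (r + / s) (1 - al) <=
  r + Rpower s (- (1 - al)) + Ca * (powR r (1 - al) + Rpower s (- (1 - al))).
{ by apply: Rplus_le_compat; [lra | apply: Rmult_le_compat_l]. }
have := Rmult_le_compat_l _ _ _ hCx h4; lra.
Qed.

End Local.

Theorem theorem2p14 (X : CBanach) (T S : X -> X) (alpha CT CS sumZ : R)
  (Halpha : 0 <= alpha < 1)
  (HT : is_bounded_op T) (HS : is_bounded_op S)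
  (Hcomm : forall x, T (S x) = S (T x))
  (HCT : 0 < CT) (HCS : 0 < CS)
  (HexpT : forall t : R, exp_it_bound T t (CT * (1 + powR (Rabs t) alpha)))
  (HexpS : forall t : R, exp_it_bound S t (CS * (1 + powR (Rabs t) alpha)))
  (* sumZ = sum_{k in Z} |2k+1|^{-(2-alpha)}, terms k = n and k = -n-1 paired *)
  (HsumZ : infinite_sum
             (fun n : nat => calpha_term alpha (Z.of_nat n)
                             + calpha_term alpha (- Z.of_nat n - 1)%Z) sumZ) :
  let Calpha := Rpower (2 / PI) (2 - alpha) * sumZ in
  forall (x : X) (r : R),
    is_local_spectral_radius (fun y => vadd (T y) (vscal Ci (S y))) x r ->
    Rmax (vnorm (T x)) (vnorm (S x))
      <= Rmax CT CS * (r + Calpha * powR r (1 - alpha)) * vnorm x.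
Proof.
move=> Calpha x r Hr.
have gT := growth_exp_it_bound alpha T CT HT HexpT.
have gS := growth_exp_it_bound alpha S CS HS HexpS.
have r0 : 0 <= r by apply: (proj1 Hr); left.
have term0 k : 0 <= calpha_term alpha k by apply: Rlt_le; apply: Rpower_pos.
have hZ M : rsum (fun k => calpha_term alpha (Z.of_nat k) + calpha_term alpha (- Z.of_nat k - 1)%Z) M <= sumZ.
{ set f := fun k => _; have f0 k : 0 <= f k by apply: Rplus_le_le_0_compat; exact: term0.
  apply: Rle_trans (rsum_mono f M (Datatypes.S M) f0 ltac:(lia)) _.
  have -> : rsum f (Datatypes.S M) = sum_f_R0 f M.
  { by elim: M => [|M IH]; [rewrite /=; ring | rewrite rsumS IH]. }
  apply: sum_incr => // eps he; have [N hN] := HsumZ eps he; by exists N. }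
have hA : is_bounded_op (opD T (opZ Ci S)) by apply: bop_opD => //; apply: bop_opZ.
have growA : forall s, r < s -> exists K, forall n, vnorm (Nat.iter n (opD T (opZ Ci S)) x) <= K * s ^ n.
{ apply: local_radius_growth => // l c; exact: (ascent alpha Halpha T S CT CS l c). }
have bT := bernstein_local alpha CT CS T S x r sumZ Halpha HCT HCS HT HS Hcomm gT gS hZ r0 growA.
have hT' : is_bounded_op (opZ (Copp C1) T) by apply: bop_opZ.
have gT' : growth alpha (opZ (Copp C1) T) CT by apply: growth_opp.
have hc' : opcomm S (opZ (Copp C1) T) by move=> y; rewrite /opZ (bop_scal _ HS) Hcomm.
(* S - i T = - i (T + i S) has the same power growth as T + i S. *)
have growA' : forall s, r < s -> exists K, forall n,
  vnorm (Nat.iter n (opD S (opZ Ci (opZ (Copp C1) T))) x) <= K * s ^ n.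
{ move=> s hs; have [K hK] := growA s hs; exists K => n.
  have -> : opD S (opZ Ci (opZ (Copp C1) T)) = opZ (Copp Ci) (opD T (opZ Ci S)).
  { apply: functional_extensionality => y; rewrite /opD /opZ vscal_distr_v !vscal_assoc.
    have -> : Cmul (Copp Ci) Ci = C1 by ceq; ring.
    have -> : Cmul Ci (Copp C1) = Copp Ci by ring.
    by rewrite vscal_one vadd_comm. }
  by rewrite iter_opZ // vnorm_scal CnormX CnormN Cnorm_Ci pow1 Rmult_1_l. }
have bS := bernstein_local alpha CS CT S _ x r sumZ Halpha HCS HCT HS hT' hc' gS gT' hZ r0 growA'.
(* Nonnegativity lets [CT] and [CS] be replaced by their maximum. *)
have v0 : 0 <= (r + Calpha * powR r (1 - alpha)) * vnorm x.
{ apply: Rmult_le_pos (vnorm_ge0 _); apply: Rplus_le_le_0_compat => //.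
  apply: Rmult_le_pos (powR_ge0 _ _); apply: Rmult_le_pos (hZ O).
  by apply: Rlt_le; exact: Rpower_pos. }
have m1 := Rmult_le_compat_r _ _ _ v0 (Rmax_l CT CS); have m2 := Rmult_le_compat_r _ _ _ v0 (Rmax_r CT CS).
rewrite -/Calpha in bT bS; apply: Rmax_lub; lra.
Qed.
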